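(* Let $E,F:\mathcal I\to\mathbb R^{m\times m}$ be sufficiently smooth and let the pair $\{E,F\}$ be regular with index $\mu$ and canonical subspaces $S_{can}$ and $N_{can}$, with bases $C_{S_{can}}$ and $C_{N_{can}}$, respectively. Then the adjoint pair $\{-E^*,F^*-{E^*}'\}$ is also regular with the same characteristics. Moreover, with bases $C_{S_{*can}}$, $C_{N_{*can}}$ of its canonical subspaces $S_{*can}$ and $N_{*can}$, it results that (pointwise on $\mathcal I$) $$N_{can}=\ker C_{S_{*can}}^*E,\qquad N_{*can}=\ker C_{S_{can}}^*E^*.$$
   Context: $\mathcal I\subseteq\mathbb R$ is an interval; $E,F:\mathcal I\to\mathbb R^{m\times m}$ are sufficiently smooth (as many continuous derivatives as needed); $^*$ denotes transposition; solutions are continuously differentiable. A basis of a time-varying subspace is a matrix function whose columns at each $t$ form a basis of it (empty matrices allowed). Pre-regularity: A pair $\{E,F\}$ of $m\times m$ matrix functions is pre-regular if, with $N(t)=\ker E(t)$, $S(t)=\{z\in\mathbb R^m:F(t)z\in\operatorname{im}E(t)\}$, one has $\operatorname{im}[E(t)\ F(t)]=\mathbb R^m$, $\operatorname{rank}E(t)=r$, $\dim(N(t)\cap S(t))=\theta$ for all $t\in\mathcal I$ with constant integers $r,\theta$. Reduction and regularity: Set $E_0=E,F_0=F,m_0=m$. If $\{E_i,F_i\}$ (size $m_i\times m_i$) is pre-regular with constants $r_i,\theta_i$, choose bases $Y_i$ of $\operatorname{im}E_i$, $Z_i$ of $(\operatorname{im}E_i)^\perp$ and a $C^1$ basis $C_i:\mathcal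 I\to\mathbb R^{m_i\times r_i}$ of $S_i=\ker Z_i^*F_i$, and put $m_{i+1}=r_i$, $E_{i+1}=Y_i^*E_iC_i$, $F_{i+1}=Y_i^*(F_iC_i+E_iC_i')$; then $\operatorname{rank}E_{i+1}=r_{i+1}=r_i-\theta_i$. A pre-regular pair with $r=r_0<m$ is regular with index $\mu\ge1$ if $\{E_i,F_i\}$, $i=0,\dots,\mu-1$, are well defined and pre-regular, $r_0>\cdots>r_{\mu-1}$, and either $r_{\mu-1}>0$ and $E_\mu$ is pointwise nonsingular, or $r_{\mu-1}=0$. Its characteristics are the index $\mu$ together with $r$ and $\theta_0\ge\cdots\ge\theta_{\mu-2}>\theta_{\mu-1}=0$; they do not depend on the chosen bases. Canonical subspace $S_{can}$: for $\bar t\in\mathcal I$, $S_{can}(\bar t)$ is the set of all $\bar x\in\mathbb R^m$ for which there is a solution $x:(\bar t-\delta,\bar t+\delta)\cap\mathcal I\to\mathbb R^m$ (some $\delta>0$) of $Ex'+Fx=0$ with $x(\bar t)=\bar x$. Canonical subspace $N_{can}$: Let $E=AD$ be a proper factorization: $A:\mathcal I\to\mathbb R^{m\times k}$ continuous, $D:\mathcal I\to\mathbb R^{k\times m}$ continuously differentiable, $\ker A$ and $\operatorname{im}D$ are $C^1$-subspaces of $\mathbb R^k$ (the orthogonal projector functions onto them are continuously differentiable), $\ker A\oplus\operatorname{im}D=\mathbb R^k$. Put $B=F-AD'$; let $R$ be the projector function onto $\operatorname{im}D$ along $\ker A$, $Q_0$ a continuously differentiable projector function onto $\ker E$, $P_0=I-Q_0$,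 and $D^-$ determined by $D^-DD^-=D^-$, $DD^-D=D$, $DD^-=R$, $D^-D=P_0$. Set $G_0=AD$, $B_0=B$, $\Pi_0=P_0$, $N_0=\ker G_0$. A sequence $G_0,\dots,G_\kappa$ is admissible if for $i=1,\dots,\kappa$: $G_i=G_{i-1}+B_{i-1}Q_{i-1}$, $B_i=B_{i-1}P_{i-1}-G_iD^-(D\Pi_iD^-)'D\Pi_{i-1}$, $N_i=\ker G_i$, $\widehat N_i=(N_0+\cdots+N_{i-1})\cap N_i$, $N_0+\cdots+N_{i-1}=\widehat N_i\oplus X_i$, $Q_i$ is a projector function with $\operatorname{im}Q_i=N_i$, $X_i\subseteq\ker Q_i$, $P_i=I-Q_i$, $\Pi_i=\Pi_{i-1}P_i$; and additionally all $G_i$ have constant rank, all $\widehat N_i$ have constant dimension, all $\Pi_i$ are continuous and all $D\Pi_iD^-$ are continuously differentiable. For a regular pair with index $\mu$ there is an admissible sequence $G_0,\dots,G_\mu$ with $G_\mu$ pointwise nonsingular, and $$N_{can}=\ker\Pi_{\mu-1}=N_0\oplus N_1\oplus\cdots\oplus N_{\mu-1},$$ which does not depend on the choice of factorization or admissible projector functions, and $\mathbb R^m=S_{can}\oplus N_{can}$ pointwise. $S_{*can}$ and $N_{*can}$ denote the subspaces obtained by the same definitions from the adjoint pair $\{-E^*,F^*-{E^*}'\}$, i.e. from the adjoint DAE $-E^*y'+(F^*-{E^*}')y=0$. *)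

(* Defs.v *)
From HB Require Import structures.
From mathcomp Require Import all_boot all_order all_algebra.
From mathcomp Require Import all_classical all_reals all_analysis.

Set Implicit Arguments.
Unset Strict Implicit.
Unset Printing Implicit Defensive.

Import Order.TTheory GRing.Theory Num.Theory.
Import numFieldNormedType.Exports.
Local Open Scope classical_set_scope.
Local Open Scope ring_scope.

(* Matrix functions are total functions [R -> 'M[R]_(p, q)]; only their values
   on the interval [I] matter.  MathComp-Analysis defines derivatives through
   two-sided neighbourhoods, whereas [I] may contain its endpoints; hence the
   derivative relative to [I], one-sided at an endpoint. *)
Section Calculus.
Context {R : realType}.
Implicit Types (I : set R) (f : R -> R) (t : R).

Definition diff_quot f t : R -> R := fun s => (s - t)^-1 * (f s - f t).

Definition derivable_in I f t : Prop :=
  cvg (diff_quot f t s @[s --> within I t^']).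

Definition deriv_in I f t : R := lim (diff_quot f t s @[s --> within I t^']).

Fixpoint Cn I (n : nat) f : Prop :=
  if n is n'.+1 then
    (forall t, I t -> derivable_in I f t) /\ Cn I n' (deriv_in I f)
  else {within I, continuous f}.

Definition mxderiv I p q (M : R -> 'M[R]_(p, q)) t : 'M[R]_(p, q) :=
  \matrix_(i, j) deriv_in I (fun s => M s i j) t.

Definition mxCn I (n : nat) p q (M : R -> 'M[R]_(p, q)) : Prop :=
  forall i j, Cn I n (fun s => M s i j).

End Calculus.

Section Subspaces.
Context {R : realType}.
Implicit Types (I : set R) (p q n k : nat).

Definition kerc p q (M : 'M[R]_(p, q)) : {vspace 'cV[R]_q} :=
  lker (linfun (mulmx M : 'cV[R]_q -> 'cV[R]_p)).

Definition imc p q (M : 'M[R]_(p, q)) : {vspace 'cV[R]_p} :=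
  limg (linfun (mulmx M : 'cV[R]_q -> 'cV[R]_p)).

Definition orthoc n (V : {vspace 'cV[R]_n}) : set 'cV[R]_n :=
  [set z | forall x, x \in V -> z^T *m x = 0].

(* A time-varying subspace is set-valued here because the canonical subspace
   [Scan] is given by a solvability property, not as a [{vspace _}]. *)
Definition basis_on I n k (M : R -> 'M[R]_(n, k)) (V : R -> set 'cV[R]_n) :=
  forall t, I t ->
    let cols := [seq col j (M t) | j : 'I_k] in
    free cols /\ [set` <<cols>>%VS] = V t.

Definition projects_on n (P : 'M[R]_n) (V : {vspace 'cV[R]_n}) : Prop :=
  P *m P = P /\ imc P = V.

Definition C1_subspace I n (V : R -> {vspace 'cV[R]_n}) : Prop :=
  exists P : R -> 'M[R]_n, mxCn I 1 P /\
    forall t, I t -> projects_on (P t) (V t) /\ (P t)^T = P t.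

End Subspaces.

Section Regularity.
Context {R : realType}.
Implicit Types (I : set R).

Definition Sspace m (E F : 'M[R]_m) : {vspace 'cV[R]_m} :=
  (linfun (mulmx F : 'cV[R]_m -> 'cV[R]_m) @^-1: imc E)%VS.

Definition pre_regular I m (E F : R -> 'M[R]_m) (r theta : nat) : Prop :=
  forall t, I t ->
    [/\ imc (row_mx (E t) (F t)) = fullv,
        \rank (E t) = r
      & \dim (kerc (E t) :&: Sspace (E t) (F t)) = theta].

Definition reduction_step I m r (E F : R -> 'M[R]_m) (E1 F1 : R -> 'M[R]_r) :=
  exists (Y : R -> 'M[R]_(m, r)) (Z : R -> 'M[R]_(m, m - r))
         (C : R -> 'M[R]_(m, r)),
    [/\ basis_on I Y (fun t => [set` imc (E t)]),
        basis_on I Z (fun t => orthoc (imc (E t))),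
        basis_on I C (fun t => [set` kerc ((Z t)^T *m F t)]),
        mxCn I 1 C
      & forall t, I t ->
          E1 t = (Y t)^T *m E t *m C t /\
          F1 t = (Y t)^T *m (F t *m C t + E t *m mxderiv I C t)].

(* The sizes m_0 = m, m_(i+1) = r_i of the successively reduced pairs. *)
Definition red_size (m : nat) (r : nat -> nat) (i : nat) : nat :=
  if i is j.+1 then r j else m.

(* The pair [E, F] is regular with characteristics [mu], [r] and
   [theta 0, ..., theta mu.-1] (further values of [theta] are irrelevant).
   The characteristics do not depend on the bases chosen in the steps. *)
Definition regular I m (E F : R -> 'M[R]_m) (mu r : nat) (theta : nat -> nat) :=
  exists (rs : nat -> nat) (Es Fs : forall i, R -> 'M[R]_(red_size m rs i)),
    let step i := reduction_step I (r := rs i)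
                    (Es i) (Fs i) (Es i.+1) (Fs i.+1) in
    [/\ [/\ Es 0%N = E, Fs 0%N = F & rs 0%N = r],
        (0 < mu)%N /\ (r < m)%N,
        forall i, (i.+1 < mu)%N -> step i /\ (rs i.+1 < rs i)%N,
        forall i, (i < mu)%N -> pre_regular I (Es i) (Fs i) (rs i) (theta i)
      & ((0 < rs mu.-1)%N /\ step mu.-1 /\
           forall t, I t -> (Es mu.-1.+1 t : 'M[R]_(rs mu.-1)) \in unitmx) \/
        rs mu.-1 = 0%N].

End Regularity.

Section Adjoint.
Context {R : realType} (I : set R) (m : nat) (E F : R -> 'M[R]_m).

Definition adjE (t : R) : 'M[R]_m := - (E t)^T.

Definition adjF (t : R) : 'M[R]_m :=
  (F t)^T - mxderiv I (fun s => (E s)^T) t.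

End Adjoint.

Section CanonicalSubspaces.
Context {R : realType}.
Implicit Types (I : set R).

Definition Scan I m (E F : R -> 'M[R]_m) (t : R) : set 'cV[R]_m :=
  [set xbar | exists (delta : R) (x : R -> 'cV[R]_m),
    let J := `]t - delta, t + delta[ `&` I in
    [/\ 0 < delta, mxCn J 1 x, x t = xbar
      & forall s, J s -> E s *m mxderiv J x s + F s *m x s = 0]].

Definition proper_factorization I m k (E : R -> 'M[R]_m)
    (A : R -> 'M[R]_(m, k)) (D : R -> 'M[R]_(k, m)) : Prop :=
  [/\ forall t, I t -> E t = A t *m D t,
      mxCn I 0 A /\ mxCn I 1 D,
      C1_subspace I (fun t => kerc (A t)),
      C1_subspace I (fun t => imc (D t))
    & forall t, I t -> (kerc (A t) + imc (D t) = fullv)%VS /\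
                       (kerc (A t) :&: imc (D t) = 0)%VS].

(* [Dm] is the generalized inverse D^-; the projector onto im D along ker A is
   expressed as [D t *m Dm t]. *)
Definition generalized_inverse I m k (A : R -> 'M[R]_(m, k))
    (D : R -> 'M[R]_(k, m)) (P0 : R -> 'M[R]_m) (Dm : R -> 'M[R]_(m, k)) :=
  forall t, I t ->
    [/\ Dm t *m D t *m Dm t = Dm t,
        D t *m Dm t *m D t = D t,
        projects_on (D t *m Dm t) (imc (D t)) /\
          kerc (D t *m Dm t) = kerc (A t)
      & Dm t *m D t = P0 t].

Section MatrixSequence.
Variables (I : set R) (m k : nat) (F : R -> 'M[R]_m).
Variables (A : R -> 'M[R]_(m, k)) (D : R -> 'M[R]_(k, m)).
Variables (Dm : R -> 'M[R]_(m, k)) (Q : nat -> R -> 'M[R]_m).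

Definition seqP (i : nat) (t : R) : 'M[R]_m := 1%:M - Q i t.

Fixpoint seqPi (i : nat) (t : R) : 'M[R]_m :=
  if i is j.+1 then seqPi j t *m seqP j.+1 t else seqP 0 t.

Definition DPiD (i : nat) (t : R) : 'M[R]_k := D t *m seqPi i t *m Dm t.

(* The pair (G_i, B_i). *)
Fixpoint seqGB (i : nat) : (R -> 'M[R]_m) * (R -> 'M[R]_m) :=
  if i is j.+1 then
    let: (G, B) := seqGB j in
    let G1 t := G t + B t *m Q j t in
    (G1, fun t => B t *m seqP j t
                  - G1 t *m Dm t *m mxderiv I (DPiD j.+1) t *m D t *m seqPi j t)
  else (fun t => A t *m D t, fun t => F t - A t *m mxderiv I D t).

Definition seqG (i : nat) : R -> 'M[R]_m := (seqGB i).1.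

Definition seqN (i : nat) (t : R) : {vspace 'cV[R]_m} := kerc (seqG i t).

(* N_0 + ... + N_(i-1) *)
Definition sumN (i : nat) (t : R) : {vspace 'cV[R]_m} :=
  (\sum_(j < i) seqN j t)%VS.

Definition hatN (i : nat) (t : R) : {vspace 'cV[R]_m} :=
  (sumN i t :&: seqN i t)%VS.

Definition admissible_sequence (kappa : nat) : Prop :=
  [/\ forall i t, (0 < i <= kappa)%N -> I t ->
        projects_on (Q i t) (seqN i t) /\
        exists X : {vspace 'cV[R]_m},
          [/\ (hatN i t + X = sumN i t)%VS, (hatN i t :&: X = 0)%VS
            & (X <= kerc (Q i t))%VS],
      forall i, (i <= kappa)%N ->
        exists r : nat, forall t, I t -> \rank (seqG i t) = r,
      forall i, (0 < i <= kappa)%N ->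
        exists u : nat, forall t, I t -> \dim (hatN i t) = u,
      forall i, (i <= kappa)%N -> mxCn I 0 (seqPi i)
    & forall i, (i <= kappa)%N -> mxCn I 1 (DPiD i)].

End MatrixSequence.

(* For a regular pair of index [mu] the kernel of [seqPi Q mu.-1] is the same
   subspace for all choices of the existentially quantified data. *)
Definition Ncan I m (E F : R -> 'M[R]_m) (mu : nat) (t : R) : set 'cV[R]_m :=
  [set x | exists (k : nat) (A : R -> 'M[R]_(m, k)) (D : R -> 'M[R]_(k, m))
                  (Dm : R -> 'M[R]_(m, k)) (Q : nat -> R -> 'M[R]_m),
    [/\ proper_factorization I E A D,
        mxCn I 1 (Q 0%N) /\
          (forall s, I s -> projects_on (Q 0%N s) (kerc (E s))),
        generalized_inverse I A D (seqP Q 0) Dm,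
        admissible_sequence I F A D Dm Q mu /\
          (forall s, I s -> seqG I F A D Dm Q mu s \in unitmx)
      & x \in kerc (seqPi Q mu.-1 t)]].

End CanonicalSubspaces.

(* Main.v *)
Require Import Defs.
From HB Require Import structures.
From mathcomp Require Import all_boot all_order all_algebra.
From mathcomp Require Import all_classical all_reals all_analysis.
From mathcomp Require Import ring lra zify.

Set Implicit Arguments.
Unset Strict Implicit.
Unset Printing Implicit Defensive.

Import Order.TTheory GRing.Theory Num.Theory.
Import numFieldNormedType.Exports.
Local Open Scope classical_set_scope.
Local Open Scope ring_scope.

(* Regularity of the adjoint pair. Reducing a pair X commutes with reducing its
   adjoint: in a normal form of X, the reduction of X followed by the dual
   reduction (adjoin, reduce, adjoin) is the same pair as the dual reduction
   followed by the reduction. An induction on the index then transfers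
   regularity, and the characteristics, from X to its adjoint.

   Duality of the canonical subspaces. Let G_i, B_i, Pi_i belong to an admissible
   sequence and let y solve the adjoint equation. With v = y^T A one finds
   y^T G_i = v D and y^T B_i = v' D Pi_i by induction on i, so that y^T E
   annihilates ker Pi_{mu-1} = N_can. Conversely, since G_mu is nonsingular, every
   row vector in the row space of D Pi_{mu-1} is y^T E for the adjoint solution
   y^T = w D G_mu^{-1}, where w solves a linear differential equation. This y is a
   priori only continuous; regularity of the adjoint pair makes it C^1. *)

(** * Calculus relative to a set of reals *)

Section RelativeCalculus.
Context {R : realType}.
Implicit Types (I J : set R) (f g : R -> R) (t : R).

(** The obstacle is a rank that the pair itself does not show. In normal form, pre-regularity
    amounts to full rank of [F21], whereas the adjoint needs full rank of [F12]. This becomes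
    visible one level down: [F12^T] is the constraint block of the adjoint of the reduced pair,
    which is pre-regular by induction. Only then can the dual reduction be formed. The common pair
    reached by both routes has index two less than the original, so the induction is strong.

    Regularity is handled through the recursive predicate [Reg], in which both ways of ending the
    chain become the condition that the last [theta] is zero. It is invariant under equivalence, so
    bases can be chosen at will at each level.

    Each level costs two derivatives: one for [K'] in the passage to the normal form, one for [c']
    in the reduction. Hence the multiple of [mu] in the smoothness bound.

    Constant rank gives smooth bases only locally. Orthogonal projectors are unique and therefore
    glue; a linear differential equation then carries a basis of their range along the whole
    interval. *)

Definition no_isolated I := forall t, I t -> ProperFilter (within I t^').

Definition has_deriv I f t l := diff_quot f t s @[s --> within I t^'] --> (l : R).

Definition cont_at I f t := f s @[s --> within I (nbhs t)] --> f t.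

Lemma Cn0P I f : Cn I 0 f <-> forall t, I t -> cont_at I f t.
Proof. exact: subspace_continuousP. Qed.

Lemma no_isolatedP I :
  (forall t, I t -> forall d : R, 0 < d -> exists s, [/\ I s, s != t & `|s - t| < d]) ->
  no_isolated I.
Proof.
move=> H t It; apply: Build_ProperFilter_ex => A /nbhs_ballP [d /= d0 Hd].
have [s [Is st sd]] := H t It d d0.
exists s; apply: Hd => //.
by rewrite -ball_normE /= distrC.
Qed.

Lemma has_deriv_in I f t l : no_isolated I -> I t ->
  has_deriv I f t l -> derivable_in I f t /\ deriv_in I f t = l.
Proof.
move=> nI It H; have pf := nI t It; split.
  by apply/cvg_ex; exists l.
by apply/cvg_lim => //; exact: Rhausdorff.
Qed.

Lemma deriv_inP I f t : derivable_in I f t -> has_deriv I f t (deriv_in I f t).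
Proof. by []. Qed.

Lemma has_deriv_ext I f g t l : (forall s, I s -> f s = g s) -> I t ->
  has_deriv I f t l -> has_deriv I g t l.
Proof.
move=> fg It; apply: cvg_trans; apply: near_eq_cvg.
near=> s; rewrite /diff_quot !fg //.
by near: s; exact: withinT.
Unshelve. all: by end_near. Qed.

(** Multiplying the quotient by [s - t] gives an estimate that also holds at [s = t]. Restriction
    and localisation then only change which points [s] are tested. *)
Lemma has_derivP I f t l : has_deriv I f t l <->
  forall e : R, 0 < e -> exists2 d : R, 0 < d &
    forall s, I s -> `|s - t| < d -> `|f s - f t - l * (s - t)| <= e * `|s - t|.
Proof.
split=> [H e e0|H].
  move/cvgrPdist_le: H => /(_ e e0) /nbhs_ballP [d /= d0 Hd].
  exists d => // s Is sd; have [->|st] := eqVneq s t.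
    by rewrite !subrr mulr0 subr0 normr0 mulr0.
  have := Hd s; rewrite -ball_normE /= distrC => /(_ sd st Is).
  rewrite /diff_quot => h.
  have st0 : s - t != 0 by rewrite subr_eq0.
  have -> : f s - f t - l * (s - t) =
      - ((l - (s - t)^-1 * (f s - f t)) * (s - t)) by field.
  by rewrite normrN normrM ler_wpM2r.
apply/cvgrPdist_le => e e0; have [d d0 Hd] := H e e0.
apply/nbhs_ballP; exists d => //= s; rewrite -ball_normE /= distrC => sd st Is.
have st0 : s - t != 0 by rewrite subr_eq0.
rewrite /diff_quot -(ler_pM2r (x := `|s - t|)) ?normr_gt0 // -normrM.
have -> : (l - (s - t)^-1 * (f s - f t)) * (s - t) =
   - (f s - f t - l * (s - t)) by field.
by rewrite normrN Hd.
Qed.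

Lemma cont_atP I f t : cont_at I f t <->
  forall e : R, 0 < e -> exists2 d : R, 0 < d &
    forall s, I s -> `|s - t| < d -> `|f s - f t| < e.
Proof.
split=> [H e e0|H].
  move/cvgrPdist_lt: H => /(_ e e0) /nbhs_ballP [d /= d0 Hd].
  exists d => // s Is sd; rewrite distrC; apply: Hd => //.
  by rewrite -ball_normE /= distrC.
apply/cvgrPdist_lt => e e0; have [d d0 Hd] := H e e0.
apply/nbhs_ballP; exists d => //= s; rewrite -ball_normE /= distrC => sd Is.
by rewrite distrC; exact: Hd.
Qed.

Lemma has_deriv_cont I f t l : has_deriv I f t l -> cont_at I f t.
Proof.
move/has_derivP => H; apply/cont_atP => e e0.
have [d d0 Hd] := H 1 ltr01.
have k0 : 0 < `|l| + 2 by rewrite ltr_wpDl.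
exists (Num.min d (e / (`|l| + 2))).
  by rewrite lt_min d0 divr_gt0.
move=> s Is; rewrite lt_min => /andP[sd se].
have h := Hd s Is sd; rewrite mul1r in h.
have -> : f s - f t = (f s - f t - l * (s - t)) + l * (s - t) by ring.
apply: le_lt_trans (ler_normD _ _) _; rewrite normrM.
apply: (@le_lt_trans _ _ ((`|l| + 1) * `|s - t|)).
  by rewrite mulrDl mul1r addrC lerD2l.
rewrite ltr_pdivlMr // in se.
apply: le_lt_trans se; rewrite mulrC ler_wpM2l //; lra.
Qed.

Lemma within_dnbhs_le I t : within I t^' `=>` within I (nbhs t).
Proof. by move=> A [d /= d0 H]; exists d => //= s sd st Is; exact: H. Qed.

Lemma has_derivD I f g t k l : has_deriv I f t k -> has_deriv I g t l ->
  has_deriv I (fun s => f s + g s) t (k + l).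
Proof.
move=> Hf Hg; rewrite /has_deriv.
rewrite (_ : diff_quot _ t = fun s => diff_quot f t s + diff_quot g t s).
  exact: cvgD.
by apply/funext => s; rewrite /diff_quot; ring.
Qed.

Lemma has_derivN I f t k : has_deriv I f t k -> has_deriv I (fun s => - f s) t (- k).
Proof.
move=> Hf; rewrite /has_deriv.
rewrite (_ : diff_quot _ t = fun s => - diff_quot f t s).
  exact: cvgN.
by apply/funext => s; rewrite /diff_quot; ring.
Qed.

Lemma has_derivM I f g t k l : has_deriv I f t k -> has_deriv I g t l ->
  has_deriv I (fun s => f s * g s) t (k * g t + f t * l).
Proof.
move=> Hf Hg; have cg := has_deriv_cont Hg; rewrite /has_deriv.
rewrite (_ : diff_quot _ t = fun s => diff_quot f t s * g s + f t * diff_quot g t s).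
  apply: cvgD; apply: cvgM => //; last exact: cvg_cst.
  exact: cvg_trans (cvg_app _ (@within_dnbhs_le I t)) cg.
by apply/funext => s; rewrite /diff_quot; ring.
Qed.

Lemma has_deriv_cst I c t : has_deriv I (fun=> c) t 0.
Proof.
rewrite /has_deriv (_ : diff_quot _ t = fun=> 0); first exact: cvg_cst.
by apply/funext => s; rewrite /diff_quot subrr mulr0.
Qed.

Lemma has_deriv_id I t : has_deriv I (fun s => s) t 1.
Proof.
by apply/has_derivP => e e0; exists 1 => // s _ _; rewrite mul1r subrr normr0 mulr_ge0 // ltW.
Qed.

Lemma has_derivV I f t k : f t != 0 -> has_deriv I f t k ->
  has_deriv I (fun s => (f s)^-1) t (- k * ((f t)^-1 * (f t)^-1)).
Proof.
move=> ft0 Hf; have cf := has_deriv_cont Hf; rewrite /has_deriv.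
have cfi : (f s)^-1 @[s --> within I t^'] --> (f t)^-1.
  apply: cvgV => //; exact: cvg_trans (cvg_app _ (@within_dnbhs_le I t)) cf.
have : - (diff_quot f t s) * ((f s)^-1 * (f t)^-1) @[s --> within I t^'] -->
    - k * ((f t)^-1 * (f t)^-1).
  by apply: cvgM; [exact: cvgN|apply: cvgM => //; exact: cvg_cst].
apply: cvg_trans; apply: near_eq_cvg.
have : \forall s \near within I (nbhs t), `|f s - f t| < `|f t|.
  move/cont_atP: cf => /(_ `|f t|); rewrite normr_gt0 => /(_ ft0) [d d0 Hd].
  apply/nbhs_ballP; exists d => //= s; rewrite -ball_normE /= distrC => sd Is.
  exact: Hd.
move/(@within_dnbhs_le I t); apply: filterS => s fs.
have fs0 : f s != 0.
  by apply/eqP => fs0; rewrite fs0 sub0r normrN ltxx in fs.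
by rewrite /diff_quot; have [->|st] := eqVneq s t; [rewrite !subrr; ring | field; rewrite fs0 ft0 subr_eq0 st].
Qed.

Lemma has_deriv_sub I J f t l : J `<=` I -> has_deriv I f t l -> has_deriv J f t l.
Proof.
move=> JI /has_derivP H; apply/has_derivP => e /H [d d0 Hd].
by exists d => // s /JI; exact: Hd.
Qed.

Lemma cont_at_sub I J f t : J `<=` I -> cont_at I f t -> cont_at J f t.
Proof.
move=> JI /cont_atP H; apply/cont_atP => e /H [d d0 Hd].
by exists d => // s /JI; exact: Hd.
Qed.

(** The set [J] is a neighbourhood of [t] relative to [I], so limits along [J] at [t] decide those
    along [I]. *)
Definition rel_nbhs I J t := exists2 d : R, 0 < d & forall s, I s -> `|s - t| < d -> J s.

Lemma has_deriv_local I J f t l : rel_nbhs I J t ->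
  has_deriv J f t l -> has_deriv I f t l.
Proof.
move=> [d0 d00 HJ] /has_derivP H; apply/has_derivP => e /H [d dp Hd].
exists (Num.min d d0); first by rewrite lt_min dp.
by move=> s Is; rewrite lt_min => /andP[sd sd0]; apply: Hd => //; apply: HJ.
Qed.

Lemma cont_at_local I J f t : rel_nbhs I J t -> cont_at J f t -> cont_at I f t.
Proof.
move=> [d0 d00 HJ] /cont_atP H; apply/cont_atP => e /H [d dp Hd].
exists (Num.min d d0); first by rewrite lt_min dp.
by move=> s Is; rewrite lt_min => /andP[sd sd0]; apply: Hd => //; apply: HJ.
Qed.

Lemma Cn_ext I n f g : (forall s, I s -> f s = g s) -> Cn I n f -> Cn I n g.
Proof.
elim: n f g => [|n IH] f g fg.
  move=> /Cn0P H; apply/Cn0P => t It; have /cont_atP {}H := H t It.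
  apply/cont_atP => e /H [d d0 Hd]; exists d => // s Is sd.
  by rewrite -!fg //; exact: Hd.
(* [deriv_in] is a bare [lim]: equality of the image filters gives equality of the derivatives
   without any convergence. *)
have E t : I t -> diff_quot f t s @[s --> within I t^'] = diff_quot g t s @[s --> within I t^'].
  have nIs : \forall s \near within I t^', I s by exact: withinT.
  move=> It; apply/seteqP; split => A /=; apply: filterS2 nIs => s Is;
    by rewrite /= /diff_quot !fg.
move=> /= [df Cf]; split.
  by move=> t It; rewrite /derivable_in -E //; exact: df.
by apply: IH Cf => s Is; rewrite /deriv_in E.
Qed.

Section NoIsolated.
Variable I : set R.
Hypothesis nI : no_isolated I.

Lemma CnSP n f : Cn I n.+1 f <->
  exists2 f', (forall t, I t -> has_deriv I f t (f' t)) & Cn I n f'.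
Proof.
split=> [[df Cf]|[f' Hf Cf]]; first by exists (deriv_in I f).
split; first by move=> t It; have [] := has_deriv_in nI It (Hf t It).
by apply: Cn_ext Cf => s Is; have [_ ->] := has_deriv_in nI Is (Hf s Is).
Qed.

Lemma CnS n f : Cn I n.+1 f -> Cn I n f.
Proof.
elim: n f => [|n IH] f /CnSP [f' Hf Cf].
  by apply/Cn0P => t It; exact: has_deriv_cont (Hf t It).
by apply/CnSP; exists f' => //; exact: IH.
Qed.

Lemma Cn_le n k f : (n <= k)%N -> Cn I k f -> Cn I n f.
Proof. by move=> /subnK <-; elim: (k - n)%N => // d IH /CnS. Qed.

Lemma Cn_cont n f t : I t -> Cn I n f -> cont_at I f t.
Proof. by move=> It /(Cn_le (leq0n n)) /Cn0P; exact. Qed.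

Lemma Cn_cst n c : Cn I n (fun=> c).
Proof.
elim: n c => [|n IH] c; first by apply/Cn0P => t It; exact: cvg_cst.
by apply/CnSP; exists (fun=> 0) => // t It; exact: has_deriv_cst.
Qed.

Lemma CnD n f g : Cn I n f -> Cn I n g -> Cn I n (fun s => f s + g s).
Proof.
elim: n f g => [|n IH] f g.
  by move=> /Cn0P Hf /Cn0P Hg; apply/Cn0P => t It; apply: cvgD; [exact: Hf|exact: Hg].
move=> /CnSP [f' Hf Cf] /CnSP [g' Hg Cg]; apply/CnSP.
by exists (fun s => f' s + g' s); [move=> t It; apply: has_derivD; auto|exact: IH].
Qed.

Lemma CnN n f : Cn I n f -> Cn I n (fun s => - f s).
Proof.
elim: n f => [|n IH] f.
  by move=> /Cn0P Hf; apply/Cn0P => t It; apply: cvgN; exact: Hf.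
move=> /CnSP [f' Hf Cf]; apply/CnSP.
by exists (fun s => - f' s); [move=> t It; apply: has_derivN; auto|exact: IH].
Qed.

Lemma CnM n f g : Cn I n f -> Cn I n g -> Cn I n (fun s => f s * g s).
Proof.
elim: n f g => [|n IH] f g.
  by move=> /Cn0P Hf /Cn0P Hg; apply/Cn0P => t It; apply: cvgM; [exact: Hf|exact: Hg].
move=> Hf0 Hg0; have f0 := CnS Hf0; have g0 := CnS Hg0.
move: Hf0 Hg0 => /CnSP [f' Hf Cf] /CnSP [g' Hg Cg]; apply/CnSP.
exists (fun s => f' s * g s + f s * g' s).
  by move=> t It; apply: has_derivM; auto.
by apply: CnD; apply: IH.
Qed.

Lemma CnV n f : (forall t, I t -> f t != 0) -> Cn I n f -> Cn I n (fun s => (f s)^-1).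
Proof.
move=> f0; elim: n f f0 => [|n IH] f f0.
  by move=> /Cn0P Hf; apply/Cn0P => t It; apply: cvgV; [exact: f0|exact: Hf].
move=> Hf0; have Cf0 := CnS Hf0.
move: Hf0 => /CnSP [f' Hf Cf]; apply/CnSP.
exists (fun s => - f' s * ((f s)^-1 * (f s)^-1)).
  by move=> t It; apply: has_derivV; auto.
by apply: CnM; [exact: CnN|apply: CnM; apply: IH].
Qed.

Lemma Cn_sum n (T : Type) (r : seq T) (P : pred T) (F : T -> R -> R) :
  (forall i, P i -> Cn I n (F i)) -> Cn I n (fun s => \sum_(i <- r | P i) F i s).
Proof.
move=> H; elim: r => [|x r IH].
  by apply: Cn_ext (Cn_cst n 0) => s _; rewrite big_nil.
have [Px|Px] := boolP (P x).
  by apply: Cn_ext (CnD (H x Px) IH) => s _; rewrite big_cons Px.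
by apply: Cn_ext IH => s _; rewrite big_cons (negbTE Px).
Qed.

Lemma Cn_prod n (T : Type) (r : seq T) (P : pred T) (F : T -> R -> R) :
  (forall i, P i -> Cn I n (F i)) -> Cn I n (fun s => \prod_(i <- r | P i) F i s).
Proof.
move=> H; elim: r => [|x r IH].
  by apply: Cn_ext (Cn_cst n 1) => s _; rewrite big_nil.
have [Px|Px] := boolP (P x).
  by apply: Cn_ext (CnM (H x Px) IH) => s _; rewrite big_cons Px.
by apply: Cn_ext IH => s _; rewrite big_cons (negbTE Px).
Qed.

Lemma has_deriv_sum (T : Type) (r : seq T) (P : pred T) (F : T -> R -> R) (F' : T -> R) t :
  (forall i, P i -> has_deriv I (F i) t (F' i)) -> I t ->
  has_deriv I (fun s => \sum_(i <- r | P i) F i s) t (\sum_(i <- r | P i) F' i).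
Proof.
move=> H It; elim: r => [|x r IH].
  by rewrite big_nil; apply: has_deriv_ext (has_deriv_cst I 0 t) => // s _; rewrite big_nil.
rewrite big_cons; have [Px|Px] := boolP (P x).
  by apply: has_deriv_ext (has_derivD (H x Px) IH) => // s _; rewrite big_cons Px.
by apply: has_deriv_ext IH => // s _; rewrite big_cons (negbTE Px).
Qed.

Lemma Cn_restrict J n f : no_isolated J -> J `<=` I -> Cn I n f -> Cn J n f.
Proof.
move=> nJ JI; elim: n f => [|n IH] f.
  move=> /Cn0P H; apply/Cn0P => t Jt; apply: (cont_at_sub JI); apply: H; exact: JI.
move=> /CnSP [f' Hf Cf].
split; last first.
  apply: Cn_ext (IH _ Cf) => s Js.
  by have [_ ->] := has_deriv_in nJ Js (has_deriv_sub JI (Hf s (JI _ Js))).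
by move=> t Jt; have [] := has_deriv_in nJ Jt (has_deriv_sub JI (Hf t (JI _ Jt))).
Qed.

End NoIsolated.

(** On a relatively open [J] the derivatives relative to [I] and to [J] agree, so the derivative
    inherits the local hypothesis with the same sets [J]. *)
Lemma Cn_local I n f : no_isolated I ->
  (forall t, I t -> exists J, [/\ no_isolated J, J `<=` I, J t,
     (forall s, J s -> rel_nbhs I J s) & Cn J n f]) -> Cn I n f.
Proof.
move=> nI; elim: n f => [|n IH] f H.
  apply/Cn0P => t It; have [J [nJ JI Jt HJ Cf]] := H t It.
  by apply: cont_at_local (HJ t Jt) _; move/Cn0P: Cf; exact.
have E J t : no_isolated J -> J `<=` I -> J t -> (forall s, J s -> rel_nbhs I J s) ->
    Cn J n.+1 f -> derivable_in I f t /\ deriv_in I f t = deriv_in J f t.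
  move=> nJ JI Jt HJ [df _].
  exact: has_deriv_in (JI _ Jt) (has_deriv_local (HJ t Jt) (deriv_inP (df t Jt))).
split.
  by move=> t It; have [J [nJ JI Jt HJ Cf]] := H t It; have [] := E J t nJ JI Jt HJ Cf.
apply: IH => t It; have [J [nJ JI Jt HJ Cf]] := H t It; exists J; split => //.
apply: Cn_ext Cf.2 => s Js; by have [] := E J s nJ JI Js HJ Cf.
Qed.

End RelativeCalculus.

(** * Calculus of matrix functions *)

Section MatrixCalculus.
Context {R : realType}.
Implicit Types (I J : set R) (t : R) (n p q r : nat).

Definition mx_has_deriv I p q (M : R -> 'M[R]_(p, q)) t (M' : 'M[R]_(p, q)) :=
  forall i j, has_deriv I (fun s => M s i j) t (M' i j).

Definition nondeg_itv I := is_interval I /\ exists a b : R, [/\ I a, I b & a < b].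

Lemma nondeg_no_isolated I : nondeg_itv I -> no_isolated I.
Proof.
move=> [iI [a [b [Ia Ib ab]]]]; apply: no_isolatedP => t It d d0.
have H m : 0 < m -> m <= d / 2 -> forall s, (s = t + m \/ s = t - m) -> s != t /\ `|s - t| < d.
  move=> m0 md s hs; rewrite -subr_eq0 -normr_gt0.
  have -> : `|s - t| = m.
    by case: hs => ->; rewrite addrC addKr ?normrN gtr0_norm.
  by split; lra.
have [ta|at_] := ltP t b.
  have [m m0 /andP[md mb]] : exists2 m, 0 < m & (m <= d / 2) && (m <= b - t).
    by exists (Num.min (d / 2) (b - t)); [rewrite lt_min; apply/andP; split; lra|rewrite -le_min].
  exists (t + m); have [? ?] := H m m0 md _ (or_introl erefl); split => //.
  by apply: iI It Ib _ _; apply/andP; split; lra.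
have [m m0 /andP[md mb]] : exists2 m, 0 < m & (m <= d / 2) && (m <= t - a).
  by exists (Num.min (d / 2) (t - a)); [rewrite lt_min; apply/andP; split; lra|rewrite -le_min].
exists (t - m); have [? ?] := H m m0 md _ (or_intror erefl); split => //.
by apply: iI Ia It _ _; apply/andP; split; lra.
Qed.

Lemma nondeg_itvI I t d : nondeg_itv I -> I t -> 0 < d -> nondeg_itv (`]t - d, t + d[ `&` I).
Proof.
move=> nI It d0; have niI := nondeg_no_isolated nI; move: nI => [iI _].
have ii : is_interval (`]t - d, t + d[ `&` I).
  move=> x y [/= + Ix] [/= + Iy] z /andP[xz zy].
  rewrite !in_itv /= => /andP[? ?] /andP[? ?]; split => /=.
    rewrite ?in_itv /=; apply/andP; split; lra.
  by apply: iI Ix Iy _ _; rewrite xz.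
split => //.
have Jt : (`]t - d, t + d[ `&` I) t.
  by split => //=; rewrite ?in_itv /=; apply/andP; split; lra.
have [s [Is st sd]] : exists s, [/\ I s, s != t & `|s - t| < d].
  have pf := niI t It.
  have : within I t^' (fun s => [/\ I s, s != t & `|s - t| < d]).
    by apply/nbhs_ballP; exists d => //= s; rewrite -ball_normE /= distrC.
  exact: filter_ex.
have Js : (`]t - d, t + d[ `&` I) s.
  split => //=; rewrite ?in_itv /=; move: sd; rewrite ltr_norml => /andP[? ?]; apply/andP; split; lra.
by case: (ltgtP s t) st => // ? _; [exists s, t|exists t, s].
Qed.

Lemma rel_nbhsI I t d s : (`]t - d, t + d[ `&` I) s -> rel_nbhs I (`]t - d, t + d[ `&` I) s.
Proof.
rewrite /= in_itv /= => -[/andP[h1 h2] Is].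
exists (Num.min (s - (t - d)) (t + d - s)); first by rewrite lt_min !subr_gt0 h1.
move=> u Iu; rewrite lt_min !ltr_norml => /andP[/andP[? ?] /andP[? ?]]; split => //=.
by rewrite ?in_itv /=; apply/andP; split; lra.
Qed.

Variable I : set R.
Hypothesis nI : no_isolated I.

Lemma mxderivE p q (M : R -> 'M[R]_(p, q)) t M' : I t ->
  mx_has_deriv I M t M' -> mxderiv I M t = M'.
Proof.
move=> It H; apply/matrixP => i j; rewrite mxE.
by have [_] := has_deriv_in nI It (H i j).
Qed.

Lemma mxCnSP n p q (M : R -> 'M[R]_(p, q)) : mxCn I n.+1 M <->
  (forall t, I t -> mx_has_deriv I M t (mxderiv I M t)) /\ mxCn I n (mxderiv I M).
Proof.
split=> [H|[H1 H2] i j].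
  split=> [t It i j|i j].
    rewrite mxE; apply: deriv_inP; exact: (H i j).1.
  apply: Cn_ext (H i j).2 => s _; by rewrite mxE.
by apply/(CnSP nI); exists (fun s => mxderiv I M s i j) => // t It; exact: H1.
Qed.

Lemma mxCnS_deriv n p q (M M' : R -> 'M[R]_(p, q)) :
  (forall t, I t -> mx_has_deriv I M t (M' t)) -> mxCn I n M' -> mxCn I n.+1 M.
Proof.
move=> H C i j; apply/(CnSP nI); exists (fun s => M' s i j) => // t It; exact: H.
Qed.

Lemma mxCn_has_deriv n p q (M : R -> 'M[R]_(p, q)) t : I t -> mxCn I n.+1 M ->
  mx_has_deriv I M t (mxderiv I M t).
Proof. by move=> It /mxCnSP [+ _]; exact. Qed.

Lemma mxCn_deriv n p q (M : R -> 'M[R]_(p, q)) : mxCn I n.+1 M -> mxCn I n (mxderiv I M).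
Proof. by move=> /mxCnSP []. Qed.

Lemma mxCn_ext n p q (M N : R -> 'M[R]_(p, q)) :
  (forall t, I t -> M t = N t) -> mxCn I n M -> mxCn I n N.
Proof. by move=> MN H i j; apply: Cn_ext (H i j) => s Is; rewrite MN. Qed.

Lemma mx_has_deriv_ext p q (M N : R -> 'M[R]_(p, q)) t M' :
  (forall t, I t -> M t = N t) -> I t -> mx_has_deriv I M t M' -> mx_has_deriv I N t M'.
Proof. by move=> MN It H i j; apply: has_deriv_ext (H i j) => // s Is; rewrite MN. Qed.

Lemma mxCn_le n k p q (M : R -> 'M[R]_(p, q)) : (n <= k)%N -> mxCn I k M -> mxCn I n M.
Proof. by move=> nk H i j; exact: Cn_le (H i j). Qed.

Lemma mxCn_cst n p q (M : 'M[R]_(p, q)) : mxCn I n (fun=> M).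
Proof. by move=> i j; exact: Cn_cst. Qed.

Lemma mxCnD n p q (M N : R -> 'M[R]_(p, q)) :
  mxCn I n M -> mxCn I n N -> mxCn I n (fun t => M t + N t).
Proof. by move=> HM HN i j; apply: Cn_ext (CnD nI (HM i j) (HN i j)) => s _; rewrite mxE. Qed.

Lemma mxCnN n p q (M : R -> 'M[R]_(p, q)) : mxCn I n M -> mxCn I n (fun t => - M t).
Proof. by move=> HM i j; apply: Cn_ext (CnN nI (HM i j)) => s _; rewrite mxE. Qed.

Lemma mxCnB n p q (M N : R -> 'M[R]_(p, q)) :
  mxCn I n M -> mxCn I n N -> mxCn I n (fun t => M t - N t).
Proof. by move=> HM HN; apply: mxCnD => //; exact: mxCnN. Qed.

Lemma mxCnM n p q r (M : R -> 'M[R]_(p, q)) (N : R -> 'M[R]_(q, r)) :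
  mxCn I n M -> mxCn I n N -> mxCn I n (fun t => M t *m N t).
Proof.
move=> HM HN i j; apply: (@Cn_ext _ _ _ (fun s => \sum_k M s i k * N s k j)).
  by move=> s _; rewrite mxE.
by apply: Cn_sum => // k _; apply: CnM.
Qed.

Lemma mxCnT n p q (M : R -> 'M[R]_(p, q)) : mxCn I n M -> mxCn I n (fun t => (M t)^T).
Proof. by move=> HM i j; apply: Cn_ext (HM j i) => s _; rewrite mxE. Qed.

Lemma mxCn_row n p q r (M : R -> 'M[R]_(p, q)) (N : R -> 'M[R]_(p, r)) :
  mxCn I n M -> mxCn I n N -> mxCn I n (fun t => row_mx (M t) (N t)).
Proof.
move=> HM HN i j; case: (split_ordP j) => k ->.
  by apply: Cn_ext (HM i k) => s _; rewrite row_mxEl.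
by apply: Cn_ext (HN i k) => s _; rewrite row_mxEr.
Qed.

Lemma mxCn_col n p q r (M : R -> 'M[R]_(p, q)) (N : R -> 'M[R]_(r, q)) :
  mxCn I n M -> mxCn I n N -> mxCn I n (fun t => col_mx (M t) (N t)).
Proof.
move=> HM HN i j; case: (split_ordP i) => k ->.
  by apply: Cn_ext (HM k j) => s _; rewrite col_mxEu.
by apply: Cn_ext (HN k j) => s _; rewrite col_mxEd.
Qed.

Lemma mxCn_block n p q r k (A : R -> 'M[R]_(p, q)) (B : R -> 'M[R]_(p, r))
    (C : R -> 'M[R]_(k, q)) (D : R -> 'M[R]_(k, r)) :
  mxCn I n A -> mxCn I n B -> mxCn I n C -> mxCn I n D ->
  mxCn I n (fun t => block_mx (A t) (B t) (C t) (D t)).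
Proof. by move=> HA HB HC HD; apply: mxCn_col; apply: mxCn_row. Qed.

Lemma mxCn_lsub n p q r (M : R -> 'M[R]_(p, q + r)) :
  mxCn I n M -> mxCn I n (fun t => lsubmx (M t)).
Proof. by move=> H i j; apply: Cn_ext (H i (lshift _ j)) => s _; rewrite mxE. Qed.

Lemma mxCn_rsub n p q r (M : R -> 'M[R]_(p, q + r)) :
  mxCn I n M -> mxCn I n (fun t => rsubmx (M t)).
Proof. by move=> H i j; apply: Cn_ext (H i (rshift _ j)) => s _; rewrite mxE. Qed.

Lemma mxCn_usub n p q r (M : R -> 'M[R]_(q + r, p)) :
  mxCn I n M -> mxCn I n (fun t => usubmx (M t)).
Proof. by move=> H i j; apply: Cn_ext (H (lshift _ i) j) => s _; rewrite mxE. Qed.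

Lemma mxCn_dsub n p q r (M : R -> 'M[R]_(q + r, p)) :
  mxCn I n M -> mxCn I n (fun t => dsubmx (M t)).
Proof. by move=> H i j; apply: Cn_ext (H (rshift _ i) j) => s _; rewrite mxE. Qed.

Lemma Cn_det n p (M : R -> 'M[R]_p) : mxCn I n M -> Cn I n (fun t => \det (M t)).
Proof.
move=> H; rewrite /determinant; apply: Cn_sum => // s _.
by apply: CnM => //; [exact: Cn_cst|apply: Cn_prod].
Qed.

(** Cramer's rule reduces smoothness of the inverse to smoothness of determinants. *)
Lemma mxCnV n p (M : R -> 'M[R]_p) : (forall t, I t -> M t \in unitmx) ->
  mxCn I n M -> mxCn I n (fun t => invmx (M t)).
Proof.
move=> uM H i j.
apply: (@Cn_ext _ _ _ (fun t => (\det (M t))^-1 * cofactor (M t) j i)).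
  by move=> t It; rewrite /invmx uM // !mxE.
apply: CnM => //.
  by apply: CnV => //; [move=> t It; rewrite -unitfE -unitmxE uM|exact: Cn_det].
rewrite /cofactor; apply: CnM => //; first exact: Cn_cst.
by apply: Cn_det => k l; apply: Cn_ext (H (lift j k) (lift i l)) => s _; rewrite !mxE.
Qed.

Lemma mx_has_deriv_cst p q (M : 'M[R]_(p, q)) t : mx_has_deriv I (fun=> M) t 0.
Proof. by move=> i j; rewrite mxE; exact: has_deriv_cst. Qed.

Lemma mx_has_derivD p q (M N : R -> 'M[R]_(p, q)) t M' N' : I t ->
  mx_has_deriv I M t M' -> mx_has_deriv I N t N' ->
  mx_has_deriv I (fun t => M t + N t) t (M' + N').
Proof.
move=> It HM HN i j; rewrite mxE; apply: has_deriv_ext (has_derivD (HM i j) (HN i j)) => // s _.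
by rewrite mxE.
Qed.

Lemma mx_has_derivN p q (M : R -> 'M[R]_(p, q)) t M' : I t ->
  mx_has_deriv I M t M' -> mx_has_deriv I (fun t => - M t) t (- M').
Proof.
move=> It HM i j; rewrite mxE; apply: has_deriv_ext (has_derivN (HM i j)) => // s _.
by rewrite mxE.
Qed.

Lemma mx_has_derivB p q (M N : R -> 'M[R]_(p, q)) t M' N' : I t ->
  mx_has_deriv I M t M' -> mx_has_deriv I N t N' ->
  mx_has_deriv I (fun t => M t - N t) t (M' - N').
Proof. by move=> It HM HN; apply: mx_has_derivD => //; exact: mx_has_derivN. Qed.

Lemma mx_has_derivT p q (M : R -> 'M[R]_(p, q)) t M' : I t ->
  mx_has_deriv I M t M' -> mx_has_deriv I (fun t => (M t)^T) t M'^T.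
Proof.
move=> It HM i j; rewrite mxE; apply: has_deriv_ext (HM j i) => // s _.
by rewrite mxE.
Qed.

Lemma mx_has_derivM p q r (M : R -> 'M[R]_(p, q)) (N : R -> 'M[R]_(q, r)) t M' N' : I t ->
  mx_has_deriv I M t M' -> mx_has_deriv I N t N' ->
  mx_has_deriv I (fun t => M t *m N t) t (M' *m N t + M t *m N').
Proof.
move=> It HM HN i j; rewrite !mxE -big_split /=.
apply: (@has_deriv_ext _ _ (fun s => \sum_k M s i k * N s k j)) => //.
  by move=> s _; rewrite mxE.
by apply: has_deriv_sum => // k _; apply: has_derivM.
Qed.

Lemma mx_has_deriv_row p q r (M : R -> 'M[R]_(p, q)) (N : R -> 'M[R]_(p, r)) t M' N' : I t ->
  mx_has_deriv I M t M' -> mx_has_deriv I N t N' ->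
  mx_has_deriv I (fun t => row_mx (M t) (N t)) t (row_mx M' N').
Proof.
move=> It HM HN i j; case: (split_ordP j) => k ->.
  by rewrite row_mxEl; apply: has_deriv_ext (HM i k) => // s _; rewrite row_mxEl.
by rewrite row_mxEr; apply: has_deriv_ext (HN i k) => // s _; rewrite row_mxEr.
Qed.

Lemma mx_has_deriv_col p q r (M : R -> 'M[R]_(p, q)) (N : R -> 'M[R]_(r, q)) t M' N' : I t ->
  mx_has_deriv I M t M' -> mx_has_deriv I N t N' ->
  mx_has_deriv I (fun t => col_mx (M t) (N t)) t (col_mx M' N').
Proof.
move=> It HM HN i j; case: (split_ordP i) => k ->.
  by rewrite col_mxEu; apply: has_deriv_ext (HM k j) => // s _; rewrite col_mxEu.
by rewrite col_mxEd; apply: has_deriv_ext (HN k j) => // s _; rewrite col_mxEd.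
Qed.

Lemma mx_has_deriv_block p q r k (A : R -> 'M[R]_(p, q)) (B : R -> 'M[R]_(p, r))
    (C : R -> 'M[R]_(k, q)) (D : R -> 'M[R]_(k, r)) t A' B' C' D' : I t ->
  mx_has_deriv I A t A' -> mx_has_deriv I B t B' ->
  mx_has_deriv I C t C' -> mx_has_deriv I D t D' ->
  mx_has_deriv I (fun t => block_mx (A t) (B t) (C t) (D t)) t (block_mx A' B' C' D').
Proof. by move=> It HA HB HC HD; apply: mx_has_deriv_col => //; apply: mx_has_deriv_row. Qed.

Lemma mx_has_deriv_usub p q r (M : R -> 'M[R]_(q + r, p)) t M' : I t ->
  mx_has_deriv I M t M' -> mx_has_deriv I (fun t => usubmx (M t)) t (usubmx M').
Proof.
by move=> It H i j; rewrite mxE; apply: has_deriv_ext (H (lshift _ i) j) => // s _; rewrite mxE.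
Qed.

Lemma mx_has_deriv_cont p q (M : R -> 'M[R]_(p, q)) :
  (forall t, I t -> exists M', mx_has_deriv I M t M') -> mxCn I 0 M.
Proof.
move=> H i j; apply/Cn0P => t It; have [M' HM] := H t It.
exact: has_deriv_cont (HM i j).
Qed.

Lemma mxCn_restrict J n p q (M : R -> 'M[R]_(p, q)) :
  no_isolated J -> J `<=` I -> mxCn I n M -> mxCn J n M.
Proof. by move=> nJ JI H i j; exact: Cn_restrict (H i j). Qed.

Lemma mx_has_deriv_sub J p q (M : R -> 'M[R]_(p, q)) t M' :
  J `<=` I -> mx_has_deriv I M t M' -> mx_has_deriv J M t M'.
Proof. by move=> JI H i j; exact: has_deriv_sub (H i j). Qed.

Lemma mxCn_local n p q (M : R -> 'M[R]_(p, q)) : (forall t, I t -> exists J, [/\ no_isolated J, J `<=` I, J t,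
     (forall s, J s -> rel_nbhs I J s) & mxCn J n M]) -> mxCn I n M.
Proof.
move=> H i j; apply: Cn_local => // t /H [J [? ? ? ? C]]; exists J; split => //; exact: C.
Qed.

End MatrixCalculus.

(** * Antiderivatives and linear differential equations *)

Section Antiderivative.
Context {R : realType}.
Implicit Types (I J : set R) (t : R) (f g : R -> R).

Definition seg (a b : R) : set R := [set t | a <= t <= b].

Lemma segE a b : seg a b = [set` `[a, b]].
Proof. by rewrite predeqE => y; rewrite /seg /= in_itv. Qed.

Lemma seg_sub I a b : is_interval I -> I a -> I b -> seg a b `<=` I.
Proof. by move=> iI Ia Ib t /= ?; apply: iI Ia Ib _ _. Qed.

Lemma has_deriv_is_derive a b f t l : a < t < b -> has_deriv (seg a b) f t l ->
  is_derive t (1 : R) f l.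
Proof.
move=> /andP[at_ tb] /has_derivP H.
have L : h^-1 *: (f (h *: (1 : R) + t) - f t) @[h --> 0^'] --> l.
  apply/cvgrPdist_le => e e0; have [d d0 Hd] := H e e0.
  have m0 : 0 < Num.min d (Num.min (t - a) (b - t)) by rewrite !lt_min d0 !subr_gt0 at_.
  apply/nbhs_ballP; exists (Num.min d (Num.min (t - a) (b - t))) => //= h.
  rewrite -ball_normE /= sub0r normrN !lt_min => /andP[hd /andP[h1 h2]] h0.
  have := Hd (h + t); rewrite addrK => Hh.
  have {Hh}/Hh : seg a b (h + t).
    by move: h1 h2; rewrite /seg /= !ltr_norml => /andP[? ?] /andP[? ?]; apply/andP; split; lra.
  move=> /(_ hd) Hh.
  rewrite -(ler_pM2r (x := `|h|)) ?normr_gt0 // -normrM.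
  have -> : (l - h^-1 *: (f (h *: (1 : R) + t) - f t)) * h = - (f (h + t) - f t - l * h).
    by rewrite /GRing.scale /= mulr1; field.
  by rewrite normrN.
apply: DeriveDef; first by apply/cvg_ex; exists l.
by apply/cvg_lim => //; exact: Rhausdorff.
Qed.

Lemma nondecreasing_of_deriv a b f f' : a <= b ->
  (forall t, seg a b t -> has_deriv (seg a b) f t (f' t)) ->
  (forall t, seg a b t -> 0 <= f' t) -> f a <= f b.
Proof.
move=> ab Hf f0.
have [||c + E] := @MVT_segment R f f' a b ab.
- move=> x; rewrite in_itv /= => /andP[ax xb]; apply: (@has_deriv_is_derive a b); first by rewrite ax.
  by apply: Hf; rewrite /seg /= !ltW.
- apply/subspace_continuousP => x; rewrite /= in_itv /= => xab.
  have := has_deriv_cont (Hf x xab).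
  by rewrite /cont_at segE.
rewrite in_itv /= => cab.
by rewrite -subr_ge0 E mulr_ge0 ?subr_ge0 // f0.
Qed.

(** Both [g + f] and [g - f] are nondecreasing. This replaces estimates of integrals. *)
Lemma deriv_dist_le a b f f' g g' : a <= b ->
  (forall t, seg a b t -> has_deriv (seg a b) f t (f' t)) ->
  (forall t, seg a b t -> has_deriv (seg a b) g t (g' t)) ->
  (forall t, seg a b t -> `|f' t| <= g' t) -> `|f b - f a| <= g b - g a.
Proof.
move=> ab Hf Hg fg; rewrite ler_norml; apply/andP; split.
  have := @nondecreasing_of_deriv a b (fun s => f s + g s) (fun s => f' s + g' s) ab.
  have -> : (- (g b - g a) <= f b - f a) = (f a + g a <= f b + g b).
    by apply/idP/idP; lra.
  apply=> t tab; first by apply: has_derivD; auto.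
  by have := fg t tab; rewrite ler_norml => /andP[]; lra.
have := @nondecreasing_of_deriv a b (fun s => g s + - f s) (fun s => g' s + - f' s) ab.
have -> : (f b - f a <= g b - g a) = (g a + - f a <= g b + - f b).
  by apply/idP/idP; lra.
apply=> t tab; first by apply: has_derivD; auto; apply: has_derivN; auto.
by have := fg t tab; rewrite ler_norml => /andP[]; lra.
Qed.

Lemma deriv0_const a b f : (forall t, seg a b t -> has_deriv (seg a b) f t 0) ->
  forall x y, seg a b x -> seg a b y -> f x = f y.
Proof.
move=> Hf; suff W x y : x <= y -> seg a b x -> seg a b y -> f x = f y.
  move=> x y hx hy; case: (leP x y) => xy; first exact: W.
  by apply/esym/W => //; exact: ltW.
move=> xy hx hy; apply/eqP; rewrite eq_sym -subr_eq0 -normr_le0.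
have s : seg x y `<=` seg a b.
  by move: hx hy; rewrite /seg /= => /andP[? ?] /andP[? ?] z /= /andP[? ?]; apply/andP; split; lra.
rewrite -(subrr (0 : R)).
apply: (@deriv_dist_le x y f (fun=> 0) (fun=> 0) (fun=> 0)) => // t ht.
- by apply: has_deriv_sub (Hf t (s _ ht)).
- exact: has_deriv_cst.
- by rewrite normr0.
Qed.

Lemma segment_antideriv a b f : (forall t, seg a b t -> cont_at (seg a b) f t) ->
  exists F : R -> R, forall t, seg a b t -> has_deriv (seg a b) F t (f t).
Proof.
move=> cf; have [ab|ba] := leP a b; last first.
  by exists f => t /andP[h1 h2]; have := le_trans h1 h2; rewrite leNgt ba.
(* Clamping to the segment extends [f] continuously to the whole line. The integral starts at
   [a - 1], so that [a] is an interior point and the fundamental theorem applies there too. *)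
pose c s := Num.max a (Num.min b s).
have cseg s : seg a b (c s) by rewrite /seg /c /= le_max lexx ge_max ab ge_min lexx.
have cid s : seg a b s -> c s = s.
  by move=> /andP[h1 h2]; rewrite /c min_r // max_r.
have cl s t : `|c s - c t| <= `|s - t|.
  rewrite /c /Num.max /Num.min ler_norml.
  have := ler_norm (s - t); have := ler_norm (t - s); rewrite (distrC t s).
  by case: (ltP b s); case: (ltP b t) => ? ?; case: ltP => ?; case: ltP => ?; move=> ? ?; apply/andP; split; lra.
have cg : continuous (f \o c).
  move=> t; apply/cvgrPdist_lt => e e0.
  have /cont_atP /(_ e e0) [d d0 Hd] := cf (c t) (cseg t).
  apply/nbhs_ballP; exists d => //= s; rewrite /ball_ /= distrC => sd.
  by rewrite distrC; apply: Hd => //; exact: le_lt_trans (cl _ _) sd.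
pose F x := (\int[@lebesgue_measure R]_(t in [set` `[a - 1, x]]) ((f \o c) t))%R.
exists F => t tab; have [at_ tb] := andP tab.
have fi : (@lebesgue_measure R).-integrable `[a - 1, t + 1] (EFin \o (f \o c)).
  apply: continuous_compact_integrable; first exact: segment_compact.
  exact: continuous_subspaceT.
have t1 : t < t + 1 by rewrite ltrDl.
have at1 : a - 1 < t by rewrite ltrBlDr (le_lt_trans at_) // ltrDl.
have [dF dFE] := continuous_FTC1_closed t1 fi at1 (cg t).
have {dF}H : h^-1 *: (F (h *: (1 : R) + t) - F t) @[h --> 0^'] --> f t.
  have -> : f t = (f \o c) t by rewrite /= cid.
  by rewrite -dFE derive1E; exact: dF.
apply/has_derivP => e e0; move/cvgrPdist_le: H => /(_ e e0) /nbhs_ballP [d /= d0 Hd].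
exists d => // s _ sd; have [->|st] := eqVneq s t.
  by rewrite !subrr mulr0 subr0 normr0 mulr0.
have st0 : s - t != 0 by rewrite subr_eq0.
have := Hd (s - t); rewrite -ball_normE /= sub0r normrN => /(_ sd st0).
rewrite /GRing.scale /= mulr1 subrK => h.
have -> : F s - F t - f t * (s - t) = - ((f t - (s - t)^-1 * (F s - F t)) * (s - t)) by field.
by rewrite normrN normrM ler_wpM2r.
Qed.

(** The segment reaches strictly beyond [t] on each side on which [I] does. Arguments on compact
    segments thus carry over to an interval that need not be compact. *)
Lemma hull I t t0 : is_interval I -> I t -> I t0 -> exists a b : R,
  [/\ I a, I b, seg a b t, seg a b t0 & rel_nbhs I (seg a b) t].
Proof.
move=> iI It It0.
have Ha : exists2 a, I a & [/\ a <= t, a <= t0 & exists2 d : R, 0 < d & forall s, I s -> `|s - t| < d -> a <= s].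
  have [[a Ia [at_ at0]]|N] := pselect (exists2 a, I a & a < t /\ a <= t0).
    exists a => //; split => //; first exact: ltW.
    exists (t - a); rewrite ?subr_gt0 // => s Is; rewrite ltr_norml => /andP[]; lra.
  exists (Num.min t t0); first by rewrite /Num.min; case: ifP.
  split; rewrite ?ge_min ?lexx ?orbT //; exists 1 => // s Is _.
  rewrite leNgt lt_min; apply/negP => /andP[st st0]; apply: N; exists s => //.
  by split => //; exact: ltW.
have Hb : exists2 b, I b & [/\ t <= b, t0 <= b & exists2 d : R, 0 < d & forall s, I s -> `|s - t| < d -> s <= b].
  have [[b Ib [at_ at0]]|N] := pselect (exists2 b, I b & t < b /\ t0 <= b).
    exists b => //; split => //; first exact: ltW.
    exists (b - t); rewrite ?subr_gt0 // => s Is; rewrite ltr_norml => /andP[]; lra.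
  exists (Num.max t t0); first by rewrite /Num.max; case: ifP.
  split; rewrite ?le_max ?lexx ?orbT //; exists 1 => // s Is _.
  rewrite leNgt gt_max; apply/negP => /andP[st st0]; apply: N; exists s => //.
  by split => //; exact: ltW.
have [a Ia [at_ at0 [d d0 Hd]]] := Ha; have [b Ib [tb t0b [d' d'0 Hd']]] := Hb.
exists a, b; split; rewrite /seg /= ?at_ ?tb ?at0 ?t0b //.
exists (Num.min d d'); first by rewrite lt_min d0.
by move=> s Is; rewrite lt_min => /andP[h1 h2]; rewrite /seg /= Hd // Hd'.
Qed.

Lemma antideriv_exists I t0 f : is_interval I -> I t0 -> (forall t, I t -> cont_at I f t) ->
  exists F : R -> R, F t0 = 0 /\ forall t, I t -> has_deriv I F t (f t).
Proof.
move=> iI It0 cf.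
(* An antiderivative is chosen separately on each segment. Only its increment from [t0] to [t] is
   used, and two antiderivatives differ by a constant, so the choices fit together. *)
pose P a b (F : R -> R) := forall t, seg a b t -> has_deriv (seg a b) F t (f t).
pose F a b : R -> R := xget f (P a b).
have HF a b : I a -> I b -> P a b (F a b).
  move=> Ia Ib; apply: xgetPex; apply: segment_antideriv => t tab.
  exact: cont_at_sub (seg_sub iI Ia Ib) (cf _ (seg_sub iI Ia Ib tab)).
pose a t := Num.min t0 t; pose b t := Num.max t0 t.
have Iab t : I t -> I (a t) /\ I (b t) by rewrite /a /b /Num.min /Num.max => It; case: ifP.
have sab t : seg (a t) (b t) t /\ seg (a t) (b t) t0.
  by rewrite /seg /a /b /= !ge_min !le_max !lexx !orbT.
exists (fun t => F (a t) (b t) t - F (a t) (b t) t0); split; first by rewrite subrr.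
move=> t It; have [c [d [Ic Id tcd t0cd nb]]] := hull iI It It0.
apply: (has_deriv_local nb).
have := has_derivD (HF c d Ic Id t tcd) (has_deriv_cst _ (- F c d t0) t).
rewrite addr0; apply: has_deriv_ext => // s scd.
have ss : seg (a s) (b s) `<=` seg c d.
  move=> z; move: scd t0cd; rewrite /seg /= /a /b ge_min le_max => /andP[? ?] /andP[? ?].
  by move=> /andP[/orP[?|?] /orP[?|?]]; apply/andP; split; lra.
have [Ias Ibs] := Iab s (seg_sub iI Ic Id scd); have [s1 s2] := sab s.
have D z : seg (a s) (b s) z ->
    has_deriv (seg (a s) (b s)) (fun s' => F c d s' + - F (a s) (b s) s') z 0.
  move=> zs; rewrite -(subrr (f z)); apply: has_derivD.
    exact: has_deriv_sub ss (HF c d Ic Id z (ss _ zs)).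
  apply: has_derivN; exact: HF.
by have := deriv0_const D s1 s2; lra.
Qed.

End Antiderivative.

(** * Linear differential equations by Picard iteration *)

Section LinearODE.
Context {R : realType}.
Implicit Types (I J : set R) (t : R) (f g : R -> R) (n p : nat).

Lemma antideriv_mx I t0 p q (M : R -> 'M[R]_(p, q)) : is_interval I -> I t0 -> mxCn I 0 M ->
  exists P : R -> 'M[R]_(p, q), P t0 = 0 /\ forall t, I t -> mx_has_deriv I P t (M t).
Proof.
move=> iI It0 cM.
have H i j : exists F : R -> R, F t0 = 0 /\ forall t, I t -> has_deriv I F t (M t i j).
  by apply: antideriv_exists => // t It; have /Cn0P := cM i j; apply.
pose F i j := xget (fun=> 0) [set F : R -> R | F t0 = 0 /\ forall t, I t -> has_deriv I F t (M t i j)].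
have HF i j : F i j t0 = 0 /\ forall t, I t -> has_deriv I (F i j) t (M t i j).
  exact: (xgetPex (fun=> 0) (H i j)).
exists (fun t => \matrix_(i, j) F i j t); split.
  by apply/matrixP => i j; rewrite !mxE (HF i j).1.
move=> t It i j; apply: has_deriv_ext ((HF i j).2 t It) => // s _.
by rewrite mxE.
Qed.

Lemma mxC0_sub I J p q (M : R -> 'M[R]_(p, q)) : J `<=` I -> mxCn I 0 M -> mxCn J 0 M.
Proof.
move=> JI cM i j; apply/Cn0P => t Jt; apply: (cont_at_sub JI).
by have /Cn0P := cM i j; apply; exact: JI.
Qed.

Lemma seg_bound a b f : (forall t, seg a b t -> cont_at (seg a b) f t) ->
  exists M : R, forall t, seg a b t -> `|f t| <= M.
Proof.
move=> cf; have [ab|ba] := leP a b; last first.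
  by exists 0 => t /andP[h1 h2]; have := le_trans h1 h2; rewrite leNgt ba.
have [|c _ Hc] := @EVT_max R (fun s => `|f s|) a b ab.
  apply/subspace_continuousP => x xab.
  have {}xab : seg a b x by rewrite segE.
  have /cvg_norm := cf x xab; rewrite segE; exact.
by exists `|f c| => t tab; apply: Hc; rewrite in_itv.
Qed.

Lemma seg_bound_mx a b p q (M : R -> 'M[R]_(p, q)) : mxCn (seg a b) 0 M ->
  exists C : R, 0 <= C /\ forall t i j, seg a b t -> `|M t i j| <= C.
Proof.
move=> cM.
have H (ij : 'I_p * 'I_q) : exists C : R, forall t, seg a b t -> `|M t ij.1 ij.2| <= C.
  by apply: seg_bound => t It; have /Cn0P := cM ij.1 ij.2; apply.
pose C ij := xget 0 [set C : R | forall t, seg a b t -> `|M t ij.1 ij.2| <= C].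
have HC ij : forall t, seg a b t -> `|M t ij.1 ij.2| <= C ij by exact: (xgetPex 0 (H ij)).
exists (\sum_ij `|C ij|); split; first by apply: sumr_ge0.
move=> t i j tab; apply: le_trans (HC (i, j) t tab) _.
apply: le_trans (ler_norm _) _; rewrite (bigD1 (i, j)) //= lerDl.
exact: sumr_ge0.
Qed.

Lemma has_deriv_pow I f t l k : has_deriv I f t l -> I t ->
  has_deriv I (fun s => f s ^+ k.+1) t (k.+1%:R * f t ^+ k * l).
Proof.
move=> Hf It; elim: k => [|k IH].
  by rewrite expr0 !mul1r; apply: has_deriv_ext Hf => // s _; rewrite expr1.
have := has_derivM Hf IH.
have -> : l * f t ^+ k.+1 + f t * (k.+1%:R * f t ^+ k * l) = k.+2%:R * f t ^+ k.+1 * l.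
  by rewrite -[k.+2%:R]natr1 exprS; ring.
by apply: has_deriv_ext => // s _; rewrite -exprS.
Qed.

(** Comparison with a primitive of [c * |s - t0| ^+ k], separately on each side of [t0]. The factor
    [1 / k.+1] accumulates to the factorial in the Picard estimates. *)
Lemma growth a b t0 f f' (c : R) k : seg a b t0 ->
  (forall t, seg a b t -> has_deriv (seg a b) f t (f' t)) -> f t0 = 0 ->
  (forall t, seg a b t -> `|f' t| <= c * `|t - t0| ^+ k) ->
  forall t, seg a b t -> `|f t| <= c / k.+1%:R * `|t - t0| ^+ k.+1.
Proof.
move=> t0ab Hf f0 bf t tab; have k0 : (k.+1%:R : R) != 0 by rewrite pnatr_eq0.
have D s (e : R) : has_deriv (seg a b) (fun s => (e * (s + - t0))) s e.
  have := has_derivM (has_deriv_cst (seg a b) e s)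
    (has_derivD (has_deriv_id (seg a b) s) (has_deriv_cst (seg a b) (- t0) s)).
  by rewrite mul0r add0r addr0 mulr1.
have [tt0|tt0] := leP t0 t.
  have ss : seg t0 t `<=` seg a b.
    by move=> z; move: tab t0ab; rewrite /seg /= => /andP[? ?] /andP[? ?] /andP[? ?]; apply/andP; split; lra.
  have h : `|f t - f t0| <=
      c / k.+1%:R * (1 * (t + - t0)) ^+ k.+1 - c / k.+1%:R * (1 * (t0 + - t0)) ^+ k.+1.
    apply: (@deriv_dist_le _ t0 t f f' (fun s => c / k.+1%:R * (1 * (s + - t0)) ^+ k.+1)
       (fun s => c * `|s - t0| ^+ k)) => // s ts.
    - exact: has_deriv_sub ss (Hf _ (ss _ ts)).
    - have := has_derivM (has_deriv_cst (seg t0 t) (c / k.+1%:R) s)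
        (has_deriv_pow (k:=k) (has_deriv_sub ss (D s 1)) ts).
      have -> // : 0 * (1 * (s + - t0)) ^+ k.+1 + c / k.+1%:R * (k.+1%:R * (1 * (s + - t0)) ^+ k * 1)
              = c * `|s - t0| ^+ k.
      by rewrite ger0_norm ?mul1r; [field|move: ts; rewrite /seg /= subr_ge0 => /andP[]].
    - exact: bf (ss _ ts).
  rewrite f0 subr0 in h; apply: le_trans h _.
  by rewrite subrr mulr0 expr0n /= mulr0 subr0 mul1r ger0_norm // subr_ge0.
have ss : seg t t0 `<=` seg a b.
  by move=> z; move: tab t0ab; rewrite /seg /= => /andP[? ?] /andP[? ?] /andP[? ?]; apply/andP; split; lra.
have h : `|f t0 - f t| <=
    - (c / k.+1%:R) * (-1 * (t0 + - t0)) ^+ k.+1 - - (c / k.+1%:R) * (-1 * (t + - t0)) ^+ k.+1.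
  apply: (@deriv_dist_le _ t t0 f f' (fun s => - (c / k.+1%:R) * (-1 * (s + - t0)) ^+ k.+1)
     (fun s => c * `|s - t0| ^+ k)) => //; first exact: ltW.
  - move=> s ts; exact: has_deriv_sub ss (Hf _ (ss _ ts)).
  - move=> s ts; have := has_derivM (has_deriv_cst (seg t t0) (- (c / k.+1%:R)) s)
      (has_deriv_pow (k:=k) (has_deriv_sub ss (D s (-1))) ts).
    have -> // : 0 * (-1 * (s + - t0)) ^+ k.+1 + - (c / k.+1%:R) * (k.+1%:R * (-1 * (s + - t0)) ^+ k * -1)
            = c * `|s - t0| ^+ k.
    rewrite ler0_norm ?mulN1r; first by field.
    by move: ts; rewrite /seg /= subr_le0 => /andP[].
  - move=> s ts; exact: bf (ss _ ts).
rewrite distrC f0 subr0 in h; apply: le_trans h _.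
by rewrite subrr mulr0 expr0n /= mulr0 sub0r mulN1r mulNr opprK ltr0_norm // subr_lt0.
Qed.

Lemma exp_term_rec (C K : R) k :
  C * K ^+ k.+1 / k.+1`!%:R = K * (C * K ^+ k / k`!%:R) / k.+1%:R.
Proof.
have f0 : (k`!%:R : R) != 0 by rewrite pnatr_eq0 -lt0n fact_gt0.
have k0 : (k.+1%:R : R) != 0 by rewrite pnatr_eq0.
by rewrite factS natrM exprS invfM; set x := k.+1%:R^-1; set y := k`!%:R^-1; ring.
Qed.

Section Picard.
Variables (I : set R) (n p : nat) (A : R -> 'M[R]_n) (t0 : R).
Hypotheses (nI : nondeg_itv I) (It0 : I t0) (cA : mxCn I 0 A).
Let iI : is_interval I := nI.1.
Let niI : no_isolated I := nondeg_no_isolated nI.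

Lemma linear_growth a b (D V : R -> 'M[R]_(n, p)) (M e : R) k : I a -> I b -> seg a b t0 ->
  (forall t, I t -> mx_has_deriv I D t (A t *m V t)) -> D t0 = 0 ->
  (forall t i j, seg a b t -> `|A t i j| <= M) ->
  (forall t i j, seg a b t -> `|V t i j| <= e * `|t - t0| ^+ k) ->
  forall t i j, seg a b t -> `|D t i j| <= n%:R * M * e / k.+1%:R * `|t - t0| ^+ k.+1.
Proof.
move=> Ia Ib t0ab HD D0 bA bV t i j tab.
apply: (@growth a b t0 (fun s => D s i j) (fun s => (A s *m V s) i j)) => //.
- by move=> s sab; apply: has_deriv_sub (seg_sub iI Ia Ib) _; apply: HD; exact: seg_sub sab.
- by rewrite D0 mxE.
move=> s sab; rewrite mxE; apply: le_trans (ler_norm_sum _ _ _) _.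
apply: (@le_trans _ _ (\sum_(l < n) M * (e * `|s - t0| ^+ k))).
  by apply: ler_sum => l _; rewrite normrM ler_pM // ?bA ?bV.
by rewrite sumr_const card_ord -[leLHS]mulr_natl !mulrA.
Qed.

(** Feeding a bound for [X] back into the equation improves it: after [k] passes it is a term of an
    exponential series, which tends to zero. *)
Lemma ode_unique (X : R -> 'M[R]_(n, p)) :
  (forall t, I t -> mx_has_deriv I X t (A t *m X t)) -> X t0 = 0 ->
  forall t, I t -> X t = 0.
Proof.
move=> HX X0 t It; apply/matrixP => i j; rewrite mxE; apply/eqP; rewrite -normr_le0.
have [a [b [Ia Ib tab t0ab _]]] := hull iI It It0.
have sI := seg_sub iI Ia Ib.
have cX : mxCn I 0 X by apply: mx_has_deriv_cont => s Is; exists (A s *m X s); exact: HX.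
have [M [M0 bA]] := seg_bound_mx (mxC0_sub sI cA).
have [C [C0 bX]] := seg_bound_mx (mxC0_sub sI cX).
pose e k := C * (n%:R * M) ^+ k / k`!%:R.
have He k : forall s i j, seg a b s -> `|X s i j| <= e k * `|s - t0| ^+ k.
  elim: k => [|k IH] s i0 j0 sab.
    by rewrite /e !expr0 !mulr1 fact0 divr1 bX.
  have -> : e k.+1 = n%:R * M * e k / k.+1%:R.
    exact: exp_term_rec.
  exact: linear_growth bA IH _ _ _ sab.
have c0 : (fun k => C * exp_coeff (n%:R * M * `|t - t0|) k) @ \oo --> C * 0.
  by apply: cvgM; [exact: cvg_cst|exact: cvg_exp_coeff].
rewrite mulr0 in c0.
have := @ler_cvg_to _ \oo (eventually_filter) _ (fun=> `|X t i j|) _ _ _ (cvg_cst _) c0.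
apply; apply: nearW => k; apply: le_trans (He k t i j tab) _.
rewrite /e /exp_coeff /= (exprMn _ (n%:R * M)) le_eqVlt; apply/orP; left; apply/eqP; ring.
Qed.

Variable X0 : 'M[R]_(n, p).

Let Prim (M : R -> 'M[R]_(n, p)) : R -> 'M[R]_(n, p) :=
  xget (fun=> 0) [set P | P t0 = 0 /\ forall t, I t -> mx_has_deriv I P t (M t)].

Let PrimP M : mxCn I 0 M -> Prim M t0 = 0 /\ forall t, I t -> mx_has_deriv I (Prim M) t (M t).
Proof. by move=> cM; apply: (xgetPex (fun=> 0) (antideriv_mx iI It0 cM)). Qed.

Fixpoint picard k : R -> 'M[R]_(n, p) :=
  if k is k'.+1 then fun t => X0 + Prim (fun s => A s *m picard k' s) t else fun=> X0.

Let picard_step V : mxCn I 0 V ->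
  (forall t, I t -> mx_has_deriv I (fun t => X0 + Prim (fun s => A s *m V s) t) t (A t *m V t)).
Proof.
move=> cV t It; rewrite -[A t *m V t]add0r.
apply: mx_has_derivD => //; first exact: mx_has_deriv_cst.
by apply: (PrimP _).2 => //; exact: mxCnM.
Qed.

Lemma picard_cont k : mxCn I 0 (picard k).
Proof.
elim: k => [|k IH]; first exact: mxCn_cst.
by apply: mx_has_deriv_cont => t It; exists (A t *m picard k t); exact: picard_step.
Qed.

Lemma picard0 k : picard k t0 = X0.
Proof.
case: k => //= k; rewrite (PrimP _).1 ?addr0 //; apply: mxCnM => //; exact: picard_cont.
Qed.

Lemma picard_cauchy a b : I a -> I b -> seg a b t0 -> exists q C : R, [/\ 0 <= q, 0 <= C &
  forall k t i j, seg a b t -> `|picard k.+1 t i j - picard k t i j| <= C * exp_coeff q k].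
Proof.
move=> Ia Ib t0ab; have sI := seg_sub iI Ia Ib.
have [M [M0 bA]] := seg_bound_mx (mxC0_sub sI cA).
have c1 : mxCn I 0 (fun t => picard 1 t - picard 0 t).
  by apply: mxCnB => //; exact: picard_cont.
have [C [C0 bX]] := seg_bound_mx (mxC0_sub sI c1).
pose e k := C * (n%:R * M) ^+ k / k`!%:R.
have He k : forall s i j, seg a b s -> `|(picard k.+1 s - picard k s) i j| <= e k * `|s - t0| ^+ k.
  elim: k => [|k IH] s i0 j0 sab.
    by rewrite /e !expr0 !mulr1 fact0 divr1 bX.
  have -> : e k.+1 = n%:R * M * e k / k.+1%:R.
    exact: exp_term_rec.
  apply: (@linear_growth a b (fun s => picard k.+2 s - picard k.+1 s)
     (fun s => picard k.+1 s - picard k s)) bA IH _ _ _ sab => //.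
    move=> u Iu; rewrite mulmxBr; apply: mx_has_derivB => //.
      by apply: (@picard_step (picard k.+1)) => //; exact: picard_cont.
    by apply: (@picard_step (picard k)) => //; exact: picard_cont.
  by rewrite !picard0 subrr.
exists (n%:R * M * (b - a)), C; split => //.
  rewrite !mulr_ge0 // subr_ge0; move: t0ab => /andP[]; exact: le_trans.
move=> k t i j tab; have := He k t i j tab; rewrite !mxE => h; apply: le_trans h _.
have bb : `|t - t0| ^+ k <= (b - a) ^+ k.
  have : `|t - t0| <= b - a.
    by rewrite ler_norml; move: t0ab tab; rewrite /seg /= => /andP[? ?] /andP[? ?]; apply/andP; split; lra.
  by move=> h2; rewrite lerXn2r // nnegrE // (le_trans _ h2).
rewrite /e /exp_coeff /= (exprMn _ (n%:R * M)).
have -> : C * ((n%:R * M) ^+ k * (b - a) ^+ k / k`!%:R) = C * (n%:R * M) ^+ k / k`!%:R * (b - a) ^+ k.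
  by ring.
by rewrite ler_wpM2l // !mulr_ge0 // exprn_ge0 // mulr_ge0.
Qed.

(** The error [eps k] is the tail of an exponential series and does not depend on [t]: convergence
    is uniform on segments. *)
Lemma picard_cvg a b : I a -> I b -> seg a b t0 ->
  exists eps : nat -> R, eps @ \oo --> 0 /\
  forall t i j, seg a b t ->
    cvgn (fun k => picard k t i j) /\
    forall k, `|limn (fun k => picard k t i j) - picard k t i j| <= eps k.
Proof.
move=> Ia Ib t0ab; have [q [C [q0 C0 H]]] := picard_cauchy Ia Ib t0ab.
pose u k := C * exp_coeff q k.
have u0 k : 0 <= u k by rewrite mulr_ge0 // exp_coeff_ge0.
have cu : cvgn (series u).
  by apply: (@is_cvg_seriesZ _ (exp_coeff q) C); exact: is_cvg_series_exp_coeff.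
exists (fun k => limn (series u) - series u k); split.
  by rewrite -(subrr (limn (series u))); apply: cvgB; [exact: cvg_cst|exact: cu].
move=> t i j tab; pose x k := picard k t i j.
have dx m k : `|x (k + m)%N - x k| <= series u (k + m)%N - series u k.
  elim: m => [|m IH]; first by rewrite addn0 !subrr normr0.
  rewrite addnS seriesSr /=.
  have := H (k + m)%N t i j tab; rewrite -/(u _) -/(x _) -/(x _.+1) => h.
  have -> : x (k + m).+1 - x k = (x (k + m).+1 - x (k + m)%N) + (x (k + m)%N - x k) by ring.
  apply: le_trans (ler_normD _ _) _; lra.
have us m k : series u (k + m)%N <= limn (series u).
  by apply: nondecreasing_cvgn_le => //; apply: nondecreasing_series => *; exact: u0.
have cx : cvgn x.
  pose d k := x k.+1 - x k.
  have cd : cvgn (series d).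
    apply: normed_cvg; apply: (@series_le_cvg _ (fun k => `|d k|) u (fun k => normr_ge0 _) u0 _ cu) => k; exact: H.
  have -> : x = fun k => x 0%N + series d k.
    apply/funext; elim=> [|k IH]; first by rewrite /series /= big_geq // addr0.
    by rewrite seriesSr addrA -IH /d; ring.
  by apply: is_cvgD => //; exact: is_cvg_cst.
split=> // k.
have sx : (fun m => x (m + k)%N) @ \oo --> limn x by rewrite cvg_shiftn.
have := @ler_cvg_to _ \oo (eventually_filter) _ (fun m => `|x (m + k)%N - x k|)
   (fun=> limn (series u) - series u k) `|limn x - x k| (limn (series u) - series u k).
apply.
- by apply: cvg_norm; apply: cvgB => //; exact: cvg_cst.
- exact: cvg_cst.
- by apply: nearW => m; rewrite addnC; apply: le_trans (dx m k) _; rewrite lerD2r.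
Qed.

Theorem ode_exists : exists X : R -> 'M[R]_(n, p), X t0 = X0 /\
  forall t, I t -> mx_has_deriv I X t (A t *m X t).
Proof.
pose X t : 'M[R]_(n, p) := \matrix_(i, j) limn (fun k => picard k t i j).
have cX : mxCn I 0 X.
  move=> i j; apply/Cn0P => t It.
  have [a [b [Ia Ib tab t0ab nb]]] := hull iI It It0.
  apply: (cont_at_local nb); apply/cont_atP => e e0.
  have [eps [eps0 Heps]] := picard_cvg Ia Ib t0ab.
  have [k ek] : exists k, eps k < e / 3.
    have /cvgrPdist_lt /(_ (e / 3)) H := eps0.
    have /H [k _ /(_ k (leqnn k))] : 0 < e / 3 by lra.
    by rewrite /= sub0r normrN => /ltr_normlW; exists k.
  have := @picard_cont k i j.
  move=> /Cn0P /(_ t It) /(cont_at_sub (seg_sub iI Ia Ib)) /cont_atP /(_ (e / 3)).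
  have e3 : 0 < e / 3 by lra.
  move=> /(_ e3) [d d0 Hd]; exists d => // s sab sd.
  have h1 := Hd s sab sd; have h2 := (Heps t i j tab).2 k; have h3 := (Heps s i j sab).2 k.
  rewrite !mxE; move: h1 h2 h3; set y := limn _; set z := limn _ => h1 h2 h3.
  have -> : z - y = (picard k s i j - picard k t i j) + ((z - picard k s i j) - (y - picard k t i j)) by ring.
  apply: le_lt_trans (ler_normD _ _) _.
  have := ler_normB (z - picard k s i j) (y - picard k t i j); lra.
exists X; split.
  apply/matrixP => i j; rewrite mxE.
  have -> : (fun k => picard k t0 i j) = fun=> X0 i j by apply/funext => k; rewrite picard0.
  by rewrite lim_cst.
(* It remains to pass to the limit in the recursion; both sides are limits of [picard k.+1]. *)
suff E t : I t -> X t = X0 + Prim (fun s => A s *m X s) t.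
  move=> t It; apply: mx_has_deriv_ext (picard_step cX It) => // s Is.
  by rewrite -E.
move=> It; have [a [b [Ia Ib tab t0ab _]]] := hull iI It It0.
have [eps [eps0 Heps]] := picard_cvg Ia Ib t0ab.
have sI := seg_sub iI Ia Ib.
have [M [M0 bA]] := seg_bound_mx (mxC0_sub sI cA).
apply/matrixP => i j.
have L1 : (fun k => picard k.+1 t i j) @ \oo --> X t i j.
  rewrite mxE; have /= := (Heps t i j tab).1 => c.
  by have := c; rewrite -(cvg_shiftS (fun k => picard k t i j)).
have L2 : (fun k => picard k.+1 t i j) @ \oo --> (X0 + Prim (fun s => A s *m X s) t) i j.
  apply/cvgrPdist_le => e e0.
  (* The summand 1 keeps [c] positive when [n], [M] or [t - t0] vanishes. *)
  pose c := n%:R * M * `|t - t0| + 1.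
  have c0 : 0 < c by rewrite ltr_wpDl // !mulr_ge0.
  have ec : 0 < e / c by rewrite divr_gt0.
  have /cvgrPdist_lt /(_ (e / c) ec) := eps0; apply: filterS => k.
  rewrite /= sub0r normrN => /ltr_normlW ek.
  pose D s := (X0 + Prim (fun s => A s *m X s) s) - picard k.+1 s.
  have HD s : I s -> mx_has_deriv I D s (A s *m (X s - picard k s)).
    move=> Is; rewrite mulmxBr; apply: mx_has_derivB => //; first exact: picard_step.
    by apply: (@picard_step (picard k)) => //; exact: picard_cont.
  have D0 : D t0 = 0.
    by rewrite /D picard0 (PrimP _).1 ?addr0 ?subrr //; exact: mxCnM.
  have := @linear_growth a b D (fun s => X s - picard k s) M (eps k) 0 Ia Ib t0ab HD D0 bA _ t i j tab.
  have h : forall s i j, seg a b s -> `|(X s - picard k s) i j| <= eps k * `|s - t0| ^+ 0.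
    by move=> s k' l sab; rewrite expr0 mulr1 !mxE; exact: (Heps s k' l sab).2.
  move=> /(_ h); rewrite expr1 divr1 /D [X in `|X| <= _]mxE [X in _ + X]mxE => h'.
  apply: le_trans h' _.
  have -> : n%:R * M * eps k * `|t - t0| = (c - 1) * eps k by rewrite /c; ring.
  have ek0 : 0 <= eps k by have := h t i j tab; rewrite expr0 mulr1; apply: le_trans; exact: normr_ge0.
  have : c * eps k <= e by rewrite mulrC -ler_pdivlMr // ltW.
  lra.
exact: cvg_unique L1 L2.
Qed.

End Picard.
End LinearODE.

(** * Smooth bases of subspaces of constant dimension *)

Local Opaque Cn.

Section LinearAlgebra.
Context {R : realType}.
Implicit Types (p q n k d : nat).

Definition injmx p q (M : 'M[R]_(p, q)) := forall z : 'cV[R]_q, M *m z = 0 -> z = 0.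

Lemma injmxP p q (M : 'M[R]_(p, q)) : injmx M <-> \rank M = q.
Proof.
split=> [inj|rM z Mz].
  rewrite -mxrank_tr; apply/eqP; apply: inj_row_free => v vM.
  by apply: trmx_inj; rewrite trmx0; apply: inj; rewrite -[M]trmxK -trmx_mul vM trmx0.
have /row_freeP [B HB] : row_free M^T by rewrite /row_free mxrank_tr rM.
by rewrite -[z]mul1mx -[1%:M]trmx1 -HB trmx_mul trmxK -mulmxA Mz mulmx0.
Qed.

Lemma col_mulmx p q n (M : 'M[R]_(p, q)) (N : 'M[R]_(q, n)) j : col j (M *m N) = M *m col j N.
Proof. by rewrite !colE mulmxA. Qed.

Lemma injmx_mx p q n (M : 'M[R]_(p, q)) (Z : 'M[R]_(q, n)) : injmx M -> M *m Z = 0 -> Z = 0.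
Proof.
move=> inj MZ; apply/matrixP => i j.
have : M *m col j Z = 0 by rewrite -col_mulmx MZ col0.
by move/inj/matrixP/(_ i ord0); rewrite !mxE.
Qed.

Lemma injmx_cancel p q n (M : 'M[R]_(p, q)) (Y Z : 'M[R]_(q, n)) :
  injmx M -> M *m Y = M *m Z -> Y = Z.
Proof.
move=> inj E; apply/eqP; rewrite -subr_eq0; apply/eqP.
by apply: (injmx_mx inj); rewrite mulmxBr E subrr.
Qed.

Lemma injmx_unit n (M : 'M[R]_n) : injmx M -> M \in unitmx.
Proof. by move/injmxP => rM; rewrite -row_free_unit /row_free rM. Qed.

Lemma unit_injmx n (M : 'M[R]_n) : M \in unitmx -> injmx M.
Proof. by move=> uM z Mz; rewrite -[z](mulKmx uM) Mz mulmx0. Qed.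

Lemma injmxM p q n (M : 'M[R]_(p, q)) (N : 'M[R]_(q, n)) : injmx M -> injmx N -> injmx (M *m N).
Proof. by move=> iM iN z; rewrite -mulmxA => /iM /iN. Qed.

Lemma mulmx_tr_eq0 n (v : 'cV[R]_n) : v^T *m v = 0 -> v = 0.
Proof.
move/matrixP/(_ ord0 ord0); rewrite !mxE => /eqP.
rewrite psumr_eq0 => [/allP H|i _]; last by rewrite mxE -expr2 sqr_ge0.
apply/matrixP => i j; rewrite ord1 mxE; have := H i (mem_index_enum _).
by rewrite /= mxE mulf_eq0 orbb => /eqP.
Qed.

Lemma gram_inj p q (M : 'M[R]_(p, q)) : injmx M -> injmx (M^T *m M).
Proof.
move=> inj z Hz; apply: inj; apply: mulmx_tr_eq0.
by rewrite trmx_mul -mulmxA (mulmxA M^T) Hz mulmx0.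
Qed.

Lemma gram_unit p q (M : 'M[R]_(p, q)) : injmx M -> M^T *m M \in unitmx.
Proof. by move=> inj; apply: injmx_unit; exact: gram_inj. Qed.

(** The Moore-Penrose inverse of an injective [M]. As an explicit formula it is as smooth as [M]. *)
Definition linv p q (M : 'M[R]_(p, q)) : 'M[R]_(q, p) :=
  locked (invmx (M^T *m M) *m M^T).

Lemma linvK p q (M : 'M[R]_(p, q)) : injmx M -> linv M *m M = 1%:M.
Proof. by move=> inj; rewrite /linv -lock -mulmxA mulVmx // gram_unit. Qed.

Lemma linv_solve p q n (M : 'M[R]_(p, q)) (X : 'M[R]_(q, n)) H : injmx M -> M *m X = H ->
  X = linv M *m H.
Proof. by move=> inj <-; rewrite mulmxA linvK // mul1mx. Qed.

Lemma injmx_row p q n (M : 'M[R]_(p, q)) (N : 'M[R]_(p, n)) (P : 'M[R]_p) :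
  injmx M -> injmx N -> P *m M = M -> P *m N = 0 -> injmx (row_mx M N).
Proof.
move=> iM iN PM PN z; rewrite -[z]vsubmxK mul_row_col => E.
have : P *m (M *m usubmx z + N *m dsubmx z) = 0 by rewrite E mulmx0.
rewrite mulmxDr !mulmxA PM PN mul0mx addr0 => E1.
by rewrite E1 add0r in E; rewrite (iM _ E1) (iN _ E) col_mx0.
Qed.

Lemma kercP p q (M : 'M[R]_(p, q)) x : reflect (M *m x = 0) (x \in kerc M).
Proof. by rewrite memv_ker lfunE /=; exact: eqP. Qed.

Lemma imcP p q (M : 'M[R]_(p, q)) x : reflect (exists u, x = M *m u) (x \in imc M).
Proof.
apply: (iffP memv_imgP) => [[u _ ->]|[u ->]]; first by exists u; rewrite lfunE.
by exists u; rewrite ?memvf // lfunE.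
Qed.

Lemma SspaceP m (E F : 'M[R]_m) z : reflect (exists u, F *m z = E *m u) (z \in Sspace E F).
Proof. by rewrite /Sspace -memv_preim lfunE /=; exact: imcP. Qed.

Definition mx_basis n k (M : 'M[R]_(n, k)) (V : set 'cV[R]_n) :=
  injmx M /\ forall x, V x <-> exists u, x = M *m u.

Lemma mulmx_cols n k (M : 'M[R]_(n, k)) u : M *m u = \sum_j u j ord0 *: col j M.
Proof.
apply/matrixP => i j; rewrite ord1 mxE summxE; apply: eq_bigr => l _.
by rewrite !mxE mulrC.
Qed.

Lemma basis_onP (I : set R) n k (M : R -> 'M[R]_(n, k)) V :
  basis_on I M V <-> forall t, I t -> mx_basis (M t) (V t).
Proof.
have span (t : R) x : x \in <<[seq col j (M t) | j : 'I_k]>>%VS <-> exists u, x = M t *m u.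
  split=> [|[u ->]]; last first.
    rewrite mulmx_cols; apply: memv_suml => j _; apply: memvZ; apply: memv_span.
    by apply: map_f; rewrite mem_enum.
  move/coord_span => ->.
  set c := image_tuple _ _; have sz := card_ord k.
  exists (\col_j (coord c (cast_ord (esym sz) j) x)).
  rewrite mulmx_cols (reindex (cast_ord sz)) /=; last first.
    by exists (cast_ord (esym sz)) => i _; rewrite ?cast_ordK ?cast_ordKV.
  apply: eq_bigr => i _; rewrite mxE cast_ordK; congr (_ *: _).
  have ik : (i < k)%N := ltn_ord (cast_ord sz i).
  rewrite (nth_map (Ordinal ik)) ?size_enum_ord //; congr (col _ _).
  by apply: val_inj; rewrite /= nth_enum_ord.
have fr (t : R) : free [seq col j (M t) | j : 'I_k] <-> injmx (M t).
  pose c := map_tuple (fun j => col j (M t)) (ord_tuple k).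
  have -> : free [seq col j (M t) | j : 'I_k] = free c by [].
  rewrite -(rwP freeP).
  have nE (i : 'I_k) : c`_i = col i (M t).
    by rewrite (nth_map i) ?size_enum_ord // nth_ord_enum.
  split=> [H z|H k0 E i].
    rewrite mulmx_cols => E; apply/matrixP => i j; rewrite ord1 mxE.
    by apply: (H (fun i => z i ord0)); rewrite -[RHS]E; apply: eq_bigr => l _; rewrite nE.
  have : (\col_i k0 i) = 0 :> 'cV[R]_k.
    by apply: H; rewrite mulmx_cols -[RHS]E; apply: eq_bigr => l _; rewrite nE mxE.
  by move/matrixP/(_ i ord0); rewrite !mxE.
split=> H t It.
  have [/= /fr f E] := H t It; split=> // x; rewrite -E /=; exact: span.
have [i E] := H t It; split; first exact/fr.
by rewrite predeqE => x; rewrite E /=; exact: span.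
Qed.

Lemma mx_basis_linv n k (M : 'M[R]_(n, k)) V x : mx_basis M V -> V x -> M *m (linv M *m x) = x.
Proof.
by move=> [i H] /H [u ->]; rewrite (mulmxA (linv M)) linvK // mul1mx.
Qed.

Lemma mx_basis_size n k l (M : 'M[R]_(n, k)) (N : 'M[R]_(n, l)) V :
  mx_basis M V -> mx_basis N V -> k = l.
Proof.
have W k' l' (M' : 'M[R]_(n, k')) (N' : 'M[R]_(n, l')) : mx_basis M' V -> mx_basis N' V -> (k' <= l')%N.
  move=> bM bN; have [iM HM] := bM.
  have : M' = N' *m (linv N' *m M').
    apply/matrixP => i j.
    have /(mx_basis_linv bN) : V (col j M') by apply/HM; exists (delta_mx j ord0); rewrite colE.
    by rewrite -!col_mulmx => /matrixP/(_ i ord0); rewrite !mxE.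
  move=> E; have /injmxP <- := iM; rewrite E.
  by apply: leq_trans (mxrankM_maxr _ _) _; exact: rank_leq_row.
by move=> bM bN; apply/eqP; rewrite eqn_leq !(W _ _ _ _ bM bN, W _ _ _ _ bN bM).
Qed.

Lemma mx_basis_exists n k (V : {vspace 'cV[R]_n}) : \dim V = k ->
  exists M : 'M[R]_(n, k), mx_basis M [set` V].
Proof.
move=> <-; exists (\matrix_(i, j) (vbasis V)`_j i ord0).
have cE (u : 'cV_(\dim V)) : (\matrix_(i, j) (vbasis V)`_j i ord0) *m u = \sum_j u j ord0 *: (vbasis V)`_j.
  rewrite mulmx_cols; apply: eq_bigr => j _; congr (_ *: _).
  by apply/matrixP => a b; rewrite !mxE (ord1 b).
split=> [z|x]; last split=> [xV|[u ->]].
- rewrite cE => E; apply/matrixP => i j; rewrite ord1 mxE.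
  by have /freeP /(_ (fun i => z i ord0) E i) := basis_free (vbasisP V).
- exists (\col_i coord (vbasis V) i x); rewrite cE {1}(coord_vbasis xV).
  by apply: eq_bigr => i _; rewrite mxE.
rewrite cE /=; apply: memv_suml => j _; apply: memvZ.
by apply: vbasis_mem; rewrite mem_nth // size_tuple.
Qed.

Lemma mx_basis_dim n k (M : 'M[R]_(n, k)) (V : {vspace 'cV[R]_n}) :
  mx_basis M [set` V] -> \dim V = k.
Proof.
by move=> bM; have [N bN] := mx_basis_exists (erefl (\dim V)); rewrite (mx_basis_size bM bN).
Qed.

(** Sandwiching the product rule between two copies of [N] turns it into [X = X + X] for
    [X = N N' N]. *)
Lemma idem_deriv n (N N' : 'M[R]_n) : N *m N = N -> N' = N' *m N + N *m N' -> N *m N' *m N = 0.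
Proof.
move=> NN E; have := congr1 (fun X => N *m X *m N) E.
rewrite mulmxDr mulmxDl !mulmxA NN -!mulmxA NN !mulmxA.
by move/eqP; rewrite -subr_eq0 opprD addrA subrr sub0r oppr_eq0 => /eqP.
Qed.

Lemma mxCn_linv (I : set R) n p q (M : R -> 'M[R]_(p, q)) : no_isolated I ->
  (forall t, I t -> injmx (M t)) -> mxCn I n M -> mxCn I n (fun t => linv (M t)).
Proof.
move=> niI inj cM.
apply: (@mxCn_ext _ _ _ _ _ (fun t => invmx ((M t)^T *m M t) *m (M t)^T)).
  by move=> t It; rewrite /linv -lock.
apply: mxCnM => //; last exact: mxCnT.
apply: mxCnV => //; first by move=> t It; apply: gram_unit; exact: inj.
by apply: mxCnM => //; exact: mxCnT.
Qed.

End LinearAlgebra.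

(** * Smooth projectors, kernels and rank normal forms *)

Section SmoothBases.
Context {R : realType}.
Implicit Types (p q n k d : nat).
Variable I : set R.
Hypothesis nI : nondeg_itv I.
Let niI : no_isolated I := nondeg_no_isolated nI.

Lemma mxCn_solve n p q k (M : R -> 'M[R]_(p, q)) (X : R -> 'M[R]_(q, k)) H :
  (forall t, I t -> injmx (M t)) -> (forall t, I t -> M t *m X t = H t) ->
  mxCn I n M -> mxCn I n H -> mxCn I n X.
Proof.
move=> inj E cM cH; apply: (@mxCn_ext _ _ _ _ _ (fun t => linv (M t) *m H t)).
  by move=> t It; rewrite -(linv_solve (inj t It) (E t It)).
by apply: mxCnM => //; exact: mxCn_linv.
Qed.

Lemma mxCn_linear_ode k n p (A : R -> 'M[R]_n) (X : R -> 'M[R]_(n, p)) :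
  mxCn I k A -> (forall t, I t -> mx_has_deriv I X t (A t *m X t)) -> mxCn I k.+1 X.
Proof.
move=> cA HX; have cX j : (j <= k)%N -> mxCn I j X.
  elim: j => [_|j IH jk]; first by apply: mx_has_deriv_cont => t It; exists (A t *m X t); exact: HX.
  apply: (mxCnS_deriv niI HX); apply: mxCnM => //; last by apply: IH; exact: ltnW.
  by apply: mxCn_le cA => //; exact: ltnW.
by apply: (mxCnS_deriv niI HX); apply: mxCnM => //; exact: cX.
Qed.

(* The flow of [C' = P' C] preserves [im P] because [P P' P = 0]. *)
Lemma projector_basis k n d (P : R -> 'M[R]_n) : mxCn I k.+1 P ->
  (forall t, I t -> P t *m P t = P t /\ \rank (P t) = d) ->
  exists C : R -> 'M[R]_(n, d), mxCn I k.+1 C /\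
    forall t, I t -> [/\ injmx (C t), P t *m C t = C t & exists D, P t = C t *m D].
Proof.
move=> cP HP; have [a [_ [Ia _ _]]] := nI.2.
pose P' := mxderiv I P.
have dP t : I t -> mx_has_deriv I P t (P' t) by move=> It; apply: mxCn_has_deriv cP.
have cP' : mxCn I k P' by exact: mxCn_deriv.
have P'E t : I t -> P' t = P' t *m P t + P t *m P' t.
  move=> It; rewrite -(mxderivE niI It (mx_has_derivM It (dP t It) (dP t It))).
  apply/esym; apply: mxderivE => //; apply: mx_has_deriv_ext (dP t It) => // s Is.
  by rewrite (HP s Is).1.
have PP'P t : I t -> P t *m P' t *m P t = 0.
  by move=> It; exact: idem_deriv (HP t It).1 (P'E t It).
have [C0 iC0 PC0] : exists2 C0 : 'M[R]_(n, d), injmx C0 & P a *m C0 = C0.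
  have [PP rP] := HP a Ia; rewrite -rP; exists (col_base (P a)).
    by apply/injmxP; exact/eqP/col_base_full.
  have /row_freeP [B HB] := row_base_free (P a).
  have E : P a *m col_base (P a) *m row_base (P a) = col_base (P a) *m row_base (P a).
    by rewrite -mulmxA mulmx_base.
  by have := congr1 (mulmx^~ B) E; rewrite -!(mulmxA _ (row_base _)) HB !mulmx1.
have [C [Ca HC]] := ode_exists nI Ia (mxCn_le niI (leq0n k) cP') C0.
have PC t : I t -> P t *m C t = C t.
  move=> It; apply/esym/eqP; rewrite -subr_eq0; apply/eqP.
  have cN : mxCn I 0 (fun t => - P' t).
    by apply: mxCnN => //; apply: mxCn_le cP' => //.
  (* The defect [C - P C] satisfies [X' = - P' X] and vanishes at [a]. *)
  apply: (ode_unique nI Ia cN (X := fun t => C t - P t *m C t)) => // [s Is|]; last first.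
    by rewrite Ca PC0 subrr.
  have := mx_has_derivB Is (HC s Is) (mx_has_derivM Is (dP s Is) (HC s Is)).
  congr mx_has_deriv.
  rewrite mulmxBr opprD addrA subrr sub0r mulNmx mulNmx opprK.
  have E : P' s *m (P s *m C s) = P' s *m C s - P s *m (P' s *m C s).
    by rewrite !mulmxA {2}(P'E s Is) mulmxDl addrK.
  by rewrite E addrA addNr sub0r.
(* If [C t *m z = 0], then [C z] is a solution vanishing at [t], hence also at [a], where [C] is
   injective. *)
have iC t : I t -> injmx (C t).
  move=> It z Cz; apply: iC0; rewrite -Ca.
  apply: (ode_unique nI It (mxCn_le niI (leq0n k) cP') (X := fun t => C t *m z)) => // s Is.
  have := mx_has_derivM Is (HC s Is) (mx_has_deriv_cst I z s).
  by rewrite mulmx0 addr0 mulmxA.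
exists C; split; first exact: mxCn_linear_ode HC.
move=> t It; split; [exact: iC|exact: PC|].
have sub : ((C t)^T <= (P t)^T)%MS by rewrite -(PC t It) trmx_mul submxMl.
have rC : \rank (C t)^T = d by rewrite mxrank_tr; apply/injmxP; exact: iC.
have : ((P t)^T <= (C t)^T)%MS.
  by rewrite -(mxrank_leqif_sup sub) rC mxrank_tr (HP t It).2.
by move/submxP => [D E]; exists D^T; rewrite -[P t]trmxK E trmx_mul trmxK.
Qed.

(** The orthogonal projector along [ker M], characterised by equations that determine it
    uniquely. *)
Definition is_rowproj p q (M : 'M[R]_(p, q)) (P : 'M[R]_q) :=
  [/\ P^T = P, M *m P = M & exists N, P = N *m M].

Lemma is_rowproj_uniq p q (M : 'M[R]_(p, q)) P1 P2 : is_rowproj M P1 -> is_rowproj M P2 -> P1 = P2.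
Proof.
have W P P' : is_rowproj M P -> is_rowproj M P' -> P = P *m P'.
  by move=> [_ _ [N ->]] [_ E _]; rewrite -mulmxA E.
move=> H1 H2; have [T1 _ _] := H1; have [T2 _ _] := H2.
by rewrite -T1 (W _ _ H1 H2) trmx_mul T1 T2 -(W _ _ H2 H1).
Qed.

Lemma is_rowproj_idem p q (M : 'M[R]_(p, q)) P : is_rowproj M P ->
  P *m P = P /\ \rank P = \rank M.
Proof.
move=> [T E [N EN]]; split; first by rewrite {1}EN -mulmxA E.
apply/eqP; rewrite eqn_leq {1}EN mxrankM_maxr /=.
by rewrite -{1}E mxrankM_maxr.
Qed.

Lemma is_rowprojE p q d (M : 'M[R]_(p, q)) (S : 'M[R]_(d, p)) (B : 'M[R]_(d, q)) :
  B = S *m M -> \rank M = d -> \rank B = d -> is_rowproj M (B^T *m invmx (B *m B^T) *m B).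
Proof.
move=> EB rM rB.
have iB : injmx B^T by apply/injmxP; rewrite mxrank_tr rB.
have uB : B *m B^T \in unitmx by have := gram_unit iB; rewrite trmxK.
split.
- by rewrite !trmx_mul trmxK trmx_inv trmx_mul trmxK  mulmxA.
- have /submxP [D E] : (M <= B)%MS.
    have sub : (B <= M)%MS by rewrite EB; exact: submxMl.
    by rewrite -(mxrank_leqif_sup sub) rB rM.
  by rewrite {1}E !mulmxA -(mulmxA D) -(mulmxA D) mulmxV // mulmx1 -E.
- by exists (B^T *m invmx (B *m B^T) *m S); rewrite {4}EB !mulmxA.
Qed.

Lemma rowproj_exists p q (M : 'M[R]_(p, q)) : exists P, is_rowproj M P.
Proof.
have /submxP [S E] : (row_base M <= M)%MS by rewrite eq_row_base.
have rB : \rank (S *m M) = \rank M by rewrite -E; apply/eqP; exact: row_base_free.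
by eexists; exact: (is_rowprojE erefl erefl rB).
Qed.

(* Continuity of the determinant keeps a full rank selection of rows full
   rank nearby. *)
Lemma smooth_rowproj k p q d (M : R -> 'M[R]_(p, q)) : mxCn I k M ->
  (forall t, I t -> \rank (M t) = d) ->
  exists P : R -> 'M[R]_q, mxCn I k P /\ forall t, I t -> is_rowproj (M t) (P t).
Proof.
move=> cM rM; pose P t := xget 0 [set P | is_rowproj (M t) P].
have HP t : is_rowproj (M t) (P t) by exact: (xgetPex 0 (rowproj_exists (M t))).
(* The pointwise choice is smooth because, by uniqueness, it agrees near each point with the formula
   for one fixed selection [S] of row combinations. *)
exists P; split=> //; apply: mxCn_local => // t It.
have [S rS] : exists S : 'M[R]_(d, p), \rank (S *m M t) = d.
  have /submxP [S E] : (row_base (M t) <= M t)%MS by rewrite eq_row_base.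
  rewrite -(rM t It); exists S; rewrite -E; apply/eqP; exact: row_base_free.
pose B s := S *m M s.
have cB : mxCn I k B by apply: mxCnM => //; exact: mxCn_cst.
have cG : mxCn I k (fun s => B s *m (B s)^T) by apply: mxCnM => //; exact: mxCnT.
pose g s := \det (B s *m (B s)^T).
have uG s : \rank (B s) = d <-> g s != 0.
  rewrite -unitfE -unitmxE; split=> [rB|u].
    have iB : injmx (B s)^T by apply/injmxP; rewrite mxrank_tr.
    by have := gram_unit iB; rewrite trmxK.
  apply/eqP; rewrite eqn_leq rank_leq_row /=; have := mxrank_unit u.
  by move=> {1}<-; exact: mxrankM_maxl.
have gt : g t != 0 by apply/uG.
have cg : cont_at I g t by apply: (Cn_cont niI It (n := k)); exact: Cn_det.
have [e e0 He] : exists2 e : R, 0 < e & forall s, I s -> `|s - t| < e -> g s != 0.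
  move/cont_atP: cg => /(_ `|g t|); rewrite normr_gt0 => /(_ gt) [e e0 He].
  exists e => // s Is se; apply/eqP => gs; have := He s Is se.
  by rewrite gs sub0r normrN ltxx.
pose J := `]t - e, t + e[ `&` I.
have nJ : nondeg_itv J by exact: nondeg_itvI.
have JI : J `<=` I by move=> s [].
exists J; split => //; first exact: nondeg_no_isolated.
- by split=> //=; rewrite in_itv /=; apply/andP; split; lra.
- by move=> s; exact: rel_nbhsI.
have niJ := nondeg_no_isolated nJ.
have gJ s : J s -> g s != 0.
  move=> [/= + Is]; rewrite in_itv /= => /andP[? ?]; apply: He => //.
  by rewrite ltr_norml; apply/andP; split; lra.
apply: (@mxCn_ext _ _ _ _ _ (fun s => (B s)^T *m invmx (B s *m (B s)^T) *m B s)).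
  move=> s Js; apply: (@is_rowproj_uniq _ _ (M s)) => //.
  apply: (@is_rowprojE _ _ d _ S) => //; first exact: (rM s (JI _ Js)).
  by apply/uG; exact: gJ.
have cBJ : mxCn J k B by exact: (mxCn_restrict niI niJ JI).
apply: mxCnM => //; apply: mxCnM => //; first exact: mxCnT.
apply: mxCnV => //; first by move=> s Js; rewrite unitmxE unitfE; exact: gJ.
by apply: mxCnM => //; exact: mxCnT.
Qed.

Lemma rank_compl_proj n d (P : 'M[R]_(d + n)) : P *m P = P -> \rank P = d -> \rank (1%:M - P) = n.
Proof.
move=> PP rP; apply/eqP; rewrite eqn_leq; apply/andP; split.
  have : (1%:M - P) *m P = 0 by rewrite mulmxBl mul1mx PP subrr.
  by move/mulmx0_rank_max; rewrite rP addnC leq_add2l.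
have := mxrank_add P (1%:M - P); rewrite addrC subrK mxrank1 rP.
by rewrite leq_add2l.
Qed.

Lemma smooth_completion k n d (P : R -> 'M[R]_(d + n)) : mxCn I k.+1 P ->
  (forall t, I t -> P t *m P t = P t /\ \rank (P t) = d) ->
  exists C : R -> 'M[R]_(d + n, n), mxCn I k.+1 C /\
    forall t, I t -> injmx (C t) /\ P t *m C t = 0.
Proof.
move=> cP HP.
have [||C [cC HC]] := @projector_basis k (d + n) n (fun t => 1%:M - P t).
- by apply: mxCnB => //; exact: mxCn_cst.
- move=> t It; have [PP rP] := HP t It; split; last exact: rank_compl_proj.
  by rewrite mulmxBr mulmx1 mulmxBl mul1mx PP subrr subr0.
exists C; split=> // t It; have [iC PC _] := HC t It; split=> //.
by rewrite -PC mulmxBl mul1mx mulmxBr mulmxA (HP t It).1 subrr.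
Qed.

Definition smooth_unit k n (L : R -> 'M[R]_n) := mxCn I k L /\ forall t, I t -> L t \in unitmx.

Lemma smooth_kernel_basis k p q d (M : R -> 'M[R]_(p, d + q)) : mxCn I k.+1 M ->
  (forall t, I t -> \rank (M t) = d) ->
  exists C : R -> 'M[R]_(d + q, q), mxCn I k.+1 C /\
    forall t, I t -> mx_basis (C t) [set z | M t *m z = 0].
Proof.
move=> cM rM; have [P [cP HP]] := smooth_rowproj cM rM.
have HP' t : I t -> P t *m P t = P t /\ \rank (P t) = d.
  by move=> It; have [? E] := is_rowproj_idem (HP t It); rewrite E rM.
have [||C [cC HC]] := @projector_basis k (d + q) q (fun t => 1%:M - P t).
- by apply: mxCnB => //; exact: mxCn_cst.
- move=> t It; have [PP rP] := HP' t It; split; last exact: rank_compl_proj.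
  by rewrite mulmxBr mulmx1 mulmxBl mul1mx PP subrr subr0.
exists C; split=> // t It; have [iC PC [D ED]] := HC t It; split=> // z.
have [_ MP [N EN]] := HP t It; split=> [/= Mz|[u ->] /=].
  have Pz : P t *m z = 0 by rewrite EN -mulmxA Mz mulmx0.
  exists (D *m z); rewrite mulmxA -ED mulmxBl mul1mx Pz subr0 //.
by rewrite -PC !mulmxA mulmxBr mulmx1 MP subrr !mul0mx.
Qed.

(** [V] spans the kernel, [W] its orthogonal complement, and [U] completes the columns [T = M W] of
    the image. In the bases [(W, V)] and [(T, U)] the matrix becomes the block identity. *)
Lemma smooth_rank_normal_form k p q d (M : R -> 'M[R]_(d + p, d + q)) : mxCn I k.+1 M ->
  (forall t, I t -> \rank (M t) = d) ->
  exists L K, [/\ smooth_unit k.+1 L, smooth_unit k.+1 K &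
    forall t, I t -> L t *m M t *m K t = block_mx 1%:M 0 0 0].
Proof.
move=> cM rM; have [P [cP HP]] := smooth_rowproj cM rM.
have HP' t : I t -> P t *m P t = P t /\ \rank (P t) = d.
  by move=> It; have [? E] := is_rowproj_idem (HP t It); rewrite E rM.
have [W [cW HW]] := projector_basis cP HP'.
have [V [cV HV]] := smooth_completion cP HP'.
pose T t := M t *m W t.
have cT : mxCn I k.+1 T by exact: mxCnM.
have iT t : I t -> injmx (T t).
  move=> It z; rewrite /T -mulmxA => E; have [iW PW _] := HW t It; have [_ _ [N EN]] := HP t It.
  by apply: iW; rewrite -PW EN -!mulmxA E mulmx0.
have [P2 [cP2 HP2]] : exists P2 : R -> 'M[R]_(d + p), mxCn I k.+1 P2 /\
    forall t, I t -> is_rowproj (T t)^T (P2 t).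
  apply: (@smooth_rowproj _ _ _ d); first exact: mxCnT.
  by move=> t It; rewrite mxrank_tr; apply/injmxP; exact: iT.
have HP2' t : I t -> P2 t *m P2 t = P2 t /\ \rank (P2 t) = d.
  move=> It; have [? E] := is_rowproj_idem (HP2 t It); rewrite E mxrank_tr; split=> //.
  by apply/injmxP; exact: iT.
have [U [cU HU]] := smooth_completion cP2 HP2'.
have uTU t : I t -> row_mx (T t) (U t) \in unitmx.
  move=> It; have [iU PU] := HU t It; have [PT TP _] := HP2 t It.
  apply: injmx_unit; apply: (injmx_row (P := P2 t)) => //; first exact: iT.
  by apply: trmx_inj; rewrite trmx_mul PT.
exists (fun t => invmx (row_mx (T t) (U t))), (fun t => row_mx (W t) (V t)); split.
- split; last by move=> t It; rewrite unitmx_inv uTU.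
  by apply: mxCnV => //; exact: mxCn_row.
- split; first exact: mxCn_row.
  move=> t It; have [iW PW _] := HW t It; have [iV PV] := HV t It.
  by apply: injmx_unit; exact: (injmx_row (P := P t)).
move=> t It; rewrite -mulmxA mul_mx_row -/(T t).
have -> : M t *m V t = 0.
  by have [_ MP _] := HP t It; rewrite -MP -mulmxA (HV t It).2 mulmx0.
have -> : row_mx (T t) 0 =
    row_mx (T t) (U t) *m (block_mx 1%:M 0 0 0 : 'M[R]_(d + p, d + q)).
  rewrite (mul_row_block (T t) (U t)) !mulmx1 !mulmx0 !addr0 //.
by rewrite mulKmx // uTU.
Qed.

End SmoothBases.

(** * Reduction steps and regularity *)

Section ReductionTheory.
Context {R : realType}.
Implicit Types (p q n k d m r : nat).
Variable I : set R.
Hypothesis niI : no_isolated I.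

Lemma dim_imc p q (M : 'M[R]_(p, q)) : \dim (imc M) = \rank M.
Proof.
apply: (@mx_basis_dim _ _ _ (col_base M)); split.
  by apply/injmxP; exact/eqP/col_base_full.
move=> x /=; split=> [/imcP [u ->]|[u ->]].
  by exists (row_base M *m u); rewrite mulmxA mulmx_base.
have /row_freeP [B HB] := row_base_free M.
apply/imcP; exists (B *m u).
have <- : col_base M *m row_base M *m (B *m u) = M *m (B *m u) by rewrite mulmx_base.
by rewrite -mulmxA (mulmxA (row_base M)) HB mul1mx.
Qed.

Lemma dim_kerc p q (M : 'M[R]_(p, q)) : \dim (kerc M) = (q - \rank M)%N.
Proof.
have E : (\dim (kerc M) + \rank M)%N = q.
  have := limg_ker_dim (linfun (mulmx M : 'cV[R]_q -> 'cV[R]_p)) fullv.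
  by rewrite capfv dimvf -/(kerc M) -/(imc M) dim_imc /dim /= muln1.
by apply/eqP; rewrite -(eqn_add2r (\rank M)) E subnK // rank_leq_col.
Qed.

Definition Sset m (E F : 'M[R]_m) : set 'cV[R]_m := [set z | exists u, F *m z = E *m u].

Definition prereg_at m (E F : 'M[R]_m) r theta :=
  [/\ forall w : 'cV[R]_m, exists u v, w = E *m u + F *m v, \rank E = r
    & exists V : 'M[R]_(m, theta), mx_basis V [set z | E *m z = 0 /\ Sset E F z]].

Lemma prereg_atP m (E F : R -> 'M[R]_m) r theta :
  pre_regular I E F r theta <-> forall t, I t -> prereg_at (E t) (F t) r theta.
Proof.
have S1 t : [set` (kerc (E t) :&: Sspace (E t) (F t))%VS] =
    [set z | E t *m z = 0 /\ Sset (E t) (F t) z].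
  rewrite predeqE => z /=; rewrite memv_cap; split=> [/andP[/kercP ? /SspaceP ?]|[? ?]] //.
  by apply/andP; split; [apply/kercP|apply/SspaceP].
have S2 t : imc (row_mx (E t) (F t)) = fullv <->
    forall w : 'cV[R]_m, exists u v, w = E t *m u + F t *m v.
  split=> [H w|H].
    have : w \in imc (row_mx (E t) (F t)) by rewrite H memvf.
    move=> /imcP [u ->]; exists (usubmx u), (dsubmx u).
    by rewrite -mul_row_col vsubmxK.
  apply/vspaceP => w; rewrite memvf; apply/imcP; have [u [v ->]] := H w.
  by exists (col_mx u v); rewrite mul_row_col.
split=> H t It; have [h1 h2 h3] := H t It; split=> //; first exact/S2.
- by rewrite -S1; exact: mx_basis_exists.
- exact/S2.
- by move: h3 => [V]; rewrite -S1; exact: mx_basis_dim.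
Qed.

(** [Z] enters a reduction only through the space [S = ker Z^T F], so it can be eliminated. *)
Definition red_step m r (E F : R -> 'M[R]_m) (E1 F1 : R -> 'M[R]_r) :=
  exists (Y C : R -> 'M[R]_(m, r)),
    [/\ forall t, I t -> mx_basis (Y t) [set z | exists u, z = E t *m u],
        forall t, I t -> mx_basis (C t) (Sset (E t) (F t)), mxCn I 1 C
      & forall t, I t -> E1 t = (Y t)^T *m E t *m C t /\
          F1 t = (Y t)^T *m (F t *m C t + E t *m mxderiv I C t)].

Lemma orthocE n (E : 'M[R]_n) : orthoc (imc E) = [set` kerc E^T].
Proof.
rewrite predeqE => z; split=> [H|/kercP H x /imcP [u ->]] /=.
  apply/kercP; apply: trmx_inj; rewrite trmx0 trmx_mul trmxK.
  apply/matrixP => i j; have := H (col j E); rewrite colE.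
  have h : E *m delta_mx j ord0 \in imc E by apply/imcP; exists (delta_mx j ord0).
  by move=> /(_ h); rewrite -colE -col_mulmx => /matrixP/(_ i ord0); rewrite !mxE.
by rewrite mulmxA -[E]trmxK -trmx_mul H trmx0 mul0mx.
Qed.

(** For [w] orthogonal to the columns of [Z] and [P] the orthogonal projector onto [im E], the
    vector [w - P w] lies in [ker E^T] and is orthogonal to it; hence [w] is in [im E]. *)
Lemma kerc_Z n k (E : 'M[R]_n) (F : 'M[R]_n) (Z : 'M[R]_(n, k)) :
  mx_basis Z (orthoc (imc E)) -> [set` kerc (Z^T *m F)] = Sset E F.
Proof.
rewrite orthocE => -[iZ HZ].
have ZE : Z^T *m E = 0.
  apply: trmx_inj; rewrite trmx0 trmx_mul trmxK; apply/matrixP => i j; rewrite mxE.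
  have /kercP : Z *m delta_mx j ord0 \in kerc E^T by apply/HZ; exists (delta_mx j ord0).
  by rewrite -colE -col_mulmx => /matrixP/(_ i ord0); rewrite !mxE.
rewrite predeqE => z /=; split=> [/kercP|[u Fu]]; last first.
  by apply/kercP; rewrite -mulmxA Fu mulmxA ZE mul0mx.
rewrite -mulmxA /Sset /=; move: (F *m z) => w Zw.
have [P [PT EP [N EN]]] := rowproj_exists E^T.
have PE : P = E *m N^T by rewrite -PT EN trmx_mul trmxK.
have PEE : P *m E = E by apply: trmx_inj; rewrite trmx_mul PT EP.
have /HZ [v Ev] : w - P *m w \in kerc E^T.
  by apply/kercP; rewrite mulmxBr (mulmxA E^T P) EP subrr.
have : w - P *m w = 0.
  apply: mulmx_tr_eq0; rewrite {1}Ev trmx_mul -mulmxA mulmxBr Zw PE !mulmxA.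
  by rewrite ZE !mul0mx subrr mulmx0.
by move/eqP; rewrite subr_eq0 => /eqP ->; exists (N^T *m w); rewrite mulmxA PE.
Qed.

Lemma red_stepP m r (E F : R -> 'M[R]_m) (E1 F1 : R -> 'M[R]_r) :
  (forall t, I t -> \rank (E t) = r) ->
  reduction_step I E F E1 F1 <-> red_step E F E1 F1.
Proof.
move=> rE.
have imE t : [set` imc (E t)] = [set z | exists u, z = E t *m u].
  by rewrite predeqE => z; split=> [/imcP|?] //=; apply/imcP.
split=> [[Y [Z [C [/basis_onP HY /basis_onP HZ /basis_onP HC cC H]]]]|[Y [C [HY HC cC H]]]].
  exists Y, C; split=> // t It; first by rewrite -imE; exact: HY.
  by rewrite -(kerc_Z (F t) (HZ t It)); exact: HC.
have exZ t : I t -> exists Z : 'M[R]_(m, m - r), mx_basis Z (orthoc (imc (E t))).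
  move=> It; rewrite orthocE; apply: mx_basis_exists.
  by rewrite dim_kerc mxrank_tr rE.
pose Z t := xget 0 [set Z : 'M[R]_(m, m - r) | mx_basis Z (orthoc (imc (E t)))].
have HZ t : I t -> mx_basis (Z t) (orthoc (imc (E t))).
  by move=> It; exact: (xgetPex 0 (exZ t It)).
exists Y, Z, C; split=> //; apply/basis_onP => t It.
- by rewrite imE; exact: HY.
- exact: HZ.
- by rewrite (kerc_Z (F t) (HZ t It)); exact: HC.
Qed.

(** The equation is multiplied by [L] and [x] is replaced by [K x]. Only [K] is differentiated, so
    [L] is merely pointwise invertible. *)
Definition eqv m (E F E' F' : R -> 'M[R]_m) :=
  exists L K : R -> 'M[R]_m,
    [/\ forall t, I t -> L t \in unitmx, forall t, I t -> K t \in unitmx, mxCn I 1 K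
      & forall t, I t -> E' t = L t *m E t *m K t /\
          F' t = L t *m (F t *m K t + E t *m mxderiv I K t)].

Lemma mxderiv_inv m (K : R -> 'M[R]_m) t : (forall t, I t -> K t \in unitmx) -> mxCn I 1 K ->
  I t -> K t *m mxderiv I (fun t => invmx (K t)) t = - (mxderiv I K t *m invmx (K t)).
Proof.
move=> uK cK It; have cKi := mxCnV niI uK cK.
have := mx_has_derivM It (mxCn_has_deriv niI It cK) (mxCn_has_deriv niI It cKi).
move/(mxderivE niI It) => E; apply/eqP; rewrite -addr_eq0 addrC -E; apply/eqP.
apply: (mxderivE niI It).
by apply: mx_has_deriv_ext (mx_has_deriv_cst I 1%:M t) => // s Is; rewrite mulmxV // uK.
Qed.

Lemma eqv_sym m (E F E' F' : R -> 'M[R]_m) : eqv E F E' F' -> eqv E' F' E F.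
Proof.
move=> [L [K [uL uK cK H]]].
exists (fun t => invmx (L t)), (fun t => invmx (K t)); split.
- by move=> t It; rewrite unitmx_inv uL.
- by move=> t It; rewrite unitmx_inv uK.
- exact: mxCnV.
move=> t It; have [-> ->] := H t It; have uLt := uL t It; have uKt := uK t It; split.
  by rewrite !mulmxA mulVmx // mul1mx -mulmxA mulmxV // mulmx1.
rewrite -!(mulmxA (L t)) -mulmxDr mulKmx // mulmxDl -!mulmxA mulmxV // mulmx1.
by rewrite mxderiv_inv // mulmxN addrK.
Qed.

(** The matrix [K1] stands for [K'], but its value is irrelevant: [E K1] only adds elements of
    [im E], so [S] is transformed by [K] alone. *)
Lemma prereg_eqv m (E F L K K1 : 'M[R]_m) r theta : L \in unitmx -> K \in unitmx ->
  prereg_at E F r theta -> prereg_at (L *m E *m K) (L *m (F *m K + E *m K1)) r theta.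
Proof.
move=> uL uK [h1 h2 [V [iV HV]]]; split.
- move=> w; have [u [v E1]] := h1 (invmx L *m w).
  exists (invmx K *m (u - K1 *m (invmx K *m v))), (invmx K *m v).
  rewrite -!(mulmxA L) -mulmxDr -[LHS](mulKVmx uL); congr (L *m _).
  rewrite E1 mulmxDl -!mulmxA !(mulKVmx uK) mulmxBr.
  by rewrite addrA addrAC subrK.
- rewrite mxrankMfree ?row_free_unit //.
  by rewrite (eqmxMfull _ (_ : row_full L)) ?row_full_unit.
exists (invmx K *m V); split.
  by apply: injmxM => //; apply: unit_injmx; rewrite unitmx_inv.
move=> z; have kE : L *m E *m K *m z = 0 <-> E *m (K *m z) = 0.
  rewrite -!mulmxA; split=> [/(unit_injmx uL) //|->]; exact: mulmx0.
have sE : Sset (L *m E *m K) (L *m (F *m K + E *m K1)) z <-> Sset E F (K *m z).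
  rewrite /Sset /=; split=> -[u].
    rewrite -!mulmxA => /(injmx_cancel (unit_injmx uL)); rewrite mulmxDl -!mulmxA => E1.
    by exists (K *m u - K1 *m z); rewrite mulmxBr -E1 addrK.
  move=> E1; exists (invmx K *m (u + K1 *m z)).
  by rewrite -!mulmxA (mulKVmx uK) mulmxDl -!mulmxA E1 -mulmxDr.
rewrite /= kE sE; have /= -> := HV (K *m z); split=> -[u].
  by move=> Eu; exists u; rewrite -mulmxA -Eu mulKmx.
by move=> ->; exists u; rewrite !mulmxA mulmxV // mul1mx.
Qed.

End ReductionTheory.

Section Regularity2.
Context {R : realType}.
Implicit Types (p q n k d m r : nat).
Variable I : set R.
Hypothesis niI : no_isolated I.

Lemma sub_im_mx m n k (M : 'M[R]_(m, n)) (N : 'M[R]_(m, k)) :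
  (forall z : 'cV[R]_k, exists u, N *m z = M *m u) -> exists U, N = M *m U.
Proof.
move=> H; have /submxP [D E] : (N^T <= M^T)%MS.
  apply/row_subP => i; have [u Eu] := H (delta_mx i ord0).
  by apply/submxP; exists u^T; rewrite -tr_col colE Eu trmx_mul.
by exists D^T; rewrite -[N]trmxK E trmx_mul trmxK.
Qed.

Lemma gram_pinv p q k (T : 'M[R]_(p, q)) (S : 'M[R]_(q, k)) : injmx T ->
  (T *m invmx (T^T *m T) *m S)^T *m T = S^T.
Proof.
move=> iT; rewrite !trmx_mul trmx_inv trmx_mul trmxK -!mulmxA mulVmx ?mulmx1 //.
exact: gram_unit.
Qed.

Lemma step_eqv m r (E F E' F' : R -> 'M[R]_m) (E1 F1 : R -> 'M[R]_r) :
  eqv I E F E' F' -> red_step I E F E1 F1 -> red_step I E' F' E1 F1.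
Proof.
move=> [L [K [uL uK cK H]]] [Y [C [HY HC cC HE]]].
pose T t := L t *m Y t.
(* Chosen so that [Y'^T T = Y^T Y], whence [Y'^T L E = Y^T E]. With [C' = K^-1 C] the new step
   yields literally the same reduced pair. *)
pose Y' t := T t *m invmx ((T t)^T *m T t) *m ((Y t)^T *m Y t).
pose C' t := invmx (K t) *m C t.
have iT t : I t -> injmx (T t).
  by move=> It; apply: injmxM; [exact/unit_injmx/uL|case: (HY t It)].
have YE t : I t -> exists W, E t = Y t *m W.
  move=> It; apply: sub_im_mx => z; have [_ /= HYt] := HY t It.
  by apply/HYt; exists z.
have EY t : I t -> exists W, Y t = E t *m W.
  move=> It; apply: sub_im_mx => z; have [_ /= HYt] := HY t It.
  by apply/HYt; exists z.
have YLE t : I t -> (Y' t)^T *m L t *m E t = (Y t)^T *m E t.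
  move=> It; have [W EW] := YE t It; have uG := gram_unit (iT t It).
  rewrite EW -mulmxA (mulmxA (L t)) -/(T t) !mulmxA; congr (_ *m W).
  by rewrite -mulmxA -/(T t) /Y' (gram_pinv _ (iT t It)) trmx_mul trmxK.
have cKi := mxCnV niI uK cK.
have cC' : mxCn I 1 C' by exact: mxCnM.
exists Y', C'; split=> //.
- move=> t It; have [E'E _] := H t It; split.
    apply: injmxM; last by apply: gram_inj; case: (HY t It).
    apply: injmxM; first exact: iT.
    by apply: unit_injmx; rewrite unitmx_inv; exact/gram_unit/iT.
  have [iY _] := HY t It.
  move=> x; split=> -[u ->].
    have [W EW] := YE t It.
    have Y'X (X : 'cV[R]_r) :
        Y' t *m (invmx ((Y t)^T *m Y t) *m (((T t)^T *m T t) *m X)) = T t *m X.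
      have := gram_unit iY; have := gram_unit (iT t It); rewrite /Y'.
      move: (T t) ((T t)^T *m T t) ((Y t)^T *m Y t) => T0 G YY uG uYY.
      by rewrite -!mulmxA (mulKVmx uYY) (mulKmx uG).
    exists (invmx ((Y t)^T *m Y t) *m (((T t)^T *m T t) *m (W *m (K t *m u)))).
    by rewrite Y'X E'E EW /T !mulmxA.
  have [W EW] := EY t It.
  exists (invmx (K t) *m (W *m (invmx ((T t)^T *m T t) *m ((Y t)^T *m Y t) *m u))).
  by rewrite E'E -!mulmxA mulKVmx ?uK // (mulmxA (E t)) -EW /Y' /T !mulmxA.
- move=> t It; have [-> ->] := H t It; have [iC HCt] := HC t It; split.
    by apply: injmxM => //; apply: unit_injmx; rewrite unitmx_inv uK.
  move=> z.
  have sE : Sset (L t *m E t *m K t) (L t *m (F t *m K t + E t *m mxderiv I K t)) z <->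
      Sset (E t) (F t) (K t *m z).
    have uLt := uL t It; have uKt := uK t It.
    rewrite /Sset /=; split=> -[u].
      rewrite -!mulmxA => /(injmx_cancel (unit_injmx uLt)); rewrite mulmxDl -!mulmxA => E0.
      by exists (K t *m u - mxderiv I K t *m z); rewrite mulmxBr -E0 addrK.
    move=> E0; exists (invmx (K t) *m (u + mxderiv I K t *m z)).
    by rewrite -!mulmxA (mulKVmx uKt) mulmxDl -!mulmxA E0 -mulmxDr.
  rewrite sE HCt; split=> -[u].
    by move=> Eu; exists u; rewrite /C' -mulmxA -Eu mulKmx ?uK.
  by move=> ->; exists u; rewrite /C' !mulmxA mulmxV ?mul1mx ?uK.
move=> t It; have [-> ->] := H t It; have [-> ->] := HE t It; have uKt := uK t It; split.
  rewrite -(YLE t It) /C' !mulmxA; congr (_ *m _).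
  by rewrite -!mulmxA mulmxV // mulmx1.
have KC : C t = K t *m C' t by rewrite /C' mulKVmx.
have dC : mxderiv I C t = mxderiv I K t *m C' t + K t *m mxderiv I C' t.
  apply: (mxderivE niI It).
  apply: mx_has_deriv_ext (mx_has_derivM It (mxCn_has_deriv niI It cK) (mxCn_has_deriv niI It cC')) => // s Is.
  by rewrite /C' mulKVmx ?uK.
have [U EU] : exists U, F t *m C t = E t *m U.
  apply: sub_im_mx => z; have [_ HCt] := HC t It.
  have /HCt [u] : exists u, C t *m z = C t *m u by exists z.
  by move=> Eu; exists u; rewrite -mulmxA.
rewrite EU -mulmxDr mulmxA -(YLE t It) -!mulmxA -mulmxDr; congr (_ *m (_ *m _)).
by rewrite mulmxDr -EU dC {1}KC mulmxDr mulmxDl !mulmxA addrA.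
Qed.

(** Two choices of bases differ by invertible factors. The factor for [C] is a left inverse times a
    basis, hence [C^1]; the factor for [Y] is never differentiated. *)
Lemma step_uniq m r (E F : R -> 'M[R]_m) (E1 F1 E2 F2 : R -> 'M[R]_r) :
  red_step I E F E1 F1 -> red_step I E F E2 F2 -> eqv I E1 F1 E2 F2.
Proof.
move=> [Y1 [C1 [HY1 HC1 cC1 H1]]] [Y2 [C2 [HY2 HC2 cC2 H2]]].
pose K t := linv (C1 t) *m C2 t.
pose G t := linv (Y1 t) *m Y2 t.
have basis_chg k (M N : 'M[R]_(m, k)) V : mx_basis M V -> mx_basis N V ->
    N = M *m (linv M *m N) /\ linv M *m N \in unitmx.
  move=> bM bN; have E0 : N = M *m (linv M *m N).
    apply/matrixP => i j; have [_ HN] := bN.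
    have /(mx_basis_linv bM) : V (col j N) by apply/HN; exists (delta_mx j ord0); rewrite colE.
    by rewrite -!col_mulmx => /matrixP/(_ i ord0); rewrite !mxE.
  split=> //; apply: injmx_unit => z Gz; have [iN _] := bN.
  by apply: iN; rewrite E0 -mulmxA Gz mulmx0.
have cK : mxCn I 1 K.
  by apply: mxCnM => //; apply: mxCn_linv => // t It; case: (HC1 t It).
exists (fun t => (G t)^T), K; split=> //.
- by move=> t It; rewrite unitmx_tr; case: (basis_chg _ _ _ _ (HY1 t It) (HY2 t It)).
- by move=> t It; case: (basis_chg _ _ _ _ (HC1 t It) (HC2 t It)).
move=> t It; have [-> ->] := H1 t It; have [-> ->] := H2 t It.
have [EY _] := basis_chg _ _ _ _ (HY1 t It) (HY2 t It); rewrite -/(G t) in EY.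
have [EC _] := basis_chg _ _ _ _ (HC1 t It) (HC2 t It); rewrite -/(K t) in EC.
have dC : mxderiv I C2 t = mxderiv I C1 t *m K t + C1 t *m mxderiv I K t.
  apply: (mxderivE niI It).
  apply: mx_has_deriv_ext (mx_has_derivM It (mxCn_has_deriv niI It cC1) (mxCn_has_deriv niI It cK)) => // s Is.
  by have [] := basis_chg _ _ _ _ (HC1 s Is) (HC2 s Is).
rewrite EY EC dC trmx_mul !mulmxA; split=> //.
by rewrite -!mulmxA -!mulmxDr; congr (_ *m (_ *m _)); rewrite mulmxDl mulmxDr !mulmxA addrA.
Qed.

(** [C] maps the kernel of [Y^T E C] isomorphically onto the intersection of [ker E] and [S]. *)
Lemma rank_red m r theta (E F : R -> 'M[R]_m) (E1 F1 : R -> 'M[R]_r) t : I t ->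
  prereg_at (E t) (F t) r theta -> red_step I E F E1 F1 ->
  \rank (E1 t) = (r - theta)%N /\ (theta <= r)%N.
Proof.
move=> It [_ rE [V bV]] [Y [C [HY HC _ H]]]; have [-> _] := H t It.
have [iY /= HYt] := HY t It; have [iC HCt] := HC t It; have [iV /= HV] := bV.
have YE (z : 'cV[R]_m) : (Y t)^T *m (E t *m z) = 0 -> E t *m z = 0.
  have [u ->] := (HYt (E t *m z)).1 (ex_intro _ z erefl).
  by rewrite mulmxA => /(gram_inj iY) ->; rewrite mulmx0.
have VS (u : 'cV[R]_theta) : Sset (E t) (F t) (V *m u).
  by have [] := (HV (V *m u)).2 (ex_intro _ u erefl).
have VC : V = C t *m (linv (C t) *m V).
  apply/matrixP => i j; have := VS (delta_mx j ord0).
  move/(mx_basis_linv (HC t It)); rewrite !mulmxA -!colE.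
  by move=> /matrixP/(_ i ord0); rewrite !mxE.
have bK : mx_basis (linv (C t) *m V) [set` kerc ((Y t)^T *m E t *m C t)].
  split=> [z Hz|x]; first by apply: iV; rewrite VC -mulmxA Hz mulmx0.
  split=> [/kercP|[u ->]].
    rewrite -!mulmxA => /YE ECx.
    have [|u Eu] := (HV (C t *m x)).1.
      by split=> //; apply/HCt; exists x.
    by exists u; rewrite -mulmxA -Eu mulmxA linvK // mul1mx.
  apply/kercP; rewrite -!mulmxA (mulmxA (linv (C t))) (mulmxA (C t)) -VC.
  have [-> _] := (HV (V *m u)).2 (ex_intro _ u erefl).
  by rewrite mulmx0.
have := mx_basis_dim bK; rewrite dim_kerc => E0.
have le := rank_leq_col ((Y t)^T *m E t *m C t).
by rewrite -E0 leq_subr subKn.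
Qed.

(* [Reg n] is regularity with index [n.+1]. *)
Fixpoint Reg n m (E F : R -> 'M[R]_m) r (theta : nat -> nat) : Prop :=
  (forall t, I t -> prereg_at (E t) (F t) r (theta 0%N)) /\
  match n with
  | 0 => theta 0%N = 0%N /\ (r = 0%N \/ exists E1 F1 : R -> 'M[R]_r, red_step I E F E1 F1)
  | n'.+1 => exists r1 (E1 F1 : R -> 'M[R]_r),
      [/\ red_step I E F E1 F1, (r1 < r)%N & Reg n' E1 F1 r1 (fun i => theta i.+1)]
  end.

Lemma Reg_prereg n m (E F : R -> 'M[R]_m) r theta : Reg n E F r theta ->
  forall t, I t -> prereg_at (E t) (F t) r (theta 0%N).
Proof. by case: n => [|n] []. Qed.

Lemma Reg_eqv n m (E F E' F' : R -> 'M[R]_m) r theta :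
  eqv I E F E' F' -> Reg n E F r theta -> Reg n E' F' r theta.
Proof.
move=> e; have [L [K [uL uK _ H]]] := e.
have P : (forall t, I t -> prereg_at (E t) (F t) r (theta 0%N)) ->
    (forall t, I t -> prereg_at (E' t) (F' t) r (theta 0%N)).
  move=> h t It; have [-> ->] := H t It.
  by apply: prereg_eqv; [exact: uL|exact: uK|exact: h].
case: n => [|n] [/P h0 h]; split=> //.
  case: h => ? [?|[E1 [F1 s]]]; split=> //; [by left|right].
  by exists E1, F1; exact: step_eqv s.
have [r1 [E1 [F1 [s rr h1]]]] := h.
by exists r1, E1, F1; split=> //; exact: step_eqv s.
Qed.

(** Uniqueness up to equivalence lets an arbitrary step replace the one recorded in [Reg]; the rank
    formula then forces the next rank to be [r - theta 0]. *)
Lemma Reg_step n m (E F : R -> 'M[R]_m) r theta (E1 F1 : R -> 'M[R]_r) : (exists t, I t) ->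
  Reg n.+1 E F r theta -> red_step I E F E1 F1 ->
  [/\ (0 < theta 0%N)%N, (theta 0%N <= r)%N & Reg n E1 F1 (r - theta 0%N) (fun i => theta i.+1)].
Proof.
move=> [t It] [P [r1 [E2 [F2 [s rr h1]]]]] s'.
have h2 := Reg_eqv (step_uniq s s') h1.
have [rk le] := rank_red It (P t It) s.
have [_ rk1 _] := Reg_prereg h1 It.
have Er : r1 = (r - theta 0%N)%N by rewrite -rk1 rk.
by split=> //; [move: rr; rewrite Er; lia|rewrite -Er].
Qed.

Lemma regular_Reg m (E F : R -> 'M[R]_m) mu r theta : (exists t, I t) ->
  regular I E F mu r theta -> [/\ (0 < mu)%N, (r < m)%N & Reg mu.-1 E F r theta].
Proof.
move=> [t0 It0] [rs [Es [Fs [[E0 F0 r0] [mu0 rm] H1 H2 H3]]]]; split=> //.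
have PR i : (i < mu)%N -> forall t, I t -> prereg_at (Es i t) (Fs i t) (rs i) (theta i).
  by move=> imu; apply/prereg_atP; exact: H2.
have ST i : (i < mu)%N -> reduction_step I (r := rs i) (Es i) (Fs i) (Es i.+1) (Fs i.+1) ->
    red_step I (r := rs i) (Es i) (Fs i) (Es i.+1) (Fs i.+1).
  move=> imu; apply (proj1 (@red_stepP _ _ _ _ (Es i) (Fs i) (Es i.+1) (Fs i.+1) (fun t It => let: And3 _ h _ := PR i imu t It in h))).
suff W j : forall i, (i + j)%N = mu.-1 -> Reg j (Es i) (Fs i) (rs i) (fun k => theta (i + k)%N).
  have := W mu.-1 0%N erefl; rewrite E0 F0 r0; congr Reg.
elim: j => [|j IH] i ij /=.
  have imu : (i < mu)%N by lia.
  split; first by rewrite addn0; exact: PR.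
  rewrite addn0 in ij; subst i; rewrite addn0.
  have P0 := PR _ imu t0 It0.
  (* Both endings force the last [theta] to vanish. If the rank is 0, then [E = 0], so [F] is onto
     and [S = ker F = 0]; if the next [E] is nonsingular, its rank [r - theta] equals [r]. *)
  case: H3 => [[r_gt0 [s u]]|rs0]; last first.
    split; last by left.
    have [sur rk [V [iV HV]]] := P0.
    have Ez : Es mu.-1 t0 = 0 by apply/eqP; rewrite -mxrank_eq0 rk rs0.
    have /injmxP rV := iV; rewrite -rV; apply/eqP; rewrite mxrank_eq0; apply/eqP.
    have iF : injmx (Fs mu.-1 t0).
      have [U EU] : exists U, 1%:M = Fs mu.-1 t0 *m U.
        apply: sub_im_mx => z; have [u [v]] := sur (1%:M *m z).
        by rewrite Ez mul0mx add0r => ->; exists v.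
      by apply: unit_injmx; case: (mulmx1_unit (esym EU)).
    apply: (injmx_mx iF); apply/matrixP => a b; rewrite mxE.
    have [_ [u]] := (HV (V *m delta_mx b ord0)).2 (ex_intro _ _ erefl).
    by rewrite Ez mul0mx mulmxA -colE => /matrixP/(_ a ord0); rewrite !mxE.
  have s' := ST _ imu s; split; last by right; exists (Es mu.-1.+1), (Fs mu.-1.+1).
  have [rk le] := rank_red It0 P0 s'.
  have := mxrank_unit (u t0 It0); rewrite rk /= => E1.
  by apply/eqP; rewrite -(eqn_add2l (rs mu.-1 - theta mu.-1)) subnK // addn0 E1.
have imu : (i.+1 < mu)%N by lia.
have [s rr] := H1 i imu; split; first by rewrite addn0; exact: PR (ltnW imu).
exists (rs i.+1), (Es i.+1), (Fs i.+1); split=> //; first exact: ST (ltnW imu) s.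
have := IH i.+1; rewrite addSnnS => /(_ ij).
by congr Reg; apply/funext => k; rewrite addSnnS.
Qed.

Lemma Reg_regular m n (E F : R -> 'M[R]_m) r theta : (exists t, I t) -> (r < m)%N ->
  Reg n E F r theta -> regular I E F n.+1 r theta.
Proof.
move=> [t0 It0].
elim: n m E F r theta => [|n IH] m E F r theta rm.
  move=> [P [th0 h]].
  (* For [r = 0] no further step is made, and zero matrices pad the sequence. *)
  have [E1 [F1 H1]] : exists E1 F1 : R -> 'M[R]_r, (0 < r)%N -> red_step I E F E1 F1.
    case: h => [->|[E1 [F1 s]]]; last by exists E1, F1.
    by exists (fun=> 0), (fun=> 0).
  exists (fun=> r), (fun i => match i return R -> 'M[R]_(red_size m (fun=> r) i) with 0%N => E | i.+1 => E1 end),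
    (fun i => match i return R -> 'M[R]_(red_size m (fun=> r) i) with 0%N => F | i.+1 => F1 end).
  split=> //; first by case=> // _; exact/prereg_atP.
  have [r0|r0] := posnP r; [by right|left]; split=> //; have s := H1 r0; split.
    by apply/red_stepP => // t It; case: (P t It).
  move=> t It /=; rewrite -row_free_unit /row_free.
  by have [-> _] := rank_red It (P t It) s; rewrite th0 subn0.
move=> [P [r1 [E1 [F1 [s rr h]]]]].
have [rs [Es [Fs [[E0 F0 r0] _ H1 H2 H3]]]] := IH _ _ _ _ _ rr h.
(* The chain of the reduced pair is shifted by one. Index 1 gets its own case only to make
   [red_size] compute. *)
pose rs' i := if i is i'.+1 then rs i' else r.
pose Es' i : R -> 'M[R]_(red_size m rs' i) := match i with
  | 0 => E | 1 => Es 0%N | i'.+2 => Es i'.+1 end.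
pose Fs' i : R -> 'M[R]_(red_size m rs' i) := match i with
  | 0 => F | 1 => Fs 0%N | i'.+2 => Fs i'.+1 end.
have s' : reduction_step I (r := r) E F (Es 0%N) (Fs 0%N).
  apply/red_stepP; first by move=> t It; case: (P t It).
  by rewrite E0 F0.
exists rs', Es', Fs'; split=> //.
- by case=> [_|[|i]]; [split; [exact: s'|rewrite /= r0]|exact: (H1 0%N)|exact: (H1 i.+1)].
- case=> [_|[|i]]; [exact/prereg_atP|exact: (H2 0%N)|exact: (H2 i.+1)].
- by case: n {IH h} H1 H2 H3 => [|n] H1 H2 H3; exact: H3.
Qed.

End Regularity2.

(** * A normal form and the regularity of the adjoint pair *)

Section NormalForm.
Context {R : realType}.
Implicit Types (p q n k d m r s : nat).
Variable I : set R.
Hypothesis nI : nondeg_itv I.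
Let niI : no_isolated I := nondeg_no_isolated nI.

(** Unlike in [eqv], both factors are smooth: the adjoint exchanges their roles, and [L^T] is then
    differentiated. *)
Definition seqv k m (E F E' F' : R -> 'M[R]_m) :=
  exists L K : R -> 'M[R]_m,
    [/\ smooth_unit I k L, smooth_unit I k K
      & forall t, I t -> E' t = L t *m E t *m K t /\
          F' t = L t *m (F t *m K t + E t *m mxderiv I K t)].

Lemma seqv_eqv k m (E F E' F' : R -> 'M[R]_m) : seqv k.+1 E F E' F' -> eqv I E F E' F'.
Proof.
by move=> [L [K [[_ uL] [cK uK] H]]]; exists L, K; split=> //; exact: mxCn_le cK.
Qed.

Lemma seqv_trans k m (E F E1 F1 E2 F2 : R -> 'M[R]_m) :
  seqv k.+1 E F E1 F1 -> seqv k.+1 E1 F1 E2 F2 -> seqv k.+1 E F E2 F2.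
Proof.
move=> [L1 [K1 [[cL1 uL1] [cK1 uK1] H1]]] [L2 [K2 [[cL2 uL2] [cK2 uK2] H2]]].
exists (fun t => L2 t *m L1 t), (fun t => K1 t *m K2 t); split.
- by split; [exact: mxCnM|move=> t It; rewrite unitmx_mul uL1 ?uL2].
- by split; [exact: mxCnM|move=> t It; rewrite unitmx_mul uK1 ?uK2].
move=> t It; have [-> ->] := H2 t It; have [-> ->] := H1 t It.
rewrite (mxderivE niI It (mx_has_derivM It (mxCn_has_deriv niI It cK1) (mxCn_has_deriv niI It cK2))).
by rewrite !mulmxDr !mulmxDl !mulmxDr !mulmxA addrA.
Qed.

Lemma mxderiv_cst p q (M : 'M[R]_(p, q)) t : I t -> mxderiv I (fun=> M) t = 0.
Proof. by move=> It; apply: (mxderivE niI It); exact: mx_has_deriv_cst. Qed.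

Lemma unit_block_diag p q (A : 'M[R]_p) (B : 'M[R]_q) : A \in unitmx -> B \in unitmx ->
  block_mx A 0 0 B \in unitmx.
Proof. by rewrite !unitmxE det_ublock unitrM => -> ->. Qed.

Lemma unit_block_upper p q (A : 'M[R]_(p, q)) : block_mx 1%:M A 0 1%:M \in unitmx.
Proof. by rewrite unitmxE det_ublock !det1 mulr1 unitr1. Qed.

Lemma unit_block_lower p q (A : 'M[R]_(q, p)) : block_mx 1%:M 0 A 1%:M \in unitmx.
Proof. by rewrite unitmxE det_lblock !det1 mulr1 unitr1. Qed.

Lemma mulmx_cols_eq0 p q n (M : 'M[R]_(p, q)) (V : 'M[R]_(q, n)) :
  (forall u : 'cV[R]_n, M *m (V *m u) = 0) -> M *m V = 0.
Proof.
move=> H; apply/matrixP => i j; have := H (delta_mx j ord0).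
by rewrite mulmxA -colE => /matrixP/(_ i ord0); rewrite !mxE.
Qed.

Lemma prereg_size m (E F : 'M[R]_m) r th : prereg_at E F r th -> exists s, m = (r + (s + th))%N.
Proof.
move=> [_ rE [V [/injmxP iV HV]]].
have EV : E *m V = 0.
  by apply: mulmx_cols_eq0 => u; have [] := (HV (V *m u)).2 (ex_intro _ _ erefl).
have := mulmx0_rank_max EV; rewrite rE iV => le.
by exists (m - r - th)%N; lia.
Qed.

Definition nfE r n : 'M[R]_(r + n) := block_mx 1%:M 0 0 0.

(** The [s] middle components of a solution vanish, [F21] constrains the first [r], and the last
    [th] coordinates parametrise the intersection of [ker E] and [S]. *)
Definition nfF r s th (F11 : 'M[R]_r) (F12 : 'M[R]_(r, th)) (F21 : 'M[R]_(th, r)) :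
    'M[R]_(r + (s + th)) :=
  block_mx F11 (row_mx 0 F12) (col_mx 0 F21) (block_mx 1%:M 0 0 0).

Definition mulsimp := (mul1mx, mulmx1, mul0mx, mulmx0, addr0, add0r).

(** For [E = diag(1, 0)] the intersection of [ker E] and [S] is a copy of the kernel of the lower
    right block. That block thus has constant rank [s] and can be normalised itself. *)
Lemma nf_stage2 k r s th (F : R -> 'M[R]_(r + (s + th))) :
  mxCn I k.+1 F -> (forall t, I t -> prereg_at (nfE r (s + th)) (F t) r th) ->
  exists F11 Fa Fb, [/\ mxCn I k.+1 F11, mxCn I k.+1 Fa, mxCn I k.+1 Fb &
    seqv k.+1 (fun=> nfE r (s + th)) F (fun=> nfE r (s + th))
      (fun t => block_mx (F11 t) (Fa t) (Fb t) (block_mx 1%:M 0 0 0))].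
Proof.
move=> cF HP.
pose F11 t := ulsubmx (F t); pose Fa t := ursubmx (F t).
pose Fb t := dlsubmx (F t); pose F22 t := drsubmx (F t).
have FE t : F t = block_mx (F11 t) (Fa t) (Fb t) (F22 t) by rewrite submxK.
have c11 : mxCn I k.+1 F11 by apply: mxCn_lsub; exact: mxCn_usub.
have ca : mxCn I k.+1 Fa by apply: mxCn_rsub; exact: mxCn_usub.
have cb : mxCn I k.+1 Fb by apply: mxCn_lsub; exact: mxCn_dsub.
have c22 : mxCn I k.+1 F22 by apply: mxCn_rsub; exact: mxCn_dsub.
have r22 t : I t -> \rank (F22 t) = s.
  move=> It; have [_ _ [V [iV /= HV]]] := HP t It.
  have HV2 (z : 'cV[R]_(s + th)) : F22 t *m z = 0 <-> exists u, col_mx 0 z = V *m u.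
    rewrite -HV /nfE mul_block_col !mulsimp col_mx0; split=> [Fz|[_ [u]]].
      split=> //; exists (col_mx (Fa t *m z) 0).
      by rewrite FE !mul_block_col !mulsimp Fz.
    rewrite FE -[u]vsubmxK !mul_block_col !mulsimp.
    by case/eq_col_mx.
  have usV : usubmx V = 0.
    have : nfE r (s + th) *m V = 0.
      by apply: mulmx_cols_eq0 => u; have [] := (HV (V *m u)).2 (ex_intro _ _ erefl).
    rewrite -{1}[V]vsubmxK /nfE mul_block_col !mulsimp -(@col_mx0 _ r (s + th) th).
    by case/eq_col_mx.
  have VE : V = col_mx 0 (dsubmx V) by rewrite -usV vsubmxK.
  have bK : mx_basis (dsubmx V) [set` kerc (F22 t)].
    split=> [z Vz|x].
      by apply: iV; rewrite VE mul_col_mx Vz mul0mx col_mx0.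
    split=> [/kercP/HV2 [u]|[u ->]].
      by rewrite {1}VE mul_col_mx => /eq_col_mx [_ ->]; exists u.
    by apply/kercP/HV2; exists u; rewrite [in RHS]VE mul_col_mx mul0mx.
  have := mx_basis_dim bK; rewrite dim_kerc.
  by have := rank_leq_col (F22 t); lia.
have [L2 [K2 [[cL uL] [cK uK] HLK]]] := smooth_rank_normal_form nI c22 r22.
exists F11, (fun t => Fa t *m K2 t), (fun t => L2 t *m Fb t); split=> //.
- exact: mxCnM.
- exact: mxCnM.
exists (fun t => block_mx 1%:M 0 0 (L2 t)), (fun t => block_mx 1%:M 0 0 (K2 t)); split.
- split; last by move=> t It; apply: unit_block_diag; [exact: unitmx1|exact: uL].
  by apply: mxCn_block => //; exact: mxCn_cst.
- split; last by move=> t It; apply: unit_block_diag; [exact: unitmx1|exact: uK].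
  by apply: mxCn_block => //; exact: mxCn_cst.
move=> t It; rewrite /nfE !mulmx_block !mulsimp; split=> //.
have -> : mxderiv I (fun t => block_mx (1%:M : 'M[R]_r) 0 0 (K2 t)) t = block_mx 0 0 0 (mxderiv I K2 t).
  apply: (mxderivE niI It); apply: mx_has_deriv_block => //; try exact: mx_has_deriv_cst.
  exact: mxCn_has_deriv cK.
by rewrite FE !mulmx_block !mulsimp block_mx0 addr0 mulmx_block !mulsimp !mulmxA HLK.
Qed.

(** The identity pivot clears the neighbouring blocks and leaves a Schur complement in the corner.
    [E K'] vanishes, because [K'] lives in the lower left block. *)
Lemma nf_stage3 k r s th (F11 : R -> 'M[R]_r) (Fa : R -> 'M[R]_(r, s + th)) Fb :
  mxCn I k.+1 F11 -> mxCn I k.+1 Fa -> mxCn I k.+1 Fb ->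
  exists G F12 F21, [/\ mxCn I k.+1 G, mxCn I k.+1 F12, mxCn I k.+1 F21 &
    seqv k.+1 (fun=> nfE r (s + th))
       (fun t => block_mx (F11 t) (Fa t) (Fb t) (block_mx 1%:M 0 0 0))
       (fun=> nfE r (s + th)) (fun t => nfF s (G t) (F12 t) (F21 t))].
Proof.
move=> c11 ca cb.
pose Fa1 t := lsubmx (Fa t); pose Fa2 t := rsubmx (Fa t).
pose Fb1 t := usubmx (Fb t); pose Fb2 t := dsubmx (Fb t).
have Ea t : Fa t = row_mx (Fa1 t) (Fa2 t) by rewrite hsubmxK.
have Eb t : Fb t = col_mx (Fb1 t) (Fb2 t) by rewrite vsubmxK.
have ca1 : mxCn I k.+1 Fa1 by exact: mxCn_lsub.
have ca2 : mxCn I k.+1 Fa2 by exact: mxCn_rsub.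
have cb1 : mxCn I k.+1 Fb1 by exact: mxCn_usub.
have cb2 : mxCn I k.+1 Fb2 by exact: mxCn_dsub.
exists (fun t => F11 t - Fa1 t *m Fb1 t), Fa2, Fb2; split=> //.
  by apply: mxCnB => //; exact: mxCnM.
pose A t := - row_mx (Fa1 t) (0 : 'M[R]_(r, th)).
pose B t := - col_mx (Fb1 t) (0 : 'M[R]_(th, r)).
have cA : mxCn I k.+1 A by apply: mxCnN => //; apply: mxCn_row => //; exact: mxCn_cst.
have cB : mxCn I k.+1 B by apply: mxCnN => //; apply: mxCn_col => //; exact: mxCn_cst.
exists (fun t => block_mx 1%:M (A t) 0 1%:M), (fun t => block_mx 1%:M 0 (B t) 1%:M); split.
- split; last by move=> t It; exact: unit_block_upper.
  by apply: mxCn_block => //; exact: mxCn_cst.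
- split; last by move=> t It; exact: unit_block_lower.
  by apply: mxCn_block => //; exact: mxCn_cst.
move=> t It; rewrite /nfE !mulmx_block !mulsimp; split=> //.
have -> : mxderiv I (fun t => block_mx (1%:M : 'M[R]_r) 0 (B t) 1%:M) t = block_mx 0 0 (mxderiv I B t) 0.
  apply: (mxderivE niI It); apply: mx_has_deriv_block => //; try exact: mx_has_deriv_cst.
  exact: mxCn_has_deriv cB.
rewrite mulmx_block !mulsimp block_mx0 addr0 mulmx_block !mulsimp /nfF /A /B Ea Eb.
rewrite !mulNmx !mulmxN !(mul_row_col, mul_row_block, mul_block_col) !mulsimp.
have -> : col_mx (Fb1 t) (Fb2 t) - col_mx (Fb1 t) 0 = col_mx 0 (Fb2 t).
  by rewrite opp_col_mx add_col_mx subrr oppr0 addr0.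
have -> : row_mx (Fa1 t) (Fa2 t) - Fa1 t *m row_mx 1%:M 0 = row_mx 0 (Fa2 t).
  by rewrite mul_mx_row !mulsimp opp_row_mx add_row_mx subrr oppr0 addr0.
by rewrite mul_row_col !mulsimp subr0.
Qed.

(** One derivative is lost, since the transformed [F] contains [K'] from the normalisation of
    [E]. *)
Lemma normal_form k r s th (E F : R -> 'M[R]_(r + (s + th))) :
  mxCn I k.+2 E -> mxCn I k.+2 F -> (forall t, I t -> prereg_at (E t) (F t) r th) ->
  exists F11 F12 F21, [/\ mxCn I k.+1 F11, mxCn I k.+1 F12, mxCn I k.+1 F21 &
    seqv k.+1 E F (fun=> nfE r (s + th)) (fun t => nfF s (F11 t) (F12 t) (F21 t))].
Proof.
move=> cE cF HP.
have rE t : I t -> \rank (E t) = r by move=> It; case: (HP t It).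
have [L [K [[cL uL] [cK uK] HLK]]] := smooth_rank_normal_form nI cE rE.
pose F1 t := L t *m (F t *m K t + E t *m mxderiv I K t).
have cK' : mxCn I k.+1 (mxderiv I K) by exact: mxCn_deriv.
have cL1 : mxCn I k.+1 L by exact: mxCn_le cL.
have cK1 : mxCn I k.+1 K by exact: mxCn_le cK.
have cF1 : mxCn I k.+1 F1.
  apply: mxCnM => //; apply: mxCnD => //; apply: mxCnM => //.
    exact: mxCn_le cF.
  exact: mxCn_le cE.
have e1 : seqv k.+1 E F (fun=> nfE r (s + th)) F1.
  by exists L, K; split=> // t It; rewrite HLK.
have HP1 t : I t -> prereg_at (nfE r (s + th)) (F1 t) r th.
  move=> It; rewrite /nfE -(HLK t It); apply: prereg_eqv; [exact: uL|exact: uK|exact: HP].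
have [F11 [Fa [Fb [c11 ca cb e2]]]] := nf_stage2 cF1 HP1.
have [G [F12 [F21 [cG c12 c21 e3]]]] := nf_stage3 c11 ca cb.
by exists G, F12, F21; split=> //; apply: seqv_trans e3; exact: seqv_trans e2.
Qed.

End NormalForm.

(** * Regularity of the adjoint pair *)

Section AdjointRegularity.
Context {R : realType}.
Implicit Types (p q n k d m r s : nat).
Variable I : set R.
Hypothesis nI : nondeg_itv I.
Let niI : no_isolated I := nondeg_no_isolated nI.

Definition blkE := (mul_block_col, mul_row_col, mul_col_mx, add_col_mx, mulsimp).

Lemma trmxD p q (A B : 'M[R]_(p, q)) : (A + B)^T = A^T + B^T.
Proof. by rewrite linearD. Qed.

Lemma trmxN p q (A : 'M[R]_(p, q)) : (- A)^T = - A^T.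
Proof. by rewrite linearN. Qed.

Lemma rank_surj p q (M : 'M[R]_(p, q)) : \rank M = p <-> forall w : 'cV[R]_p, exists v, w = M *m v.
Proof.
split=> [rM w|H].
  have /row_freeP [B HB] : row_free M by rewrite /row_free rM.
  by exists (B *m w); rewrite mulmxA HB mul1mx.
have [U EU] : exists U, 1%:M = M *m U.
  by apply: sub_im_mx => z; have [v] := H (1%:M *m z); exists v.
apply/eqP/row_freeP; by exists U.
Qed.

Lemma ker_perp p q k (M : 'M[R]_(p, q)) (b : 'M[R]_(q, k)) (x : 'cV[R]_q) :
  mx_basis b [set z | M *m z = 0] -> b^T *m x = 0 -> exists u, x = M^T *m u.
Proof.
move=> [ib /= Hb] bx.
have Mb : M *m b = 0.
  by apply: mulmx_cols_eq0 => u; exact: (Hb (b *m u)).2 (ex_intro _ u erefl).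
have [P [PT MP [N EN]]] := rowproj_exists M.
have PE : P = M^T *m N^T by rewrite -PT EN trmx_mul.
have [v Ev] : exists v, x - P *m x = b *m v.
  by apply/Hb; rewrite mulmxBr mulmxA MP subrr.
have : x - P *m x = 0.
  apply: mulmx_tr_eq0; rewrite {1}Ev trmx_mul -mulmxA mulmxBr bx PE !mulmxA -trmx_mul Mb.
  by rewrite trmx0 !mul0mx subrr mulmx0.
by move/eqP; rewrite subr_eq0 => /eqP ->; exists (N^T *m x); rewrite PE mulmxA.
Qed.

(** The range of [E] covers the first block row and the identity block the second, so only [F21] has
    to be onto. [F11] and [F12] are unrestricted. *)
Lemma nf_prereg r s th (F11 : 'M[R]_r) (F12 : 'M[R]_(r, th)) (F21 : 'M[R]_(th, r)) :
  \rank F21 = th -> prereg_at (nfE r (s + th)) (nfF s F11 F12 F21) r th.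
Proof.
move=> /rank_surj sF; rewrite /nfE /nfF; split.
- move=> w; have [v1 Ev1] := sF (dsubmx (dsubmx w)).
  exists (col_mx (usubmx w - F11 *m v1) 0), (col_mx v1 (col_mx (usubmx (dsubmx w)) 0)).
  by rewrite !blkE subrK -Ev1 !vsubmxK.
- by rewrite rank_diag_block_mx mxrank1 mxrank0 addn0.
exists (col_mx 0 (col_mx 0 1%:M)); split.
  by move=> z; rewrite !blkE => /(congr1 (@dsubmx _ _ _ _)); rewrite col_mxKd
    => /(congr1 (@dsubmx _ _ _ _)); rewrite col_mxKd !linear0.
move=> z /=; rewrite -[z]vsubmxK -[dsubmx z]vsubmxK; set z1 := usubmx z.
set z2 := usubmx _; set z3 := dsubmx (dsubmx z).
rewrite /Sset /= !blkE -(@col_mx0 _ r (s + th) 1); split=> [[/eq_col_mx [-> _] [u]]|[u]].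
  rewrite -[u]vsubmxK !blkE => /eq_col_mx [_].
  rewrite -(@col_mx0 _ s th 1) => /eq_col_mx [-> _].
  by exists z3; rewrite !blkE.
rewrite !blkE => /eq_col_mx [-> /eq_col_mx [-> ->]]; split=> //.
exists (col_mx (F12 *m u) 0).
by rewrite !blkE col_mx0.
Qed.

Lemma nf_prereg_rank r s th th' (F11 : 'M[R]_r) (F12 : 'M[R]_(r, th)) (F21 : 'M[R]_(th, r)) :
  prereg_at (nfE r (s + th)) (nfF s F11 F12 F21) r th' -> \rank F21 = th.
Proof.
move=> [sur _ _]; apply/rank_surj => w; have [u [v]] := sur (col_mx 0 (col_mx 0 w)).
rewrite /nfE /nfF -[u]vsubmxK -[v]vsubmxK -[dsubmx v]vsubmxK !blkE.
by move=> /eq_col_mx [_ /eq_col_mx [_ ->]]; exists (usubmx v).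
Qed.

(** Here [S] consists of the vectors [(c v, 0, w)] with [v] and [w] free. *)
Lemma nf_step d s th (F11 : R -> 'M[R]_(d + th)) (F12 : R -> 'M[R]_(d + th, th))
    (F21 : R -> 'M[R]_(th, d + th)) (c : R -> 'M[R]_(d + th, d)) :
  mxCn I 1 c -> (forall t, I t -> mx_basis (c t) [set z | F21 t *m z = 0]) ->
  red_step I (fun=> nfE (d + th) (s + th)) (fun t => nfF s (F11 t) (F12 t) (F21 t))
    (fun t => row_mx (c t) 0) (fun t => row_mx (F11 t *m c t + mxderiv I c t) (F12 t)).
Proof.
move=> cc Hc; pose r := (d + th)%N.
pose B : 'M[R]_(s + th, th) := col_mx 0 1%:M.
exists (fun=> col_mx 1%:M 0), (fun t => block_mx (c t) 0 0 B); split.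
- move=> t It; split=> [z|x].
    by rewrite !blkE => /(congr1 (@usubmx _ _ _ _)); rewrite col_mxKu linear0.
  split=> [[u ->]|[u ->]].
    exists (usubmx u); rewrite /nfE -{1}[u]vsubmxK !blkE //.
  by exists (col_mx u 0); rewrite /nfE !blkE.
- move=> t It; have [ic /= Hct] := Hc t It; split=> [z|x].
    rewrite -[z]vsubmxK !blkE -(@col_mx0 _ (d + th) (s + th) 1).
    move=> /eq_col_mx [/ic ->]; rewrite /B ?blkE -(@col_mx0 _ s th 1).
    by move=> /eq_col_mx [_ ->]; rewrite col_mx0.
  rewrite -[x]vsubmxK -[dsubmx x]vsubmxK; set z1 := usubmx x.
  set z2 := usubmx _; set z3 := dsubmx (dsubmx x).
  rewrite /Sset /nfE /nfF /= !blkE; split=> -[u].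
    rewrite -[u]vsubmxK !blkE => /eq_col_mx [_].
    rewrite -(@col_mx0 _ s th 1) => /eq_col_mx [-> /Hct [v ->]].
    by exists (col_mx v z3); rewrite /B !blkE.
  rewrite -[u]vsubmxK /B !blkE.
  move=> /eq_col_mx [-> /eq_col_mx [-> ->]].
  have -> : F21 t *m (c t *m usubmx u) = 0 by apply/Hct; exists (usubmx u).
  eexists (col_mx _ 0); rewrite col_mx0 !blkE; reflexivity.
- by apply: mxCn_block => //; exact: mxCn_cst.
move=> t It.
have -> : mxderiv I (fun t => block_mx (c t) 0 0 B) t = block_mx (mxderiv I c t) 0 0 0.
  apply: (mxderivE niI It); apply: mx_has_deriv_block => //; try exact: mx_has_deriv_cst.
  exact: mxCn_has_deriv cc.
rewrite tr_col_mx trmx1 trmx0 /nfE /nfF; split.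
  by rewrite mul_row_block !mulsimp mul_row_block !mulsimp.
rewrite !mulmx_block !mulsimp add_block_mx !mulsimp mul_row_block !mulsimp.
by rewrite mul_row_col !mulsimp.
Qed.

(** Since [G] is onto, the first block row imposes no condition, and [S = ker M]. Both the dual
    reduction of a normal form and the adjoint of its reduction have this shape. *)
Lemma col_step d th (G H : R -> 'M[R]_(d, d + th)) (M : R -> 'M[R]_(th, d + th))
    (c : R -> 'M[R]_(d + th, d)) :
  mxCn I 1 c -> (forall t, I t -> mx_basis (c t) [set z | M t *m z = 0]) ->
  (forall t, I t -> \rank (G t) = d) ->
  red_step I (fun t => col_mx (G t) 0) (fun t => col_mx (H t) (M t))
    (fun t => G t *m c t) (fun t => H t *m c t + G t *m mxderiv I c t).
Proof.
move=> cc Hc rG; exists (fun=> col_mx 1%:M 0), c; split=> //.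
- move=> t It; split=> [z|x].
    by rewrite !blkE => /(congr1 (@usubmx _ _ _ _)); rewrite col_mxKu linear0.
  split=> [[u ->]|[u ->]].
    by exists (G t *m u); rewrite !blkE.
  have [v ->] := (rank_surj (G t)).1 (rG t It) u.
  by exists v; rewrite !blkE.
- move=> t It; have [ic /= Hct] := Hc t It; split=> // x; rewrite -Hct /Sset /=.
  split=> [[u]|Mx]; first by rewrite !blkE => /eq_col_mx [_].
  have [v Ev] := (rank_surj (G t)).1 (rG t It) (H t *m x).
  by exists v; rewrite !blkE Mx Ev.
move=> t It; rewrite tr_col_mx trmx1 trmx0 mul_row_col !mulsimp; split=> //.
by rewrite !mul_col_mx add_col_mx mul_row_col !mulsimp.
Qed.

Lemma col_prereg d th th1 (G H : 'M[R]_(d, d + th)) (M : 'M[R]_(th, d + th)) V :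
  \rank G = d -> \rank M = th ->
  mx_basis (V : 'M[R]_(d + th, th1)) [set z | G *m z = 0 /\ M *m z = 0] ->
  prereg_at (col_mx G 0) (col_mx H M) d th1.
Proof.
move=> rG /rank_surj sM [iV /= HV]; have sG := (rank_surj G).1 rG; split.
- move=> w; have [v Ev] := sM (dsubmx w); have [u Eu] := sG (usubmx w - H *m v).
  exists u, v; by rewrite !blkE -Ev -Eu subrK vsubmxK.
- by rewrite rank_col_mx0.
exists V; split=> // x; rewrite /= -HV /Sset /= !blkE.
rewrite -(@col_mx0 _ d th 1); split=> [[/eq_col_mx [-> _] [u]]|[-> Mx]].
  by rewrite !blkE => /eq_col_mx [_ ->].
split=> //; have [v Ev] := sG (H *m x).
by exists v; rewrite !blkE Mx Ev.
Qed.

Lemma eqv_ext m (E F E' F' : R -> 'M[R]_m) :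
  (forall t, I t -> E' t = E t /\ F' t = F t) -> eqv I E F E' F'.
Proof.
move=> H; exists (fun=> 1%:M), (fun=> 1%:M); split.
- by move=> t _; exact: unitmx1.
- by move=> t _; exact: unitmx1.
- exact: mxCn_cst.
by move=> t It; have [-> ->] := H t It; rewrite mxderiv_cst // !mulsimp.
Qed.

Lemma eqv_opp m (E F : R -> 'M[R]_m) : eqv I E F (fun t => - E t) (fun t => - F t).
Proof.
exists (fun=> - 1%:M), (fun=> 1%:M); split.
- by move=> t _; rewrite -scaleN1r unitmxZ ?unitmx1 // unitrN1.
- by move=> t _; exact: unitmx1.
- exact: mxCn_cst.
by move=> t It; rewrite mxderiv_cst // !mulsimp !mulNmx !mul1mx.
Qed.

Lemma adjFE m (E F : R -> 'M[R]_m) t E' : I t -> mx_has_deriv I E t E' ->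
  adjF I E F t = (F t)^T - E'^T.
Proof.
by move=> It HE; rewrite /adjF (mxderivE niI It (mx_has_derivT It HE)).
Qed.

(** In the adjoint of the transformed pair the terms with [K'] cancel, and the one with [L'] is the
    derivative term of the substitution by [L^T]. *)
Lemma adj_eqv k m (E F E' F' : R -> 'M[R]_m) : mxCn I 1 E -> seqv I k.+1 E F E' F' ->
  eqv I (adjE E) (adjF I E F) (adjE E') (adjF I E' F').
Proof.
move=> cE [L [K [[cL uL] [cK uK] H]]].
exists (fun t => (K t)^T), (fun t => (L t)^T); split.
- by move=> t It; rewrite unitmx_tr uK.
- by move=> t It; rewrite unitmx_tr uL.
- by apply: mxCnT; exact: mxCn_le cL.
move=> t It; have [EE EF] := H t It.
have dK := mxCn_has_deriv niI It cK; have dL := mxCn_has_deriv niI It cL.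
have dE := mxCn_has_deriv niI It cE.
split; first by rewrite /adjE EE !trmx_mul mulmxN mulNmx mulmxA.
have dE' : mx_has_deriv I E' t ((mxderiv I L t *m E t + L t *m mxderiv I E t) *m K t +
    L t *m E t *m mxderiv I K t).
  apply: mx_has_deriv_ext (mx_has_derivM It (mx_has_derivM It dL dE) dK) => // s Is.
  by have [-> _] := H s Is.
rewrite (adjFE _ It dE') (adjFE _ It dE) (mxderivE niI It (mx_has_derivT It dL)) EF /adjE.
rewrite !(trmx_mul, trmxD, mulmxDl, mulmxDr, mulmxBl, mulmxBr, opprD) /=.
rewrite !mulNmx !mulmxN !mulmxA.
by rewrite addrACA subrr addr0 (addrC (- _)) addrA.
Qed.

Lemma adj_adj m (E F : R -> 'M[R]_m) : mxCn I 1 E -> forall t, I t ->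
  adjE (adjE E) t = E t /\ adjF I (adjE E) (adjF I E F) t = F t.
Proof.
move=> cE t It; have dE := mxCn_has_deriv niI It cE.
rewrite {1}/adjE /adjE trmxN opprK trmxK; split=> //.
have dE' : mx_has_deriv I (fun t => - (E t)^T) t (- (mxderiv I E t)^T).
  by apply: mx_has_derivN => //; exact: mx_has_derivT.
rewrite (adjFE _ It dE') (adjFE _ It dE) !trmxD !trmxN !trmxK opprK.
by rewrite subrK.
Qed.

Lemma adj_nf k r s th (F11 : R -> 'M[R]_r) (F12 : R -> 'M[R]_(r, th)) (F21 : R -> 'M[R]_(th, r)) :
  seqv I k (adjE (fun=> nfE r (s + th)))
      (adjF I (fun=> nfE r (s + th)) (fun t => nfF s (F11 t) (F12 t) (F21 t)))
    (fun=> nfE r (s + th)) (fun t => nfF s (- (F11 t)^T) (- (F21 t)^T) (F12 t)^T).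
Proof.
exists (fun=> block_mx (- 1%:M) 0 0 1%:M), (fun=> 1%:M); split.
- split; first exact: mxCn_cst.
  move=> t It; apply: unit_block_diag; last exact: unitmx1.
  by rewrite -scaleN1r unitmxZ ?unitmx1 // unitrN1.
- by split; [exact: mxCn_cst|move=> t It; exact: unitmx1].
move=> t It; rewrite mxderiv_cst // !mulsimp (adjFE _ It (mx_has_deriv_cst I _ t)) trmx0 subr0.
rewrite /adjE /nfE /nfF !tr_block_mx !tr_row_mx !tr_col_mx !trmx0 !trmx1.
rewrite opp_block_mx !mulmx_block !oppr0 !mulsimp !mulNmx !mulmxN !mulsimp opprK.
by rewrite opp_row_mx oppr0.
Qed.

Lemma smooth_ker k p n q d (M : R -> 'M[R]_(p, n)) : n = (d + q)%N -> mxCn I k.+1 M ->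
  (forall t, I t -> \rank (M t) = d) ->
  exists C : R -> 'M[R]_(n, q), mxCn I k.+1 C /\
    forall t, I t -> mx_basis (C t) [set z | M t *m z = 0].
Proof. by move=> En; subst n; exact: smooth_kernel_basis. Qed.

Lemma col_prereg_rank d th th1 (G H : 'M[R]_(d, d + th)) (M : 'M[R]_(th, d + th)) :
  prereg_at (col_mx G 0) (col_mx H M) d th1 -> \rank M = th.
Proof.
move=> [sur _ _]; apply/rank_surj => w; have [u [v]] := sur (col_mx 0 w).
by rewrite !blkE => /eq_col_mx [_ ->]; exists v.
Qed.

(** Since [b^T z = 0] describes [im F12], the space in question is the intersection of [im F12] and
    [im c]. [F12] maps onto it, injectively, the [u] with [F12 u] in [im c], which are the vectors
    counted by [th1] for the reduced pair. *)
Lemma delta_basis d th th1 (c b : 'M[R]_(d + th, d)) (H : 'M[R]_(d + th, d)) F12 (F21 : 'M[R]_(th, d + th)) :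
  \rank F12^T = th -> mx_basis b [set z | F12^T *m z = 0] -> mx_basis c [set z | F21 *m z = 0] ->
  prereg_at (row_mx c 0) (row_mx H F12) d th1 ->
  exists V : 'M[R]_(d + th, th1), mx_basis V [set z | b^T *m z = 0 /\ F21 *m z = 0].
Proof.
move=> r12 bb [ic /= Hc] [_ _ [V [iV /= HV]]]; have [ib /= Hb] := bb.
have i12 : injmx F12 by apply/injmxP; rewrite -mxrank_tr.
have VE (y : 'cV[R]_th1) : exists2 u, V *m y = col_mx 0 (dsubmx V *m y) & F12 *m (dsubmx V *m y) = c *m u.
  have [] := (HV (V *m y)).2 (ex_intro _ y erefl).
  rewrite -{1 2 3}[V]vsubmxK /Sset /= !blkE => /ic E1 [u].
  rewrite -[u]vsubmxK !blkE E1 !mulsimp => E2; exists (usubmx u) => //.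
exists (F12 *m dsubmx V); split=> [y|z].
  by rewrite -mulmxA => /i12 E; apply: iV; have [_ -> _] := VE y; rewrite E col_mx0.
split=> [[/(ker_perp bb) [u]]|[y ->]].
  rewrite trmxK => -> /Hc [v Ev].
  have [|y Ey] := (HV (col_mx 0 u)).1.
    by rewrite !blkE; split=> //; exists (col_mx v 0); rewrite /= !blkE.
  by exists y; have [_ E _] := VE y; move: Ey; rewrite E => /eq_col_mx [_ ->]; rewrite mulmxA.
have [u _ E] := VE y; rewrite -mulmxA; split; last first.
  by rewrite E; apply/Hc; exists u.
have -> : b^T *m (F12 *m (dsubmx V *m y)) = (F12^T *m b)^T *m (dsubmx V *m y).
  by rewrite trmx_mul trmxK mulmxA.
have -> : F12^T *m b = 0.
  by apply: mulmx_cols_eq0 => w; exact: (Hb (b *m w)).2 (ex_intro _ w erefl).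
by rewrite trmx0 mul0mx.
Qed.

(* In normal form, let [c] and [b] span the kernels of [F21] and [F12^T]. The
   reduction of the dual reduction of the pair, and the adjoint of the reduction
   of the adjoint of the reduced pair, are both [(b^T c, b^T (F11 c + c'))]. *)
Theorem adj_Reg n m (E F : R -> 'M[R]_m) r theta : mxCn I (n.*2.+2) E -> mxCn I (n.*2.+2) F ->
  Reg I n E F r theta -> Reg I n (adjE E) (adjF I E F) r theta.
Proof.
have exI : exists t, I t by have [a [_ [Ia _ _]]] := nI.2; exists a.
elim/ltn_ind: n m E F r theta => n IH m E F r theta cE cF HR.
have HP := Reg_prereg HR; have [t0 It0] := exI.
have [s Em] := prereg_size (HP t0 It0); subst m.
have [F11 [F12 [F21 [c11 c12 c21 e]]]] := normal_form nI cE cF HP.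
have cE1 : mxCn I 1 E by exact: mxCn_le cE.
have HNF := Reg_eqv niI (seqv_eqv nI e) HR.
have r21 t : I t -> \rank (F21 t) = theta 0%N.
  by move=> It; exact: nf_prereg_rank (Reg_prereg HNF It).
(* It suffices to treat the adjoint of the normal form, again a normal form, with [F12^T] in the
   place of [F21]. *)
apply: (Reg_eqv niI (eqv_sym niI (adj_eqv cE1 e))).
apply: (Reg_eqv niI (eqv_sym niI (seqv_eqv (k := 0) nI (adj_nf 1 s F11 F12 F21)))).
have [d Er] : exists d, r = (d + theta 0%N)%N.
  exists (r - theta 0%N)%N; rewrite subnK //.
  move: HR; case: (n) => [|n']; first by move=> [_ [th0 _]]; lia.
  move=> [P [r1 [E1 [F1 [st _ _]]]]]; exact: (rank_red It0 (P t0 It0) st).2.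
subst r; set th := theta 0%N in F11 F12 F21 c11 c12 c21 e HNF r21 *.
have ker12 : (forall t, I t -> \rank (F12 t)^T = th) ->
    exists b : R -> 'M[R]_(d + th, d), mxCn I n.*2.+1 b /\
    forall t, I t -> mx_basis (b t) [set z | (F12 t)^T *m z = 0].
  by apply: smooth_ker; [rewrite addnC|exact: mxCnT].
case: n IH cE cF HR HP e HNF c11 c12 c21 ker12 => [|n] IH cE cF HR HP e HNF c11 c12 c21 ker12.
  (* At index one [F12^T] has no rows, so its rank is full for trivial reasons. *)
  have th0 : th = 0%N by case: HNF => _ [].
  have r12 t : I t -> \rank (F12 t)^T = th.
    by move=> _; have := rank_leq_row (F12 t)^T; lia.
  have [b [cb Hb]] := ker12 r12; split; first by move=> t It; apply: nf_prereg; exact: r12.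
  split=> //; right; eexists; eexists; exact: (nf_step _ _ _ cb Hb).
have cle k p q (M : R -> 'M[R]_(p, q)) : (k <= n.*2.+3)%N -> mxCn I n.*2.+3 M -> mxCn I k M.
  by move=> kn; apply: mxCn_le.
have [c [cc Hc]] : exists c : R -> 'M[R]_(d + th, d), mxCn I n.*2.+3 c /\
    forall t, I t -> mx_basis (c t) [set z | F21 t *m z = 0].
  by apply: smooth_ker r21; [rewrite addnC|].
have cc1 : mxCn I 1 c by exact: cle.
have cc' : mxCn I n.*2.+2 (mxderiv I c) by exact: mxCn_deriv.
have [th_gt0 _ Rrho] := Reg_step niI exI HNF (nf_step s F11 F12 cc1 Hc).
rewrite addnK in Rrho.
have crE : mxCn I n.*2.+2 (fun t => row_mx (c t) (0 : 'M[R]_(d + th, th))).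
  by apply: mxCn_row; [exact: cle|exact: mxCn_cst].
have crF : mxCn I n.*2.+2 (fun t => row_mx (F11 t *m c t + mxderiv I c t) (F12 t)).
  by apply: mxCn_row; [apply: (mxCnD niI); [apply: (mxCnM niI); exact: cle|exact: cc']|exact: cle].
have A2 : Reg I n (fun t => col_mx (- (c t)^T) 0)
    (fun t => col_mx (F11 t *m c t)^T (F12 t)^T) d (fun i => theta i.+1).
  apply: (Reg_eqv niI _ (IH n _ _ _ _ _ _ crE crF Rrho)) => //; apply: eqv_ext => t It.
  have dr : mx_has_deriv I (fun t => row_mx (c t) (0 : 'M[R]_(d + th, th))) t (row_mx (mxderiv I c t) 0).
    by apply: mx_has_deriv_row => //; [exact: mxCn_has_deriv cc1|exact: mx_has_deriv_cst].
  rewrite (adjFE _ It dr) /adjE !tr_row_mx opp_col_mx !trmx0 oppr0; split=> //.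
  by rewrite opp_col_mx add_col_mx oppr0 addr0 trmxD addrK.
(* Read off from [A2], the adjoint of the reduced pair, whose second block row is [F12^T]. *)
have r12 t : I t -> \rank (F12 t)^T = th.
  by move=> It; exact: col_prereg_rank (Reg_prereg A2 It).
have [b [cb Hb]] := ker12 r12; rewrite doubleS in cb.
have cb1 : mxCn I 1 b by exact: cle.
have cb' : mxCn I n.*2.+2 (mxderiv I b) by exact: mxCn_deriv.
have rbT t : I t -> \rank (b t)^T = d.
  by move=> It; rewrite mxrank_tr; apply/injmxP; case: (Hb t It).
(* The dual reduction. It is regular because its own reduction is the adjoint of the reduction of
   [A2] by [b], to which the induction hypothesis applies two levels down. *)
have Rdelta : Reg I n (fun t => col_mx (b t)^T 0)
    (fun t => col_mx ((b t)^T *m F11 t) (F21 t)) d (fun i => theta i.+1).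
  have P t : I t -> prereg_at (col_mx (b t)^T 0) (col_mx ((b t)^T *m F11 t) (F21 t)) d (theta 1%N).
    move=> It; have [V HV] := delta_basis (r12 t It) (Hb t It) (Hc t It) (Reg_prereg Rrho It).
    exact: col_prereg (rbT t It) (r21 t It) HV.
  have st := col_step (fun t => (b t)^T *m F11 t) cc1 Hc rbT.
  case: n IH A2 Rrho P c11 cc cc' cb cb' cle {cE cF HR e HNF c12 c21 ker12 crE crF}
    => [|n] IH A2 Rrho P c11 cc cc' cb cb' cle.
    split=> //; case: Rrho => _ [th1 _]; split=> //; right.
    by eexists; eexists; exact: st.
  have rG t : I t -> \rank (- (c t)^T) = d.
    by move=> It; rewrite mxrank_opp mxrank_tr; apply/injmxP; case: (Hc t It).
  have [th1_gt0 th1_le RW] :=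
    Reg_step niI exI A2 (col_step (fun t => (F11 t *m c t)^T) cb1 Hb rG).
  have dc t : I t -> mx_has_deriv I c t (mxderiv I c t) by move=> It; exact: mxCn_has_deriv cc1.
  have db t : I t -> mx_has_deriv I b t (mxderiv I b t) by move=> It; exact: mxCn_has_deriv cb1.
  have dn p q (M : R -> 'M[R]_(p, q)) : mxCn I n.+1.*2.+3 M -> mxCn I n.*2.+2 M.
    by apply: cle; rewrite doubleS; lia.
  have cW1 : mxCn I n.*2.+2 (fun t => - (c t)^T *m b t).
    by apply: (mxCnM niI); [apply: (mxCnN niI); apply: mxCnT|]; exact: dn.
  have cW2 : mxCn I n.*2.+2 (fun t => (F11 t *m c t)^T *m b t + - (c t)^T *m mxderiv I b t).
    apply: (mxCnD niI); apply: (mxCnM niI).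
    - by apply: mxCnT; apply: (mxCnM niI); exact: dn.
    - exact: dn.
    - by apply: (mxCnN niI); apply: mxCnT; exact: dn.
    - by apply: mxCn_le cb' => //; rewrite doubleS; lia.
  have R3 := IH n (leqW (ltnSn n)) _ _ _ _ _ cW1 cW2 RW.
  split=> //; exists (d - theta 1%N)%N; eexists; eexists; split; [exact: st|lia|].
  apply: (Reg_eqv niI _ R3); apply: eqv_ext => t It.
  have dW : mx_has_deriv I (fun t => - (c t)^T *m b t) t
      (- (mxderiv I c t)^T *m b t + - (c t)^T *m mxderiv I b t).
    apply: mx_has_derivM => //; last exact: db.
    by apply: mx_has_derivN => //; apply: mx_has_derivT => //; exact: dc.
  rewrite (adjFE _ It dW) /adjE; split.
    by rewrite mulNmx trmxN opprK trmx_mul trmxK.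
  rewrite !trmxD !mulNmx !trmxN !trmx_mul !trmxK opprD !opprK addrACA addNr addr0.
  by rewrite mulmxA.
split; first by move=> t It; apply: nf_prereg; exact: r12.
exists d; eexists; eexists; split; [exact: (nf_step _ _ _ cb1 Hb)|by rewrite -addn1 leq_add2l|].
have cdE : mxCn I n.*2.+2 (fun t => col_mx (b t)^T (0 : 'M[R]_(th, d + th))).
  by apply: mxCn_col; [apply: mxCnT; exact: cle|exact: mxCn_cst].
have cdF : mxCn I n.*2.+2 (fun t => col_mx ((b t)^T *m F11 t) (F21 t)).
  by apply: mxCn_col; [apply: (mxCnM niI); [apply: mxCnT|]; exact: cle|exact: cle].
(* Up to sign, the adjoint of the dual reduction is the reduction of the adjoint normal form by
   [b]. *)
have R1 := Reg_eqv niI (eqv_opp _ _) (IH n (ltnSn n) _ _ _ _ _ cdE cdF Rdelta).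
apply: (Reg_eqv niI _ R1); apply: eqv_ext => t It.
have dd : mx_has_deriv I (fun t => col_mx (b t)^T (0 : 'M[R]_(th, d + th))) t (col_mx (mxderiv I b t)^T 0).
  apply: mx_has_deriv_col => //; last exact: mx_has_deriv_cst.
  by apply: mx_has_derivT => //; exact: mxCn_has_deriv cb1.
rewrite (adjFE _ It dd) /adjE !tr_col_mx !trmxK trmx0 opprK; split=> //.
by rewrite trmx_mul trmxK opp_row_mx add_row_mx opp_row_mx oppr0 addr0 opprB mulNmx addrC.
Qed.

End AdjointRegularity.

(** * Smoothness of weak solutions *)

Section WeakSolutions.
Context {R : realType}.
Implicit Types (p q n k d m r s : nat).
Variable I : set R.
Hypothesis nI : nondeg_itv I.
Let niI : no_isolated I := nondeg_no_isolated nI.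

Lemma mx_has_deriv_dsub p q r (M : R -> 'M[R]_(q + r, p)) t M' : I t ->
  mx_has_deriv I M t M' -> mx_has_deriv I (fun t => dsubmx (M t)) t (dsubmx M').
Proof.
by move=> It H i j; rewrite mxE; apply: has_deriv_ext (H (rshift _ i) j) => // s _; rewrite mxE.
Qed.

(* [E x' + F x = 0] in the form [(E x)' = (E' - F) x], which only needs [E x] to be
   differentiable. *)
Definition weak_sol m (E F : R -> 'M[R]_m) (x : R -> 'cV[R]_m) :=
  mxCn I 0 x /\ forall t, I t ->
    mx_has_deriv I (fun t => E t *m x t) t ((mxderiv I E t - F t) *m x t).

Lemma weak_sol_seqv k m (E F E' F' : R -> 'M[R]_m) x : mxCn I 1 E -> seqv I k.+1 E F E' F' ->
  weak_sol E F x -> exists K : R -> 'M[R]_m, exists x',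
    [/\ mxCn I 1 K, forall t, I t -> x t = K t *m x' t & weak_sol E' F' x'].
Proof.
move=> cE [L [K [[cL uL] [cK uK] H]]] [cx Hx].
have cK1 : mxCn I 1 K by exact: mxCn_le cK.
exists K, (fun t => invmx (K t) *m x t); split=> //.
  by move=> t It; rewrite mulKVmx // uK.
split.
  apply: (mxCnM niI) => //; apply: (mxCnV niI) => //; exact: mxCn_le cK.
move=> t It.
have dK := mxCn_has_deriv niI It cK; have dL := mxCn_has_deriv niI It cL.
have dE := mxCn_has_deriv niI It cE.
have dE' : mx_has_deriv I E' t ((mxderiv I L t *m E t + L t *m mxderiv I E t) *m K t +
    L t *m E t *m mxderiv I K t).
  apply: mx_has_deriv_ext (mx_has_derivM It (mx_has_derivM It dL dE) dK) => // s Is.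
  by have [-> _] := H s Is.
have [_ EF] := H t It.
rewrite (mxderivE niI It dE') EF.
have -> : (mxderiv I L t *m E t + L t *m mxderiv I E t) *m K t + L t *m E t *m mxderiv I K t -
    L t *m (F t *m K t + E t *m mxderiv I K t) =
    (mxderiv I L t *m E t + L t *m (mxderiv I E t - F t)) *m K t.
  rewrite !mulmxDr !mulmxDl !mulmxN !mulNmx !mulmxA opprD.
  by rewrite -!addrA; congr (_ + (_ + _)); rewrite addrC -addrA addNr addr0.
rewrite -(mulmxA _ (K t)) mulKVmx ?uK // mulmxDl -!mulmxA.
apply: mx_has_deriv_ext (mx_has_derivM It dL (Hx t It)) => // s Is.
by have [-> _] := H s Is; rewrite -!mulmxA mulKVmx ?uK.
Qed.

Lemma weak_sol_nf r s th (F11 : R -> 'M[R]_r) (F12 : R -> 'M[R]_(r, th)) (F21 : R -> 'M[R]_(th, r)) x :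
  weak_sol (fun=> nfE r (s + th)) (fun t => nfF s (F11 t) (F12 t) (F21 t)) x ->
  [/\ forall t, I t -> mx_has_deriv I (fun t => usubmx (x t)) t
        (- (F11 t *m usubmx (x t) + F12 t *m dsubmx (dsubmx (x t)))),
      forall t, I t -> usubmx (dsubmx (x t)) = 0
    & forall t, I t -> F21 t *m usubmx (x t) = 0].
Proof.
move=> [cx Hx].
have E1 t : nfE r (s + th) *m x t = col_mx (usubmx (x t)) 0.
  by rewrite /nfE -{1}[x t]vsubmxK mul_block_col !mulsimp.
have E2 t : nfF s (F11 t) (F12 t) (F21 t) *m x t =
    col_mx (F11 t *m usubmx (x t) + F12 t *m dsubmx (dsubmx (x t)))
      (col_mx (usubmx (dsubmx (x t))) (F21 t *m usubmx (x t))).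
  by rewrite /nfF -{1}[x t]vsubmxK -{1}[dsubmx (x t)]vsubmxK !blkE.
have D t : I t -> mx_has_deriv I (fun t => col_mx (usubmx (x t)) (0 : 'cV[R]_(s + th))) t
    (- col_mx (F11 t *m usubmx (x t) + F12 t *m dsubmx (dsubmx (x t)))
      (col_mx (usubmx (dsubmx (x t))) (F21 t *m usubmx (x t)))).
  move=> It; have := Hx t It; rewrite mxderiv_cst // sub0r mulNmx E2.
  by apply: mx_has_deriv_ext => // u _; rewrite E1.
have Z t : I t -> col_mx (usubmx (dsubmx (x t))) (F21 t *m usubmx (x t)) = 0.
  move=> It; have := mx_has_deriv_dsub It (D t It).
  rewrite opp_col_mx col_mxKd => /(mxderivE niI It) D0.
  apply/eqP; rewrite -oppr_eq0; apply/eqP; rewrite -D0.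
  apply: (mxderivE niI It); apply: mx_has_deriv_ext (mx_has_deriv_cst I 0 t) => // u _.
  by rewrite col_mxKd.
split=> t It.
- have := mx_has_deriv_usub It (D t It); rewrite opp_col_mx col_mxKu.
  by apply: mx_has_deriv_ext => // u _; rewrite col_mxKu.
- by have := Z t It; rewrite -(@col_mx0 _ s th 1) => /eq_col_mx [].
- by have := Z t It; rewrite -(@col_mx0 _ s th 1) => /eq_col_mx [].
Qed.

(* A continuous [x] with [E x] differentiable is [C^1] by regularity:
   in normal form the unconstrained components solve the reduced pair. *)
Theorem weak_sol_C1 n m (E F : R -> 'M[R]_m) r theta x :
  mxCn I (n.*2.+2) E -> mxCn I (n.*2.+2) F ->
  Reg I n E F r theta -> weak_sol E F x -> mxCn I 1 x.
Proof.
have exI : exists t, I t by have [a [_ [Ia _ _]]] := nI.2; exists a.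
elim: n m E F r theta x => [|n IH] m E F r theta x cE cF HR Hx;
  have HP := Reg_prereg HR; have [t0 It0] := exI;
  have [s Em] := prereg_size (HP t0 It0); subst m;
  have [F11 [F12 [F21 [c11 c12 c21 e]]]] := normal_form nI cE cF HP;
  have cE1 : mxCn I 1 E by [exact: mxCn_le cE];
  have HNF := Reg_eqv niI (seqv_eqv nI e) HR;
  have r21 t : I t -> \rank (F21 t) = theta 0%N by [move=> It; exact: nf_prereg_rank (Reg_prereg HNF It)];
  have [K [y [cK xE Hy]]] := weak_sol_seqv cE1 e Hx;
  have [D1 Z2 Z1] := weak_sol_nf Hy; have [cy _] := Hy.
- apply: (mxCn_ext (M := fun t => K t *m y t)); first by move=> t It; rewrite xE.
  apply: (mxCnM niI) => //.
  apply: (mxCn_ext (M := fun t => col_mx (usubmx (y t)) (col_mx (usubmx (dsubmx (y t))) (dsubmx (dsubmx (y t)))))).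
    by move=> t _; rewrite !vsubmxK.
  apply: mxCn_col; first apply: (mxCnS_deriv niI D1).
    apply: (mxCnN niI); apply: (mxCnD niI); apply: (mxCnM niI).
    + exact: mxCn_le c11.
    + exact: mxCn_usub.
    + exact: mxCn_le c12.
    + by apply: mxCn_dsub; exact: mxCn_dsub.
  apply: mxCn_col.
    by apply: (mxCn_ext (M := fun=> 0)); [move=> t It; rewrite Z2|exact: mxCn_cst].
  (* The last component has [theta 0 = 0] rows. *)
  by have [_ [th0 _]] := HR => i; have := ltn_ord i; rewrite {2}th0.
have [d Er] : exists d, r = (d + theta 0%N)%N.
  exists (r - theta 0%N)%N; rewrite subnK //.
  have [P [r1 [E1 [F1 [st _ _]]]]] := HR; exact: (rank_red It0 (P t0 It0) st).2.
subst r; set th := theta 0%N in F11 F12 F21 c11 c12 c21 e HNF r21 y xE Hy D1 Z2 Z1 cy *.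
have [c [cc Hc]] : exists c : R -> 'M[R]_(d + th, d), mxCn I n.*2.+3 c /\
    forall t, I t -> mx_basis (c t) [set z | F21 t *m z = 0].
  by apply: (smooth_ker nI) r21; [rewrite addnC|].
have cle k p q (M : R -> 'M[R]_(p, q)) : (k <= n.*2.+3)%N -> mxCn I n.*2.+3 M -> mxCn I k M.
  by move=> kn; apply: mxCn_le.
have cc1 : mxCn I 1 c by exact: cle.
have cc' : mxCn I n.*2.+2 (mxderiv I c) by exact: mxCn_deriv.
have [th_gt0 _ Rrho] := Reg_step niI exI HNF (nf_step nI s F11 F12 cc1 Hc).
have crE : mxCn I n.*2.+2 (fun t => row_mx (c t) (0 : 'M[R]_(d + th, th))).
  by apply: mxCn_row; [exact: cle|exact: mxCn_cst].
have crF : mxCn I n.*2.+2 (fun t => row_mx (F11 t *m c t + mxderiv I c t) (F12 t)).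
  apply: mxCn_row; [apply: (mxCnD niI); [apply: (mxCnM niI); exact: cle|exact: cc']|exact: cle].
(* The constraint lets the first component be written as [c v]. For the reduced pair this product is
   the differentiable quantity, so [w] is again a weak solution. *)
pose w t := col_mx (linv (c t) *m usubmx (y t)) (dsubmx (dsubmx (y t))).
have cu t : I t -> c t *m (linv (c t) *m usubmx (y t)) = usubmx (y t).
  by move=> It; apply: (mx_basis_linv (Hc t It)); exact: Z1.
have Hw : weak_sol (fun t => row_mx (c t) 0) (fun t => row_mx (F11 t *m c t + mxderiv I c t) (F12 t)) w.
  split.
    apply: mxCn_col; last by apply: mxCn_dsub; exact: mxCn_dsub.
    apply: (mxCnM niI); last exact: mxCn_usub.
    apply: (mxCn_linv niI); first by move=> t It; case: (Hc t It).
    exact: cle cc.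
  move=> t It.
  have dr : mx_has_deriv I (fun t => row_mx (c t) (0 : 'M[R]_(d + th, th))) t (row_mx (mxderiv I c t) 0).
    by apply: mx_has_deriv_row => //; [exact: mxCn_has_deriv cc1|exact: mx_has_deriv_cst].
  rewrite (mxderivE niI It dr) opp_row_mx add_row_mx sub0r opprD addrCA subrr addr0 /w.
  rewrite mul_row_col !mulNmx -mulmxA cu // -opprD.
  by apply: mx_has_deriv_ext (D1 t It) => // u Iu; rewrite mul_row_col !mulsimp cu.
have cw := IH _ _ _ _ _ _ crE crF Rrho Hw.
apply: (mxCn_ext (M := fun t => K t *m y t)); first by move=> t It; rewrite xE.
apply: (mxCnM niI) => //.
apply: (mxCn_ext (M := fun t => col_mx (usubmx (y t)) (col_mx (usubmx (dsubmx (y t))) (dsubmx (dsubmx (y t)))))).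
  by move=> t _; rewrite !vsubmxK.
apply: mxCn_col; first apply: (mxCnS_deriv niI D1).
  apply: (mxCnN niI); apply: (mxCnD niI); apply: (mxCnM niI).
  + exact: mxCn_le c11.
  + exact: mxCn_usub.
  + exact: mxCn_le c12.
  + by apply: mxCn_dsub; exact: mxCn_dsub.
apply: mxCn_col.
  by apply: (mxCn_ext (M := fun=> 0)); [move=> t It; rewrite Z2|exact: mxCn_cst].
by apply: (mxCn_ext (M := fun t => dsubmx (w t))); [move=> t It; rewrite col_mxKd|exact: mxCn_dsub].
Qed.

End WeakSolutions.

(** * Admissible matrix sequences *)

Section MatrixSequences.
Context {R : realType}.
Variables (I : set R) (m k mu : nat) (E F : R -> 'M[R]_m).
Variables (A : R -> 'M[R]_(m, k)) (D : R -> 'M[R]_(k, m)).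
Variables (Dm : R -> 'M[R]_(m, k)) (Q : nat -> R -> 'M[R]_m).
Hypothesis nI : nondeg_itv I.
Hypothesis cF : mxCn I 0 F.
Hypothesis HAD : proper_factorization I E A D.
Hypothesis cQ0 : mxCn I 1 (Q 0%N).
Hypothesis HQ0 : forall s, I s -> projects_on (Q 0%N s) (kerc (E s)).
Hypothesis HDm : generalized_inverse I A D (seqP Q 0) Dm.
Hypothesis adm : admissible_sequence I F A D Dm Q mu.
Hypothesis uG : forall s, I s -> seqG I F A D Dm Q mu s \in unitmx.
Let niI : no_isolated I := nondeg_no_isolated nI.

Let G i := seqG I F A D Dm Q i.
Let B i := (seqGB I F A D Dm Q i).2.
Let P i := seqP Q i.
Let Pi i := seqPi Q i.
Let M i := DPiD D Dm Q i.

Let GS i t : G i.+1 t = G i t + B i t *m Q i t.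
Proof. by rewrite /G /B /seqG /=; case: (seqGB _ _ _ _ _ _ i). Qed.

Let BS i t : B i.+1 t =
  B i t *m P i t - G i.+1 t *m Dm t *m mxderiv I (M i.+1) t *m D t *m Pi i t.
Proof. by rewrite /G /B /seqG /=; case: (seqGB _ _ _ _ _ _ i). Qed.

Let PiS i t : Pi i.+1 t = Pi i t *m P i.+1 t. Proof. by []. Qed.

Let MS i t : M i t = D t *m Pi i t *m Dm t. Proof. by []. Qed.

Let G0 t : I t -> G 0 t = E t.
Proof. by move=> It; have [-> ] := HAD. Qed.

(** If [w' = w (S + N')], the defect [w - w N] solves a homogeneous linear equation, so it remains
    zero once it is zero. *)
Lemma defect_deriv n p (w : 'M[R]_(p, n)) (S N N' : 'M[R]_n) : S *m N = S -> N *m N' *m N = 0 ->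
  w *m (S + N') - (w *m (S + N') *m N + w *m N') = - ((w - w *m N) *m (N' *m N)).
Proof.
move=> SN NNN; rewrite mulmxBl -!(mulmxA w) (mulmxA N) NNN mulmx0 subr0 mulmxDl SN !mulmxDr.
by rewrite (addrAC _ (w *m (N' *m N))) opprD addrA subrr sub0r.
Qed.

Lemma projects_onP n (T : 'M[R]_n) q (S : 'M[R]_(q, n)) : projects_on T (kerc S) ->
  [/\ T *m T = T, S *m T = 0 & forall p (Z : 'M[R]_(n, p)), S *m Z = 0 -> T *m Z = Z].
Proof.
move=> [TT im]; split=> //.
  apply: mulmx_cols_eq0 => u; apply/kercP; rewrite -im; apply/imcP; by exists u.
move=> p Z SZ; apply/matrixP => i j.
have : col j Z \in imc T by rewrite im; apply/kercP; rewrite -col_mulmx SZ col0.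
move=> /imcP [u Eu]; have : T *m col j Z = col j Z by rewrite Eu mulmxA TT.
by rewrite -col_mulmx => /matrixP/(_ i ord0); rewrite !mxE.
Qed.

Section Pointwise.
Variables (t : R) (It : I t).

Lemma Q_spec i : (i <= mu)%N ->
  [/\ Q i t *m Q i t = Q i t, G i t *m Q i t = 0
    & forall p (Z : 'M[R]_(m, p)), G i t *m Z = 0 -> Q i t *m Z = Z].
Proof.
case: i => [_|i imu]; apply: projects_onP; first by rewrite G0 //; exact: HQ0.
by have [H _ _ _ _] := adm; have [] := H i.+1 t imu It.
Qed.

Lemma mulPQ i : (i <= mu)%N -> P i t *m Q i t = 0.
Proof. by move=> /Q_spec [QQ _ _]; rewrite /P /seqP mulmxBl mul1mx QQ subrr. Qed.

Lemma mulGP i : (i <= mu)%N -> G i t *m P i t = G i t.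
Proof. by move=> /Q_spec [_ GQ _]; rewrite /P /seqP mulmxBr mulmx1 GQ subr0. Qed.

Lemma mulDmD : Dm t *m D t = P 0 t. Proof. by have [] := HDm It. Qed.

Lemma mulDP0 : D t *m P 0 t = D t. Proof. by rewrite -mulDmD mulmxA; have [] := HDm It. Qed.

Lemma mulP0Dm : P 0 t *m Dm t = Dm t. Proof. by rewrite -mulDmD; have [] := HDm It. Qed.

Lemma mulADDm : A t *m D t *m Dm t = A t.
Proof.
have [_ _ [[RR _] ker] _] := HDm It.
rewrite -mulmxA; apply/eqP; rewrite eq_sym -subr_eq0 -{1}[A t]mulmx1 -mulmxBr; apply/eqP.
apply: mulmx_cols_eq0 => u; apply/kercP; rewrite -ker; apply/kercP.
by rewrite mulmxA mulmxBr mulmx1 RR subrr mul0mx.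
Qed.

(** The derivative terms in the recursion for [B] end in a factor [Pi]; unrolling it leaves a
    product that ends in [Pi i] as well. *)
Lemma B_kills_kerPi i p (Z : 'M[R]_(m, p)) : Pi i t *m Z = 0 -> B i.+1 t *m Z = 0.
Proof.
move=> PZ; rewrite BS mulmxBl -(mulmxA _ (Pi i t)) PZ mulmx0 subr0 -mulmxA.
elim: i Z PZ => [|i IH] Z PZ; first by rewrite [P 0 t *m Z]PZ mulmx0.
rewrite BS mulmxBl -(mulmxA (B i t)) IH; last by rewrite mulmxA -PiS.
by rewrite -(mulmxA _ (Pi i t)) (mulmxA (Pi i t)) -PiS PZ mulmx0 subrr.
Qed.

(** The two conditions pass from level [i] to [i.+1], since [B i.+1] kills [Z] and [Q i.+1] fixes
    it. They climb to [G mu], which is nonsingular. *)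
Lemma hat_trivial i p (Z : 'M[R]_(m, p)) : (i < mu)%N ->
  G i.+1 t *m Z = 0 -> Pi i t *m Z = 0 -> Z = 0.
Proof.
move=> imu; move: (mu - i.+1)%N (subnK imu) => d.
elim: d i {imu} => [|d IH] i Ed GZ PZ.
  rewrite add0n in Ed; rewrite Ed in GZ.
  exact: injmx_mx (unit_injmx (uG It)) GZ.
have imu : (i.+1 <= mu)%N by lia.
have [_ _ HZ] := Q_spec imu; have QZ := HZ _ _ GZ.
apply: (IH i.+1); first by rewrite -Ed addSnnS.
  by rewrite GS mulmxDl GZ add0r -mulmxA QZ; exact: B_kills_kerPi.
by rewrite PiS -mulmxA /P /seqP mulmxBl mul1mx QZ subrr mulmx0.
Qed.

(** Triviality of [hatN] makes [X] the full sum of the earlier kernels. This sum therefore lies in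
    [ker Q], which gives [Q_i Q_j = 0] for [j < i]. *)
Lemma mulPiQ i : (i <= mu)%N -> forall j, (j <= i)%N -> Pi i t *m Q j t = 0.
Proof.
elim: i => [_ j|i IH imu j]; first by rewrite leqn0 => /eqP ->; exact: mulPQ.
have {}IH := IH (ltnW imu).
have QQ l : (l <= i)%N -> Q i.+1 t *m Q l t = 0.
  move=> li; have [H _ _ _ _] := adm; have [_ [X [h1 _ h3]]] := H i.+1 t imu It.
  have hat0 : hatN I F A D Dm Q i.+1 t = 0%VS.
    apply/eqP; rewrite -subv0; apply/subvP => z; rewrite memv_cap => /andP[zs /kercP Gz].
    rewrite (hat_trivial imu Gz) ?mem0v //.
    have /memv_sumP [v Hv ->] := zs; rewrite mulmx_sumr big1 // => l' _.
    have l'i : (l' <= i)%N by rewrite -ltnS.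
    have [_ _ HZ] := Q_spec (leq_trans l'i (ltnW imu)).
    have /kercP Gv := Hv l' isT.
    by rewrite -(HZ _ _ Gv) mulmxA IH // mul0mx.
  apply: mulmx_cols_eq0 => u; apply/kercP; apply: (subvP h3).
  rewrite hat0 add0v in h1; rewrite h1.
  have li' : (l < i.+1)%N by [].
  apply: (subvP (sumv_sup (Ordinal li') isT (subvv _))).
  have [_ GQ _] := Q_spec (leq_trans li (ltnW imu)).
  by apply/kercP; rewrite mulmxA GQ mul0mx.
rewrite leq_eqVlt => /orP[/eqP ->|ji]; first by rewrite PiS -mulmxA mulPQ // mulmx0.
by rewrite PiS -mulmxA /P /seqP mulmxBl mul1mx QQ // subr0 IH.
Qed.

Lemma mulPiP i j : (i <= mu)%N -> (j <= i)%N -> Pi i t *m P j t = Pi i t.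
Proof. by move=> imu ji; rewrite /P /seqP mulmxBr mulmx1 mulPiQ // subr0. Qed.

Lemma mulPiPi i j : (i <= mu)%N -> (j <= i)%N -> Pi i t *m Pi j t = Pi i t.
Proof.
move=> imu; elim: j => [_|j IH ji]; first exact: mulPiP.
by rewrite PiS mulmxA IH ?mulPiP // ltnW.
Qed.

Lemma mulP0Pi i : P 0 t *m Pi i t = Pi i t.
Proof.
elim: i => [|i IH]; last by rewrite PiS mulmxA IH.
by have [QQ _ _] := Q_spec (leq0n mu); rewrite [Pi 0 t]/(P 0 t) /P /seqP mulmxBr mulmx1 mulmxBl mul1mx QQ subrr subr0.
Qed.

Lemma mulBPi i : (i <= mu)%N -> B i t *m Pi i t = B i t *m P i t.
Proof.
case: i => [//|i] imu; rewrite PiS mulmxA; congr (_ *m _).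
apply/eqP; rewrite eq_sym -subr_eq0 -{1}[B i.+1 t]mulmx1 -mulmxBr; apply/eqP.
by apply: B_kills_kerPi; rewrite mulmxBr mulmx1 mulPiPi ?subrr // ltnW.
Qed.

Lemma mulMM i j : (i <= mu)%N -> (j <= i)%N -> M i t *m M j t = M i t.
Proof.
move=> imu ji; rewrite !MS -!mulmxA (mulmxA (Dm t)) mulDmD (mulmxA (P 0 t)) mulP0Pi.
by rewrite (mulmxA (Pi i t)) mulPiPi.
Qed.

End Pointwise.

(** [Dm] solves the injective system [D X = M 0], [Q 0 X = 0], whose data are [C^1]. *)
Lemma Dm_C1 : mxCn I 1 Dm.
Proof.
have [_ _ _ _ cM] := adm; have [_ [_ cD] _ _ _] := HAD.
pose T t := col_mx (D t) (Q 0 t).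
apply: (mxCn_solve nI (M := T) (H := fun t => col_mx (M 0 t) 0)).
- move=> t It z; rewrite mul_col_mx -(@col_mx0 _ k m 1) => /eq_col_mx [Dz Qz].
  have := congr1 (mulmx (Dm t)) Dz; rewrite mulmxA (mulDmD It) mulmx0.
  by rewrite /P /seqP mulmxBl mul1mx Qz subr0.
- move=> t It; rewrite mul_col_mx; congr col_mx.
    by rewrite MS -mulmxA [Pi 0 t *m _](mulP0Dm It).
  have -> : Q 0 t = 1%:M - P 0 t by rewrite /P /seqP opprB addrCA subrr addr0.
  by rewrite mulmxBl mul1mx (mulP0Dm It) subrr.
- by apply: mxCn_col.
- apply: mxCn_col; [exact: cM|exact: mxCn_cst].
Qed.

(** Admissibility gives continuity of the [Pi i], not of the [Q i]. But [Q i.+1] solves a system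
    with matrix [(G i.+1; Pi i)], injective by [hat_trivial]. *)
Lemma sequence_continuous i : (i <= mu)%N -> [/\ mxCn I 0 (G i), mxCn I 0 (B i) & mxCn I 0 (Q i)].
Proof.
have [_ _ _ cPi cM] := adm; have [_ [cA cD] _ _ _] := HAD.
elim: i => [_|i IH imu].
  split; [|apply: (mxCnB niI) => //|exact: mxCn_le cQ0].
    by apply: (mxCnM niI) => //; exact: mxCn_le cD.
  by apply: (mxCnM niI) => //; exact: mxCn_deriv.
have [cGi cBi cQi] := IH (ltnW imu).
have cP j : (j <= mu)%N -> mxCn I 0 (Q j) -> mxCn I 0 (P j).
  by move=> _ cQ; apply: (mxCnB niI) => //; exact: mxCn_cst.
have cG1 : mxCn I 0 (G i.+1).
  apply: (mxCn_ext (M := fun t => G i t + B i t *m Q i t)); first by move=> t It; rewrite GS.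
  by apply: (mxCnD niI) => //; apply: (mxCnM niI).
have cDm : mxCn I 0 Dm by apply: mxCn_le Dm_C1.
have cD0 : mxCn I 0 D by apply: mxCn_le cD.
split=> //.
  apply: (mxCn_ext (M := fun t => B i t *m P i t
      - G i.+1 t *m Dm t *m mxderiv I (M i.+1) t *m D t *m Pi i t)).
    by move=> t It; rewrite BS.
  apply: (mxCnB niI); first by apply: (mxCnM niI) => //; apply: cP => //; exact: ltnW.
  apply: (mxCnM niI); last by apply: cPi; exact: ltnW.
  apply: (mxCnM niI) => //; apply: (mxCnM niI); last by apply: mxCn_deriv => //; exact: cM.
  by apply: (mxCnM niI).
apply: (mxCn_solve nI (M := fun t => col_mx (G i.+1 t) (Pi i t))
    (H := fun t => col_mx 0 (Pi i t - Pi i.+1 t))).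
- move=> t It z; rewrite mul_col_mx -(@col_mx0 _ m m 1) => /eq_col_mx [Gz Piz].
  exact: hat_trivial Gz Piz.
- move=> t It; rewrite mul_col_mx; have [_ -> _] := Q_spec It imu; congr col_mx.
  by rewrite PiS /P /seqP mulmxBr mulmx1 opprB addrCA subrr addr0.
- by apply: mxCn_col => //; apply: cPi; exact: ltnW.
apply: mxCn_col; first exact: mxCn_cst.
by apply: (mxCnB niI); apply: cPi => //; exact: ltnW.
Qed.

(* [y^T A] plays the role of the adjoint state; along an adjoint solution it
   annihilates every [N_i]. *)
Lemma adjoint_solution_kills J (y : R -> 'cV[R]_m) : no_isolated J -> J `<=` I ->
  (forall s, J s -> mx_has_deriv J (fun s => (E s)^T *m y s) s ((F s)^T *m y s)) ->
  forall i s, (i <= mu)%N -> J s -> (y s)^T *m E s *m Pi i s = (y s)^T *m E s.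
Proof.
move=> nJ JI Hy; have [EAD [cA cD] _ _ _] := HAD; have [_ _ _ _ cM] := adm.
have dE s : J s -> mx_has_deriv J (fun s => (y s)^T *m E s) s ((y s)^T *m F s).
  move=> Js; have := mx_has_derivT Js (Hy s Js); rewrite trmx_mul trmxK.
  by apply: mx_has_deriv_ext => // u _; rewrite trmx_mul trmxK.
have dsub n p q (N : R -> 'M[R]_(p, q)) s : J s -> mxCn I n.+1 N -> mx_has_deriv J N s (mxderiv I N s).
  by move=> Js cN; apply: (mx_has_deriv_sub JI); apply: mxCn_has_deriv cN => //; exact: JI.
pose v s := (y s)^T *m A s.
(* As [A D D^- = A], one has [v = y^T E D^-]; so [v] is differentiable even where [y] is not. *)
pose v' s := (y s)^T *m F s *m Dm s + (y s)^T *m E s *m mxderiv I Dm s.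
have dv s : J s -> mx_has_deriv J v s (v' s).
  move=> Js; apply: mx_has_deriv_ext (mx_has_derivM Js (dE s Js) (dsub _ _ _ _ _ Js Dm_C1)) => // u Ju.
  by have Iu := JI _ Ju; rewrite (EAD u Iu) -mulmxA (mulADDm Iu).
have vD s : J s -> v s *m D s = (y s)^T *m E s.
  by move=> Js; rewrite /v -mulmxA -(EAD s (JI _ Js)).
have yF s : J s -> (y s)^T *m F s = v' s *m D s + v s *m mxderiv I D s.
  move=> Js; rewrite -(mxderivE nJ Js (dE s Js)); apply: (mxderivE nJ Js).
  by apply: mx_has_deriv_ext (mx_has_derivM Js (dv s Js) (dsub _ _ _ _ _ Js cD)) => // u Ju; exact: vD.
have vR s : J s -> v s *m D s *m Dm s = v s.
  by move=> Js; rewrite /v -!mulmxA (mulmxA (A s)) (mulADDm (JI _ Js)).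
have vA s : (y s)^T *m A s = v s by [].
clearbody v v'.
suff H i : (i <= mu)%N -> forall s, J s ->
    [/\ (y s)^T *m G i s = v s *m D s, (y s)^T *m B i s = v' s *m D s *m Pi i s
      & v s *m D s *m Pi i s = v s *m D s].
  by move=> i s imu Js; have [_ _ E0] := H i imu s Js; rewrite -(vD s Js).
have vDP j s : (j <= mu)%N -> J s -> (y s)^T *m G j s = v s *m D s -> v s *m D s *m P j s = v s *m D s.
  by move=> imu Js <-; rewrite -mulmxA (mulGP (JI _ Js) imu).
elim: i => [_ s Js|i IH imu s Js].
  have Is := JI _ Js; have yG : (y s)^T *m G 0 s = v s *m D s by rewrite (G0 Is) vD.
  split=> //; last exact: vDP.
  rewrite -[_ *m Pi 0 s]mulmxA [D s *m _](mulDP0 Is).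
  by rewrite /B /= mulmxBr yF // mulmxA vA addrK.
have Is := JI _ Js; have ilt := ltnW imu; have [yG yB vPi] := IH ilt s Js.
have yG1 u : J u -> (y u)^T *m G i.+1 u = v u *m D u.
  move=> Ju; have [yGu yBu _] := IH ilt u Ju.
  by rewrite GS mulmxDr yGu mulmxA yBu -mulmxA (mulPiQ (JI _ Ju) ilt) // mulmx0 addr0.
have vPi1 u : J u -> v u *m D u *m Pi i.+1 u = v u *m D u.
  by move=> Ju; have [_ _ vPu] := IH ilt u Ju; rewrite PiS mulmxA vPu vDP // yG1.
split; [exact: yG1| |exact: vPi1].
(* Differentiating [v = v M_{i+1}] produces the term with the derivative of [M_{i+1}] in
   [B_{i+1}]. *)
have dM : v' s = v' s *m M i.+1 s + v s *m mxderiv I (M i.+1) s.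
  rewrite -{1}(mxderivE nJ Js (dv s Js)); apply: (mxderivE nJ Js).
  apply: mx_has_deriv_ext (mx_has_derivM Js (dv s Js) (dsub _ _ _ _ _ Js (cM _ imu))) => // u Ju.
  by rewrite [DPiD _ _ _ _ _](MS i.+1 u) (mulmxA (v u) _ (Dm u)) (mulmxA (v u) (D u)) vPi1 // vR.
have yGD : (y s)^T *m (G i.+1 s *m Dm s *m mxderiv I (M i.+1) s) = v' s - v' s *m M i.+1 s.
  rewrite -(mulmxA (G i.+1 s)) (mulmxA _ (G i.+1 s)) yG1 // (mulmxA (v s *m D s)) vR //.
  by rewrite {1}dM addrC addKr.
rewrite BS mulmxBr -(mulmxA _ (D s)) (mulmxA (y s)^T _ (D s *m _)) yGD.
rewrite (mulmxA (y s)^T) yB -(mulmxA _ (Pi i s)) (mulPiP Is ilt) // mulmxBl.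
rewrite (mulmxA (v' s) (D s) (Pi i s)) opprB addrCA subrr addr0 MS.
rewrite -(mulmxA (v' s) (D s *m Pi i.+1 s *m Dm s)) -(mulmxA (D s *m Pi i.+1 s)) (mulmxA (Dm s)) (mulDmD Is) (mulP0Pi Is).
by rewrite -(mulmxA (D s)) (mulPiPi Is imu) // (mulmxA (v' s)).
Qed.

(* The adjoint state [w = y^T A] solves the adjoint of the inherent explicit ODE;
   its solutions starting in the row space of [M n] stay there. *)
Lemma adjoint_solution_exists n t0 (e : 'rV[R]_k) : n.+1 = mu -> I t0 ->
  exists y : R -> 'cV[R]_m, [/\ mxCn I 0 y,
    forall t, I t -> mx_has_deriv I (fun s => (E s)^T *m y s) t ((F t)^T *m y t)
    & (y t0)^T *m E t0 = e *m D t0 *m Pi n t0].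
Proof.
move=> nmu It0; have nle : (n <= mu)%N by rewrite -nmu.
have [EAD [cA cD] _ _ _] := HAD; have [_ _ _ cPi cM] := adm.
have [_ cB _] := sequence_continuous nle.
have [cG _ _] := sequence_continuous (leqnn mu).
have cDm : mxCn I 0 Dm by exact: mxCn_le Dm_C1.
have cD0 : mxCn I 0 D by exact: mxCn_le cD.
have cMn := cM n nle; have cM0 : mxCn I 0 (M n) by exact: mxCn_le cMn.
have cM' : mxCn I 0 (mxderiv I (M n)) by exact: mxCn_deriv.
have dM t : I t -> mx_has_deriv I (M n) t (mxderiv I (M n) t).
  by move=> It; exact: mxCn_has_deriv cMn.
pose Gi t := invmx (G mu t).
have cGi : mxCn I 0 Gi by apply: (mxCnV niI).
(* For [y^T = w D G_mu^-1] the goal is [y^T B_n = w' D Pi_n]. [Gam] produces the left side, and the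
   added [M_n'] keeps [w] in the row space of [M_n] without contributing to this identity. *)
pose Gam t := D t *m Gi t *m B n t *m Pi n t *m Dm t.
pose Lam t := Gam t + mxderiv I (M n) t.
have cLam : mxCn I 0 Lam.
  exact: (mxCnD niI (mxCnM niI (mxCnM niI (mxCnM niI (mxCnM niI cD0 cGi) cB) (cPi n nle)) cDm) cM').
have [W [W0 HW]] := ode_exists nI It0 (mxCnT cLam) (e *m M n t0)^T.
pose w t := (W t)^T; pose w' t := w t *m Lam t.
have dw t : I t -> mx_has_deriv I w t (w' t).
  by move=> It; have := mx_has_derivT It (HW t It); rewrite trmx_mul trmxK.
have w0 : w t0 = e *m M n t0 by rewrite /w W0 trmxK.
have MMn t : I t -> M n t *m M n t = M n t by move=> It; exact: mulMM.
have dMM t : I t -> mxderiv I (M n) t =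
    mxderiv I (M n) t *m M n t + M n t *m mxderiv I (M n) t.
  move=> It; rewrite -(mxderivE niI It (mx_has_derivM It (dM t It) (dM t It))).
  by apply/esym/(mxderivE niI It); apply: mx_has_deriv_ext (dM t It) => // s Is; rewrite MMn.
have MM'M t : I t -> M n t *m mxderiv I (M n) t *m M n t = 0.
  by move=> It; exact: idem_deriv (MMn t It) (dMM t It).
have DPi t : I t -> M n t *m D t = D t *m Pi n t.
  by move=> It; rewrite MS -(mulmxA (D t *m Pi n t)) (mulDmD It) -(mulmxA (D t)) (mulPiP It nle).
have GamM t : I t -> Gam t *m M n t = Gam t.
  move=> It.
  have DmM : Dm t *m M n t = Pi n t *m Dm t.
    by rewrite MS (mulmxA (Dm t) _ (Dm t)) (mulmxA (Dm t) (D t)) (mulDmD It) (mulP0Pi It).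
  rewrite /Gam -(mulmxA _ (Dm t) (M n t)) DmM (mulmxA _ (Pi n t) (Dm t)).
  by rewrite -(mulmxA _ (Pi n t) (Pi n t)) (mulPiPi It nle).
have wM t : I t -> w t = w t *m M n t.
  move=> It; apply/eqP; rewrite -subr_eq0; apply/eqP.
  have cN : mxCn I 0 (fun t => - (mxderiv I (M n) t *m M n t)^T).
    by apply: (mxCnN niI); apply: mxCnT; apply: (mxCnM niI).
  apply: trmx_inj; rewrite trmx0.
  apply: (ode_unique nI It0 cN (X := fun t => (w t - w t *m M n t)^T)) => // [s Is|]; last first.
    by rewrite w0 -mulmxA MMn // subrr trmx0.
  have := mx_has_derivT Is (mx_has_derivB Is (dw s Is) (mx_has_derivM Is (dw s Is) (dM s Is))).
  congr mx_has_deriv.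
  rewrite mulNmx -trmx_mul -trmxN; congr trmx.
  exact: defect_deriv (GamM s Is) (MM'M s Is).
clearbody w.
pose y t := (w t *m D t *m Gi t)^T.
have yT t : (y t)^T = w t *m D t *m Gi t by rewrite trmxK.
have wDPi t : I t -> w t *m D t *m Pi n t = w t *m D t.
  by move=> It; rewrite -(mulmxA (w t)) -DPi // (mulmxA (w t)) -wM.
have yGmu t : I t -> (y t)^T *m G mu t = w t *m D t.
  by move=> It; rewrite yT /Gi mulmxKV // uG.
have wDP i t : I t -> (i <= n)%N -> w t *m D t *m P i t = w t *m D t.
  by move=> It ile; rewrite -wDPi // -(mulmxA _ (Pi n t)) (mulPiP It nle ile).
(* Descending from [G mu]: [G_i = G_{i+1} P_i], and [w D P_i = w D] because [w = w M_n]. *)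
have yG t : I t -> forall d i, (i + d)%N = mu -> (y t)^T *m G i t = w t *m D t.
  move=> It; elim=> [i|d IH i id]; first by rewrite addn0 => ->; exact: yGmu.
  have ilt : (i < mu)%N by lia.
  have -> : G i t = G i.+1 t *m P i t.
    rewrite GS mulmxDl (mulGP It (ltnW ilt)) -mulmxA.
    have -> : Q i t *m P i t = 0.
      by have [QQ _ _] := Q_spec It (ltnW ilt); rewrite /P /seqP mulmxBr mulmx1 QQ subrr.
    by rewrite mulmx0 addr0.
  rewrite mulmxA IH; last by rewrite addSnnS.
  by apply: wDP => //; lia.
have yGi t i : I t -> (i <= mu)%N -> (y t)^T *m G i t = w t *m D t.
  by move=> It ile; apply: (yG t It (mu - i)%N); rewrite subnKC.
have yBP t i : I t -> (i < mu)%N -> (y t)^T *m (B i t *m P i t) = (y t)^T *m B i t.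
  move=> It ilt; rewrite /P /seqP mulmxBr mulmx1 mulmxBr.
  have := yGi t i.+1 It ilt; rewrite GS mulmxDr yGi // 1?ltnW //.
  by move=> /eqP; rewrite -subr_eq0 addrAC subrr add0r => /eqP ->; rewrite subr0.
have wR t : I t -> w t *m D t *m Dm t = w t.
  by move=> It; rewrite -[in LHS]wDPi // [RHS]wM // MS !(mulmxA (w t)).
(* The recursion for [B] is read backwards. [y^T B_i Q_i = 0] follows by comparing [y^T G_i] with
   [y^T G_{i+1}]. *)
have yB t : I t -> forall d i, (i + d)%N = n -> (y t)^T *m B i t = w' t *m D t *m Pi i t.
  move=> It; elim=> [i|d IH i id].
    rewrite addn0 => ->.
    have wM' : w t *m mxderiv I (M n) t *m (D t *m Pi n t) = 0.
      rewrite -DPi // wM // (mulmxA _ (M n t) (D t)) -(mulmxA (w t) (M n t) (mxderiv I (M n) t)).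
      by rewrite -(mulmxA (w t) _ (M n t)) MM'M // mulmx0 mul0mx.
    have GamDPi : Gam t *m (D t *m Pi n t) = D t *m Gi t *m (B n t *m Pi n t).
      rewrite /Gam -(mulmxA _ (Dm t)) (mulmxA (Dm t)) (mulDmD It) (mulP0Pi It).
      by rewrite -(mulmxA _ (Pi n t) (Pi n t)) (mulPiPi It nle) // -(mulmxA _ (B n t)).
    rewrite -(yBP t n It) -?nmu // -(mulBPi It nle) -(mulmxA (w' t)) /w' /Lam.
    rewrite mulmxDr mulmxDl wM' addr0 -(mulmxA (w t)) GamDPi yT.
    by rewrite (mulmxA (w t)) (mulmxA (w t) (D t)).
  have iltn : (i < n)%N by lia.
  have i1mu : (i.+1 <= mu)%N by lia.
  have := IH i.+1; rewrite addSnnS => /(_ id).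
  have dM1 : w' t = w' t *m M i.+1 t + w t *m mxderiv I (M i.+1) t.
    have dMi : mx_has_deriv I (M i.+1) t (mxderiv I (M i.+1) t).
      by apply: mxCn_has_deriv => //; exact: cM.
    rewrite -{1}(mxderivE niI It (dw t It)); apply: (mxderivE niI It).
    apply: mx_has_deriv_ext (mx_has_derivM It (dw t It) dMi) => // s Is.
    by rewrite [w s in LHS]wM // -mulmxA (mulMM Is nle iltn) -wM.
  rewrite BS mulmxBr yBP //.
  have -> : (y t)^T *m (G i.+1 t *m Dm t *m mxderiv I (M i.+1) t *m D t *m Pi i t) =
      (w' t - w' t *m M i.+1 t) *m (D t *m Pi i t).
    rewrite -(mulmxA _ (D t)) (mulmxA (y t)^T) -(mulmxA (G i.+1 t)) (mulmxA (y t)^T) yGi //.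
    by rewrite (mulmxA (w t *m D t)) wR // {1}dM1 addrC addKr.
  rewrite mulmxBl MS.
  rewrite -(mulmxA (w' t) (D t *m Pi i.+1 t *m Dm t)) -(mulmxA (D t *m Pi i.+1 t)).
  rewrite (mulmxA (Dm t)) (mulDmD It) (mulP0Pi It) -(mulmxA (D t)) (mulPiPi It i1mu) //.
  rewrite (mulmxA (w' t) (D t) (Pi i.+1 t)) (mulmxA (w' t) (D t) (Pi i t)) opprB => /eqP.
  by rewrite -subr_eq0 addrAC addrA subrK subr_eq0 => /eqP.
(* At level 0 the identity is [y^T (F - A D') = w' D]; with [y^T A = w] it becomes
   [y^T F = (w D)']. *)
have yF t : I t -> (y t)^T *m F t = w' t *m D t + w t *m mxderiv I D t.
  move=> It; have := yB t It n 0%N (add0n n).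
  rewrite -(mulmxA (w' t)) [D t *m Pi 0 t](mulDP0 It) {1}/B /= mulmxBr => <-.
  have -> : (y t)^T *m (A t *m mxderiv I D t) = w t *m mxderiv I D t.
    have /= := yGi t 0%N It (leq0n mu) => yE.
    have : (y t)^T *m G 0 t *m Dm t = w t by rewrite yE wR.
    by rewrite (G0 It) EAD // -mulmxA (mulADDm It) mulmxA => ->.
  by rewrite subrK.
exists y; split.
- by apply: mxCnT; apply: (mxCnM niI) => //; apply: (mxCnM niI) => //; apply: mx_has_deriv_cont => t It; exists (w' t); exact: dw.
- move=> t It.
  have dD : mx_has_deriv I D t (mxderiv I D t) by exact: mxCn_has_deriv cD.
  have -> : (F t)^T *m y t = (w' t *m D t + w t *m mxderiv I D t)^T.
    by rewrite -yF // trmx_mul trmxK.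
  apply: mx_has_deriv_ext (mx_has_derivT It (mx_has_derivM It (dw t It) dD)) => // s Is.
  have := yGi s 0%N Is (leq0n mu); rewrite (G0 Is) => <-.
  by rewrite trmx_mul trmxK.
have := yGi t0 0%N It0 (leq0n mu); rewrite (G0 It0) => ->.
by rewrite w0 -(mulmxA e) DPi // mulmxA.
Qed.

End MatrixSequences.

(** * Duality of the canonical subspaces *)

Section CanonicalDuality.
Context {R : realType}.
Variables (I : set R) (m : nat).
Hypothesis nI : nondeg_itv I.
Let niI : no_isolated I := nondeg_no_isolated nI.

Lemma Scan_ext (E F E' F' : R -> 'M[R]_m) t :
  (forall s, I s -> E s = E' s /\ F s = F' s) -> Scan I E F t = Scan I E' F' t.
Proof.
move=> H; rewrite predeqE => x; split=> -[d [y [d0 cy yt Hy]]]; exists d, y; split=> // s Js;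
  by have [e1 e2] := H s Js.2; have := Hy s Js; rewrite e1 e2.
Qed.

Lemma adj_restrict_deriv (E F : R -> 'M[R]_m) J (y : R -> 'cV[R]_m) s : no_isolated J -> J `<=` I ->
  mxCn I 1 E -> J s -> mxCn J 1 y ->
  adjE E s *m mxderiv J y s + adjF I E F s *m y s = 0 <->
  mx_has_deriv J (fun s => (E s)^T *m y s) s ((F s)^T *m y s).
Proof.
move=> nJ JI cE Js cy; have Is := JI _ Js.
have dET := mx_has_derivT Is (mxCn_has_deriv niI Is cE).
have dy := mxCn_has_deriv nJ Js cy.
have dP := mx_has_derivM Js (mx_has_deriv_sub JI dET) dy.
rewrite (adjFE nI _ Is (mxCn_has_deriv niI Is cE)) /adjE mulNmx mulmxBl addrCA.
rewrite -opprD; split=> [/eqP|dF].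
  by rewrite subr_eq0 addrC => /eqP ->.
by rewrite [X in _ - X]addrC -(mxderivE nJ Js dP) (mxderivE nJ Js dF) subrr.
Qed.

(** Each inclusion is proved for arbitrary admissible data, so all such data give the same kernel.
    Inhabitants of [Ncan] are required because they carry the data from which adjoint solutions are
    built. *)
Theorem Ncan_duality n (E F : R -> 'M[R]_m) r theta d (C : R -> 'M[R]_(m, d)) :
  mxCn I n.*2.+3 E -> mxCn I n.*2.+2 F -> Reg I n (adjE E) (adjF I E F) r theta ->
  basis_on I C (Scan I (adjE E) (adjF I E F)) ->
  (forall t, I t -> exists x, Ncan I E F n.+1 t x) ->
  forall t, I t -> Ncan I E F n.+1 t = [set` kerc ((C t)^T *m E t)].
Proof.
move=> cE cF HR /basis_onP HC ex t It.
have cE1 : mxCn I 1 E by exact: mxCn_le cE.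
have cF0 : mxCn I 0 F by exact: mxCn_le cF.
have [_ /= HCt] := HC t It.
rewrite predeqE => x; split=> [|/kercP Cx].
  move=> [k [A [D [Dm [Q [HAD [cQ0 HQ0] HDm [adm uG] /kercP Pix]]]]]].
  apply/kercP; apply: trmx_inj; rewrite trmx0 -mulmxA trmx_mul trmxK.
  apply: mulmx_cols_eq0 => u.
  have [del [y [d0 cy yt Hy]]] : Scan I (adjE E) (adjF I E F) t (C t *m u) by apply/HCt; exists u.
  set J := _ `&` I in cy Hy.
  have nJ : no_isolated J by apply: nondeg_no_isolated; exact: nondeg_itvI.
  have JI : J `<=` I by move=> s [].
  have Jt : J t by split=> //=; rewrite in_itv /=; apply/andP; split; lra.
  have dy s : J s -> mx_has_deriv J (fun s => (E s)^T *m y s) s ((F s)^T *m y s).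
    by move=> Js; apply/(adj_restrict_deriv _ nJ) => //; exact: Hy.
  have /= := adjoint_solution_kills nI HAD cQ0 HQ0 HDm adm uG nJ JI dy (leqnSn n) Jt.
  rewrite yt => yE; apply: trmx_inj.
  by rewrite trmx_mul trmxK mulmxA -yE -(mulmxA _ _ x) Pix mulmx0 trmx0.
have [x0 [k [A [D [Dm [Q [HAD [cQ0 HQ0] HDm [adm uG] _]]]]]]] := ex t It.
exists k, A, D, Dm, Q; split=> //; apply/kercP.
(* Enough because [Pi_n = P_0 Pi_n = D^- D Pi_n]. *)
suff DPx : D t *m (seqPi Q n t *m x) = 0.
  have := mulP0Pi HAD HQ0 adm It n; have /= <- := mulDmD HDm It => <-.
  by rewrite -!mulmxA DPx mulmx0.
(* With this [e], the adjoint solution [y] satisfies [y^T E x = e D Pi_n x], the squared norm of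
   [D Pi_n x]; the left side is 0 since [y t] is in the range of [C t]. *)
apply: mulmx_tr_eq0; set e := (D t *m _)^T.
have [y [cy Hy yt]] := adjoint_solution_exists nI cF0 HAD cQ0 HQ0 HDm adm uG e (erefl n.+1) It.
rewrite mulmxA mulmxA -yt.
have [cA cB] : mxCn I n.*2.+2 (adjE E) /\ mxCn I n.*2.+2 (adjF I E F).
  split; first by apply: (mxCnN niI); apply: mxCnT; exact: mxCn_le cE.
  exact: (mxCnB niI (mxCnT cF) (mxCn_deriv niI (mxCnT cE))).
have wy : weak_sol I (adjE E) (adjF I E F) y.
  split=> // s Is; have dET := mx_has_derivT Is (mxCn_has_deriv niI Is cE1).
  have := mx_has_derivN Is (Hy s Is).
  have -> : mxderiv I (adjE E) s = - (mxderiv I E s)^T.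
    by apply: (mxderivE niI Is); exact: mx_has_derivN.
  rewrite (adjFE nI _ Is (mxCn_has_deriv niI Is cE1)) opprB addrA addNr sub0r mulNmx.
  by apply: mx_has_deriv_ext => // u _; rewrite /adjE mulNmx.
have cy1 := weak_sol_C1 nI cA cB HR wy.
have [u Eu] : exists u, y t = C t *m u.
  apply/HCt; exists 1, y => J.
  have nJ : no_isolated J by apply: nondeg_no_isolated; exact: nondeg_itvI.
  have JI : J `<=` I by move=> s [].
  have cyJ : mxCn J 1 y by exact: mxCn_restrict cy1.
  split=> // s Js; apply/(adj_restrict_deriv _ nJ) => //.
  by apply: (mx_has_deriv_sub JI); exact: Hy (JI _ Js).
by rewrite Eu trmx_mul -mulmxA -(mulmxA u^T) (mulmxA (C t)^T) Cx mulmx0.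
Qed.

End CanonicalDuality.

Theorem theorem6p2 (R : realType) (m mu : nat) :
  exists K : nat,
  forall (I : set R) (E F : R -> 'M[R]_m) (r : nat) (theta : nat -> nat),
    is_interval I -> (exists a b : R, [/\ I a, I b & a < b]) ->
    mxCn I K E -> mxCn I K F ->
    regular I E F mu r theta ->
    regular I (adjE E) (adjF I E F) mu r theta /\
    forall (dS dN dSs dNs : nat)
           (C_Scan : R -> 'M[R]_(m, dS)) (C_Ncan : R -> 'M[R]_(m, dN))
           (C_Sstarcan : R -> 'M[R]_(m, dSs)) (C_Nstarcan : R -> 'M[R]_(m, dNs)),
      basis_on I C_Scan (Scan I E F) ->
      basis_on I C_Ncan (Ncan I E F mu) ->
      basis_on I C_Sstarcan (Scan I (adjE E) (adjF I E F)) ->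
      basis_on I C_Nstarcan (Ncan I (adjE E) (adjF I E F) mu) ->
      forall t : R, I t ->
        Ncan I E F mu t = [set` kerc ((C_Sstarcan t)^T *m E t)] /\
        Ncan I (adjE E) (adjF I E F) mu t = [set` kerc ((C_Scan t)^T *m (E t)^T)].
Proof.
(* Two derivatives per level, plus a margin that also covers [E'] in the adjoint coefficient; the
   constant is not optimised. *)
exists mu.*2.+4 => I E F r theta iI ab cE cF reg.
have nI : nondeg_itv I by [].
have niI := nondeg_no_isolated nI.
have exI : exists t, I t by have [a [_ [Ia _ _]]] := ab; exists a.
have [mu0 rm HR] := regular_Reg exI reg.
case: mu mu0 cE cF HR {reg} => // n _ cE cF HR /=.
have le k p q (M : R -> 'M[R]_(p, q)) : (k <= n.+1.*2.+4)%N -> mxCn I n.+1.*2.+4 M -> mxCn I k M.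
  by move=> kn; apply: mxCn_le.
have cE1 : mxCn I 1 E by exact: le cE.
have HA : Reg I n (adjE E) (adjF I E F) r theta.
  by apply: (adj_Reg nI) HR; apply: le => //; rewrite doubleS; lia.
have HAA : Reg I n (adjE (adjE E)) (adjF I (adjE E) (adjF I E F)) r theta.
  by apply: (Reg_eqv niI _ HR); apply: eqv_ext => // t It; exact: adj_adj.
split; first exact: Reg_regular.
move=> dS dN dSs dNs CS CN CSs CNs bS bN bSs bNs t It.
(* A set with a basis contains 0. For [Ncan] this means that admissible data exist. *)
have ne k (C : R -> 'M[R]_(m, k)) V : basis_on I C V -> forall s, I s -> exists x, V s x.
  by move=> /basis_onP H s Is; have [_ HV] := H s Is; exists (C s *m 0); apply/HV; exists 0.
split; first apply: (Ncan_duality nI _ _ HA bSs (ne _ _ _ bN)) => //.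
- by apply: le cE; rewrite doubleS; lia.
- by apply: le cF; rewrite doubleS; lia.
(* The second identity is the first one for the adjoint pair, whose adjoint is the original pair.
   The sign in [adjE] does not affect the kernel. *)
have bS' : basis_on I CS (Scan I (adjE (adjE E)) (adjF I (adjE E) (adjF I E F))).
  move/basis_onP: bS => bS; apply/basis_onP => s Is.
  rewrite -(@Scan_ext _ _ _ E F); first exact: bS.
  by move=> u Iu; have [-> ->] := adj_adj nI F cE1 Iu.
rewrite (Ncan_duality nI _ _ HAA bS' (ne _ _ _ bNs)) //.
- rewrite /adjE mulmxN predeqE => x; split=> /kercP h; apply/kercP; move: h.
    by rewrite mulNmx => /eqP; rewrite oppr_eq0 => /eqP.
  by rewrite mulNmx => ->; rewrite oppr0.
- by apply: (mxCnN niI); apply: mxCnT; apply: le cE; rewrite doubleS; lia.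
apply: (mxCnB niI); first by apply: mxCnT; apply: le cF; rewrite doubleS; lia.
by apply: (mxCn_deriv niI); apply: mxCnT; apply: le cE; rewrite doubleS; lia.
Qed.
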